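(* Let $T>0$, let $A,B\in C([0,\infty);\mathcal L(\mathbb R^n))$ where, for some $\gamma>0$, $B(t)B^*(t)\ge\gamma^2 I$ for all $t\in[0,\infty)$, and let $\sigma:\mathbb R^n\to\mathcal L(\mathbb R^d,\mathbb R^n)$ be Lipschitz continuous. Then there exist constants $\eta>0$ and $C^*>0$ such that for every $x\in\mathbb R^n$, every $y\in\mathbb R^n$ with $\sigma(y)=0$, and every $\rho>0$ (so $\eta$ and $C^*$ are independent of $\rho,x,y$) the following holds. There is an $(\mathcal F_t)_{t\ge0}$-adapted controller $u^*\in L^\infty((0,T)\times\Omega;\mathbb R^n)$ such that, denoting by $X=X^{u^*}$ the solution of $$dX+A(t)X\,dt=\sigma(X)\,dW+B(t)u^*\,dt,\qquad X(0)=x,$$ and setting $\tau=\inf\{t\ge0:\ |X^{u^*}(t)-y|=0\}$, one has $$\mathbb P(\tau\le T)\ \ge\ 1-(\rho\eta)^{-1}\Big(|y|+(1-e^{-C^*T})^{-1}|x-y|\Big).$$ Moreover, $u^*$ is expressed in the feedback form $$u^*(t)\in-\rho\,\operatorname{sign}\big(B^*(t)(X(t)-y)\big),\qquad t\in(0,T).$$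
   Context: $\{\beta_j\}_{j=1}^d$ is a system of independent real Brownian motions on a probability space $(\Omega,\mathcal F,\mathbb P)$, $(\mathcal F_t)_{t\ge0}$ is the corresponding (augmented) filtration, and $\sigma(X)\,dW=\sum_{j=1}^d\sigma_{\cdot j}(X)\,d\beta_j$, where $\sigma_{\cdot j}$ is the $j$-th column of $\sigma$. $\mathcal L(\mathbb R^d,\mathbb R^n)$ is the space of linear maps (matrices), $\mathcal L(\mathbb R^n)=\mathcal L(\mathbb R^n,\mathbb R^n)$, $B^*(t)$ is the transpose of $B(t)$, and $|\cdot|$ is the Euclidean norm. The multivalued map $\operatorname{sign}:\mathbb R^n\to 2^{\mathbb R^n}$ is $\operatorname{sign} z=\{z/|z|\}$ if $z\neq0$ and $\operatorname{sign} 0=\{\theta\in\mathbb R^n:|\theta|\le1\}$. *)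

(* Defs.v *)
From HB Require Import structures.
From mathcomp Require Import all_boot all_order all_algebra.
From mathcomp Require Import all_classical all_reals all_analysis.

Set Implicit Arguments.
Unset Strict Implicit.
Unset Printing Implicit Defensive.

Import Order.TTheory GRing.Theory Num.Theory.
Import numFieldNormedType.Exports.

Local Open Scope classical_set_scope.
Local Open Scope ring_scope.

Section Euclidean.
Context {R : realType}.

(* The library norm on matrices is the max norm; this one is the Euclidean
   (Frobenius) norm. *)
Definition enorm m n (M : 'M[R]_(m, n)) : R :=
  Num.sqrt (\sum_i \sum_j M i j ^+ 2).

Definition lipschitz_map n m p (f : 'cV[R]_n -> 'M[R]_(m, p)) : Prop :=
  exists L : R, forall x y, enorm (f x - f y) <= L * enorm (x - y).

Definition psd n (M : 'M[R]_n) : Prop :=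
  forall v : 'cV[R]_n, 0 <= (v^T *m M *m v) 0 0.

Definition sign_map n (z : 'cV[R]_n) : set 'cV[R]_n :=
  if z == 0 then [set theta | enorm theta <= 1]
  else [set (enorm z)^-1 *: z].

End Euclidean.

Section Stochastic.
Context {R : realType} {dO : measure_display} {Omega : measurableType dO}.
Variable P : probability Omega R.
Implicit Types (W X phi : R -> Omega -> R) (F : R -> set (set Omega)).

Definition sigma_process W (D : set R) : set (set Omega) :=
  <<s \bigcup_(s in D) preimage_set_system setT (W s) measurable >>.

(* Each system below contains setT, so that the product rule over the whole
   finite family covers all its subfamilies. *)
Definition mutually_independent (I : finType) (G : I -> set (set Omega)) :
    Prop :=
  forall E : I -> set Omega, (forall i, G i (E i)) ->
    P (\bigcap_i E i) = (\prod_i P (E i))%E.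

Record brownian_motion W : Prop := BrownianMotion {
  bm_measurable : forall t, 0 <= t -> measurable_fun setT (W t) ;
  bm_start : {ae P, forall w, W 0 w = 0} ;
  bm_indep : forall s t, 0 <= s -> s < t ->
    forall (A : set Omega) (U : set R),
      sigma_process W `[0, s] A -> measurable U ->
      let V := (fun w => W t w - W s w) @^-1` U in
      P (A `&` V) = (P A * P V)%E ;
  (* the second argument of normal_prob is the standard deviation *)
  bm_normal : forall s t, 0 <= s -> s < t ->
    forall U : set R, measurable U ->
      P ((fun w => W t w - W s w) @^-1` U) =
      normal_prob 0 (Num.sqrt (t - s)) U ;
  bm_continuous :
    {ae P, forall w, {within `[0, +oo[, continuous (fun t : R => W t w)}} }.

Definition independent_brownian_motions d (beta : 'I_d -> R -> Omega -> R) :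
    Prop :=
  (forall j, brownian_motion (beta j)) /\
  mutually_independent (fun j => sigma_process (beta j) `[0, +oo[).

Definition augmented_filtration d (beta : 'I_d -> R -> Omega -> R) (t : R) :
    set (set Omega) :=
  <<s (\bigcup_j \bigcup_(s in `[0, t])
         preimage_set_system setT (beta j s) measurable)
      `|` [set N | measurable N /\ P N = 0%E] >>.

Definition wrt (G : set (set Omega)) (Y : Omega -> R) : Prop :=
  forall U : set R, measurable U -> G (Y @^-1` U).

Definition adapted F n (D : set R) (X : R -> Omega -> 'cV[R]_n) : Prop :=
  forall t, D t -> forall i, wrt (F t) (fun w => X t w i 0).

(* \sum_(k < N) xi_k 1_(]t_k, t_(k+1)]) with xi_k bounded and
   F_(t_k)-measurable. *)
Record simple_process F := SimpleProcess {
  sp_size : nat ;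
  sp_time : nat -> R ;
  sp_val : nat -> Omega -> R ;
  sp_time_ge0 : 0 <= sp_time 0 ;
  sp_time_le : forall k, sp_time k <= sp_time k.+1 ;
  sp_val_wrt : forall k, wrt (F (sp_time k)) (sp_val k) ;
  sp_val_bounded : forall k, exists M, forall w, `|sp_val k w| <= M }.

Definition sp_eval F (S : simple_process F) (t : R) (w : Omega) : R :=
  \sum_(k < sp_size S) sp_val S k w * \1_(`]sp_time S k, sp_time S k.+1]) t.

Definition sp_integral F (S : simple_process F) W (t : R) (w : Omega) : R :=
  \sum_(k < sp_size S) sp_val S k w *
    (W (Num.min (sp_time S k.+1) t) w - W (Num.min (sp_time S k) t) w).

(* J is a version of the Ito integral of phi against W over [0, t]: the L^2
   limit of the integrals of simple processes that approximate phi in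
   L^2(Omega x [0, t]). *)
Definition is_ito_integral F W phi (t : R) (J : Omega -> R) : Prop :=
  measurable_fun setT J /\
  exists S : nat -> simple_process F,
    ((fun m => \int[P]_w \int[lebesgue_measure]_(s in `[0%R, t])
        ((sp_eval (S m) s w - phi s w) ^+ 2)%:E)%E @ \oo --> 0%E) /\
    ((fun m => \int[P]_w ((sp_integral (S m) W t w - J w) ^+ 2)%:E)%E
       @ \oo --> 0%E).

(* u represents an element of L^oo((0, T) x Omega; R^n). *)
Definition Linfty_control n (T : R) (u : R -> Omega -> 'cV[R]_n) : Prop :=
  (forall i, measurable_fun (`]0, T[ `*` setT)
     (fun p : R * Omega => u p.1 p.2 i 0)) /\
  exists M : R, {ae (lebesgue_measure \x P)%E, forall p : R * Omega,
    0 < p.1 < T -> enorm (u p.1 p.2) <= M}.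

(* Continuous adapted solution on [0, T] of
   dX + A X dt = sigma(X) dW + B u dt, X(0) = x.  Paths are continuous for
   every w, which is no restriction as the filtration is augmented. *)
Definition sde_solution n d (beta : 'I_d -> R -> Omega -> R) (T : R)
    (A B : R -> 'M[R]_n) (sigma : 'cV[R]_n -> 'M[R]_(n, d))
    (u : R -> Omega -> 'cV[R]_n) (x : 'cV[R]_n)
    (X : R -> Omega -> 'cV[R]_n) : Prop :=
  [/\ forall w, {within `[0, T], continuous (fun t : R => X t w)},
      adapted (augmented_filtration beta) `[0, T] X &
      forall t, 0 <= t <= T ->
        exists J : 'I_n -> 'I_d -> Omega -> R,
          (forall i j, is_ito_integral (augmented_filtration beta) (beta j)
             (fun s w => sigma (X s w) i j) t (J i j)) /\
          {ae P, forall w, forall i,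
             X t w i 0
             + \int[lebesgue_measure]_(s in `[0, t]) (A s *m X s w) i 0
             = x i 0 + \sum_j J i j w
               + \int[lebesgue_measure]_(s in `[0, t]) (B s *m u s w) i 0}].

(* First time in [0, T] at which X reaches y; +oo if there is none. *)
Definition hitting_time n (T : R) (X : R -> Omega -> 'cV[R]_n)
    (y : 'cV[R]_n) (w : Omega) : \bar R :=
  ereal_inf [set t%:E | t in [set t : R | 0 <= t <= T /\ enorm (X t w - y) = 0]].

End Stochastic.

(* Main.v *)
(* The controlled process is built without Ito's formula, as the limit of explicit Euler schemes
   on dyadic grids in which the control is frozen at [- rho * sgn(B^* (X - y))] over each step.
   The sign is discontinuous but monotone, so a discrete Gronwall argument shows that the schemes
   are Cauchy in mean square, and Kolmogorov's maximal inequality makes a subsequence converge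
   uniformly for almost every path.  The drift of the limit is pathwise Lipschitz, hence the
   integral of its derivative; since [B] is invertible the derivative determines a control, and as
   an average of feedback values it still satisfies [|u| <= rho] and
   [<u, z> <= - rho |z|] with [z = B^* (X - y)], which by the equality case of Cauchy-Schwarz
   is the sign inclusion.

   Because [sigma(y) = 0] and [|B^* v| >= gamma |v|], as long as [X] stays away from [y] the
   distance [|X - y|] is, up to the factor [exp (C t)], a supermartingale that decreases at rate at
   least [rho gamma - |A| |y|].  Integrating over [[0, T]] bounds the probability of not hitting by
   [exp (C T) |x - y| / (T (rho gamma - |A| |y|))].  When [rho eta <= |y|] the claimed bound is
   trivial, otherwise the rate is at least [rho gamma / 2], so [Cstar = 1] and a small [eta]
   suffice. *)

(* The controls frozen along the scheme oscillate with the discontinuous sign and need not converge,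
   so no limit of controls is ever taken: the drifts converge, and the control is read off
   afterwards. It must be adapted, jointly measurable and satisfy the sign law at every time, also
   where the derivative of the drift fails to exist. Hence derivatives are taken from the left, as
   upper limits that always exist, and the candidate is replaced by a selection of the sign whenever
   it violates the law.

   Second moments of Gaussian increments are only bounded, by 8 times the variance, while
   orthogonality to the past is exact. The constant 8 thus stands where Ito's isometry has 1; it
   merely enlarges exponential rates.

   That [eta] does not depend on [rho] rests on using the control only through its sign in the
   hitting estimate: [rho] enters the rate of approach, whereas the exponent contains just the bound
   of [A] and the Lipschitz constant of [sigma]. Quadratic terms of the drift do depend on [rho],
   but they carry a factor of the mesh size and vanish in the limit. *)
Require Import Defs.
From HB Require Import structures.
From mathcomp Require Import all_boot all_order all_algebra.
From mathcomp Require Import ring lra.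
From mathcomp Require Import all_classical all_reals all_analysis.
From mathcomp Require Import measurable_realfun.

Set Implicit Arguments.
Unset Strict Implicit.
Unset Printing Implicit Defensive.

Import Order.TTheory GRing.Theory Num.Theory.
Import numFieldNormedType.Exports.

Local Open Scope classical_set_scope.
Local Open Scope ring_scope.

(** * Gaussian increments *)

Section gaussian.
Context {R : realType}.
Local Notation mu := (@lebesgue_measure R).
Local Open Scope ereal_scope.

(** The Radon-Nikodym derivative of [normal_prob] and [normal_pdf] have equal integrals over every
    measurable set, hence agree almost everywhere; the change of variables for the former then gives
    the formula. *)
Lemma ge0_integral_normal_prob (m s : R) (f : R -> \bar R) :
  measurable_fun setT f -> (forall x, 0 <= f x) ->
  \int[normal_prob m s]_x f x = \int[mu]_x (f x * (normal_pdf m s x)%:E).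
Proof.
move=> mf f0.
have dom := @normal_prob_dominates R m s.
rewrite -(Radon_Nikodym_SigmaFinite.change_of_variables dom)//.
apply: ae_eq_integral => //.
- apply: emeasurable_funM => //.
  exact: (measurable_int _ (Radon_Nikodym_SigmaFinite.f_integrable dom)).
- apply: emeasurable_funM => //.
  by apply/measurable_EFinP; exact: measurable_normal_pdf.
suff H : ae_eq mu setT (Radon_Nikodym_SigmaFinite.f (normal_prob m s) mu) (fun x => (normal_pdf m s x)%:E).
  by apply: filterS H => x /(_ I) Hx _ /=; rewrite Hx.
apply: integral_ae_eq => //.
- exact: Radon_Nikodym_SigmaFinite.f_integrable.
- by apply/measurable_EFinP; exact: measurable_normal_pdf.
- move=> E _ mE.
  by rewrite -(Radon_Nikodym_SigmaFinite.f_integral dom).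
Qed.

(* The density of variance [s ^+ 2] times [x ^+ 2] is at most [8 * s ^+ 2] times the
   density of variance [2 * s ^+ 2]; the exact moment is never needed. *)
Lemma integral_normal_prob_sqr (s : R) : (0 < s)%R ->
  \int[normal_prob 0 s]_x (x ^+ 2)%:E <= (8 * s ^+ 2)%:E.
Proof.
move=> s0.
have s1 : (0 < Num.sqrt 2 * s)%R by rewrite mulr_gt0// sqrtr_gt0.
have e2 : (Num.sqrt 2 ^+ 2 = 2 :> R)%R by rewrite sqr_sqrtr.
rewrite ge0_integral_normal_prob//; last 2 first.
  by apply/measurable_EFinP; exact: exprn_measurable.
  by move=> x; rewrite lee_fin sqr_ge0.
apply: (@le_trans _ _ (\int[mu]_x ((8 * s ^+ 2)%:E * (normal_pdf 0 (Num.sqrt 2 * s) x)%:E))); last first.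
  rewrite ge0_integralZl//=.
  - by rewrite integral_normal_pdf mule1.
  - by apply/measurable_EFinP; exact: measurable_normal_pdf.
  - by move=> x _; rewrite lee_fin normal_pdf_ge0.
  - by rewrite lee_fin mulr_ge0// sqr_ge0.
apply: ge0_le_integral => //.
- by move=> x _; rewrite lee_fin mulr_ge0 ?sqr_ge0 ?normal_pdf_ge0.
- apply/measurable_EFinP/measurable_funM; first exact: exprn_measurable.
  exact: measurable_normal_pdf.
- apply/measurable_EFinP/measurable_funM => //.
  exact: measurable_normal_pdf.
move=> x _; rewrite -!EFinM lee_fin !normal_pdfE ?gt_eqF//.
rewrite /normal_peak /normal_fun !subr0 exprMn e2.
have -> : Num.sqrt (2 * s ^+ 2 * pi *+ 2) = (Num.sqrt 2 * Num.sqrt (s ^+ 2 * pi *+ 2))%R.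
  by rewrite -sqrtrM//; congr Num.sqrt; ring.
set S := Num.sqrt (s ^+ 2 * pi *+ 2).
have S0 : (0 < S)%R.
  by rewrite sqrtr_gt0 pmulrn_lgt0// mulr_gt0 ?pi_gt0// exprn_gt0.
(* In terms of [v] the density of variance s^2 carries exp(-v) twice. One copy absorbs x^2 = 4 s^2 v
   through v exp(-v) <= 1, the other belongs to the density of variance 2 s^2; the ratio of the
   peaks leaves 4 sqrt 2 <= 8. *)
pose v := (x ^+ 2 / (4 * s ^+ 2))%R.
have s20 : (s ^+ 2 != 0)%R by rewrite gt_eqF// exprn_gt0.
have -> : (- x ^+ 2 / (s ^+ 2 *+ 2) = - v + - v)%R by rewrite /v; field; rewrite gt_eqF.
have -> : (- x ^+ 2 / (2 * s ^+ 2 *+ 2) = - v)%R by rewrite /v; field; rewrite gt_eqF.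
have -> : (x ^+ 2 = 4 * s ^+ 2 * v)%R by rewrite /v; field; rewrite gt_eqF.
have v0 : (0 <= v)%R by rewrite /v divr_ge0 ?sqr_ge0// mulr_ge0// sqr_ge0.
rewrite expRD invfM.
have vexp : (v * expR (- v) <= 1)%R.
  rewrite expRN ler_pdivrMr ?expR_gt0// mul1r.
  by have := expR_ge1Dx v; lra.
have r2 : (Num.sqrt 2 <= 2 :> R)%R.
  rewrite -[leRHS]ger0_norm// -sqrtr_sqr ler_sqrt//; rewrite expr2; lra.
have r0 : (0 < Num.sqrt 2 :> R)%R by rewrite sqrtr_gt0.
have E0 := expR_gt0 (- v).
rewrite -(@ler_pM2r _ S)// -(@ler_pM2r _ (Num.sqrt 2))//.
have -> : (8 * s ^+ 2 * ((Num.sqrt 2)^-1 / S * expR (- v)) * S * Num.sqrt 2 = 8 * s ^+ 2 * expR (- v))%R.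
  by field; rewrite !gt_eqF.
have -> : (4 * s ^+ 2 * v * (S^-1 * (expR (- v) * expR (- v))) * S * Num.sqrt 2 =
   (4 * s ^+ 2 * expR (- v)) * ((v * expR (- v)) * Num.sqrt 2))%R by field; rewrite gt_eqF.
have -> : (8 * s ^+ 2 * expR (- v) = (4 * s ^+ 2 * expR (- v)) * 2)%R by ring.
apply: ler_wpM2l; first by rewrite mulr_ge0 ?mulr_ge0 ?sqr_ge0// ltW.
apply: (le_trans _ r2); rewrite -[leRHS]mul1r ler_wpM2r// ltW//.
Qed.

Lemma integrable_normal_prob_id (s : R) : (0 < s)%R ->
  (normal_prob 0 s).-integrable setT (fun x : R => x%:E).
Proof.
move=> s0; apply/integrableP; split; first exact/measurable_EFinP.
have H : \int[normal_prob 0 s]_x (1 + x ^+ 2)%:E < +oo.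
  under eq_integral do rewrite EFinD.
  rewrite ge0_integralD//=.
  - rewrite integral_cst//= mul1e probability_setT.
    by apply: (@le_lt_trans _ _ (1 + (8 * s ^+ 2)%:E)); rewrite ?leeD2l ?integral_normal_prob_sqr// ltry.
  - by move=> x _; rewrite lee_fin sqr_ge0.
  - by apply/measurable_EFinP; exact: exprn_measurable.
apply: (le_lt_trans _ H); apply: ge0_le_integral => //=.
- by apply/measurable_EFinP; exact: normr_measurable.
- by apply/measurable_EFinP; apply: measurable_funD => //; exact: exprn_measurable.
move=> x _; rewrite lee_fin.
have := sqr_ge0 (`|x| - 1)%R; rewrite -(real_normK (num_real x)).
by have := normr_ge0 x; nra.
Qed.

(** The density is even, so the substitution x -> -x carries the integral of the negative part to
    that of the positive part; both are finite and cancel. *)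
Lemma integral_normal_prob_id (s : R) : (0 < s)%R ->
  \int[normal_prob 0 s]_x x%:E = 0.
Proof.
move=> s0; have int := integrable_normal_prob_id s0.
rewrite (integralE (normal_prob 0 s) setT (fun x => x%:E)).
have -> : \int[normal_prob 0 s]_x ((fun y : R => y%:E)^\- x) = \int[normal_prob 0 s]_x ((fun y : R => y%:E)^\+ x).
  rewrite !ge0_integral_normal_prob//; last 2 first.
    by apply: measurable_funepos; exact/measurable_EFinP.
    by apply: measurable_funeneg; exact/measurable_EFinP.
  pose G (x : R) := (`|x| * normal_pdf 0 s x)%R.
  have cG : continuous G.
    by move=> x; apply: cvgM; [exact: norm_continuous|apply: continuous_normal_pdf; rewrite gt_eqF].
  transitivity (\int[mu]_(x in `]-oo, (- 0)%R]) (G x)%:E).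
    rewrite [RHS]integral_mkcond; apply: eq_integral => x _.
    rewrite patchE funenegE /G oppr0 /= -EFin_max -EFinM.
    case: ifPn; rewrite ?notin_setE ?inE/= in_itv/= => x0.
      by rewrite ler0_norm// max_l// oppr_ge0.
    by rewrite max_r ?mul0r// oppr_le0 ltW// ltNge; exact/negP.
  rewrite ge0_integration_by_substitutionNy; last 2 first.
    exact: continuous_subspaceT.
    by move=> x _; rewrite /G mulr_ge0 ?normal_pdf_ge0.
  rewrite [LHS]integral_mkcond; apply: eq_integral => x _.
  rewrite patchE funeposE /G /= -EFin_max -EFinM.
  case: ifPn; rewrite ?notin_setE ?inE/= in_itv/= ?andbT => x0.
    rewrite normrN ger0_norm// max_l//.
    have -> // : normal_pdf 0 s (- x) = normal_pdf 0 s x.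
    by rewrite !normal_pdfE ?gt_eqF// /normal_fun !subr0 sqrrN.
  by rewrite max_r ?mul0r// ltW// ltNge; exact/negP.
apply: subee; apply: integrable_fin_num => //.
exact: integrable_funepos.
Qed.
End gaussian.

(** * Expectations of products of independent variables *)

Section independence.
Context {R : realType} {dO : measure_display} {Omega : measurableType dO}.
Variable P : probability Omega R.
Local Open Scope ereal_scope.

Section normal_variable.
Variables (Delta : Omega -> R) (s : R).
Hypotheses (s0 : (0 < s)%R) (mDelta : measurable_fun setT Delta).
Hypothesis law : forall U : set R, measurable U ->
  P (Delta @^-1` U) = normal_prob 0 s U.
Local Notation R' := (measurableTypeR R).

Let D : {mfun Omega >-> R'} := @mfun_Sub _ _ Omega R' Delta (mem_set mDelta).

Let eq_integral_law (f : R' -> \bar R) :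
  \int[distribution P D]_x f x = \int[normal_prob 0 s]_x f x.
Proof. by apply: eq_measure_integral => A mA _; first [exact: law|exact/esym/law]. Qed.

Lemma normal_variable_sqr :
  \int[P]_w (Delta w ^+ 2)%:E <= (8 * s ^+ 2)%:E.
Proof.
apply: le_trans (integral_normal_prob_sqr s0).
rewrite -eq_integral_law ge0_integral_distribution//.
  by apply/measurable_EFinP; exact: exprn_measurable.
by move=> x; rewrite lee_fin sqr_ge0.
Qed.

Lemma normal_variable_integrable : P.-integrable setT (EFin \o Delta).
Proof.
apply/integrableP; split; first exact/measurable_EFinP.
have /integrableP[_] := integrable_normal_prob_id s0.
rewrite -eq_integral_law ge0_integral_distribution//.
by apply/measurable_EFinP; exact: normr_measurable.
Qed.

Lemma normal_variable_mean : \int[P]_w (Delta w)%:E = 0.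
Proof.
rewrite -(integral_normal_prob_id s0) -eq_integral_law integral_distribution//.
exact: normal_variable_integrable.
Qed.
End normal_variable.

Section product.
Variables (zeta Delta : Omega -> R).
Hypotheses (mzeta : measurable_fun setT zeta)
  (mDelta : measurable_fun setT Delta).
Hypothesis indep : forall A U : set R, measurable A -> measurable U ->
  P (zeta @^-1` A `&` Delta @^-1` U) = P (zeta @^-1` A) * P (Delta @^-1` U).

Let mpair : measurable_fun setT (fun w => (zeta w, Delta w)).
Proof. exact/measurable_fun_pair. Qed.

Let Z : {mfun Omega >-> R} := mfun_Sub (mem_set mzeta).
Let D : {mfun Omega >-> R} := mfun_Sub (mem_set mDelta).
Let ZD : {mfun Omega >-> (R * R)%type} := mfun_Sub (mem_set mpair).

(** Independence is the agreement of the joint law with the product law on rectangles; uniqueness of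
    the product measure extends it to all measurable sets. *)
Let joint (X : set (R * R)) : measurable X ->
  (distribution P Z \x distribution P D) X = distribution P ZD X.
Proof.
move=> mX; apply: (product_measure_unique (m' := distribution P ZD)) => //= A U mA mU.
Qed.

Let eq_integral_joint (f : R * R -> \bar R) :
  \int[distribution P ZD]_p f p =
  \int[(distribution P Z \x distribution P D)%E]_p f p.
Proof.
by apply: eq_measure_integral => A mA _; first [exact: joint|exact/esym/joint].
Qed.

Lemma ge0_integral_indep_mul (f g : R -> R) : measurable_fun setT f ->
  measurable_fun setT g -> (forall x, 0 <= f x)%R -> (forall x, 0 <= g x)%R ->
  \int[P]_w (f (zeta w) * g (Delta w))%:E =
  \int[P]_w (f (zeta w))%:E * \int[P]_w (g (Delta w))%:E.
Proof.
move=> mf mg f0 g0.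
have mf1 : measurable_fun [set: R * R] (fun p => f p.1).
  by apply: (measurableT_comp mf).
have mg2 : measurable_fun [set: R * R] (fun p => g p.2).
  by apply: (measurableT_comp mg).
have mfg : measurable_fun [set: R * R] (fun p => (f p.1 * g p.2)%:E).
  by apply/measurable_EFinP; exact: measurable_funM.
transitivity (\int[distribution P ZD]_p (f p.1 * g p.2)%:E).
  by rewrite ge0_integral_distribution// => p; rewrite lee_fin mulr_ge0.
rewrite eq_integral_joint.
rewrite fubini_tonelli1//=; last by move=> p; rewrite lee_fin mulr_ge0.
rewrite /fubini_F /=.
rewrite (eq_integral (fun x => (f x)%:E * \int[distribution P D]_y (g y)%:E)); last first.
  move=> x _; under eq_integral do rewrite EFinM.
  by rewrite ge0_integralZl// => *; rewrite ?lee_fin//; exact/measurable_EFinP.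
rewrite /= ge0_integralZr//=.
- by rewrite !ge0_integral_distribution//=; exact/measurable_EFinP.
- exact/measurable_EFinP.
- by move=> x _; rewrite lee_fin.
- by apply: integral_ge0 => x _; rewrite lee_fin.
Qed.

Lemma integrable_indep_mul : P.-integrable setT (EFin \o zeta) ->
  P.-integrable setT (EFin \o Delta) ->
  P.-integrable setT (fun w => (zeta w * Delta w)%:E).
Proof.
move=> /integrableP[_ iz] /integrableP[_ iD]; apply/integrableP; split.
  by apply/measurable_EFinP; exact: measurable_funM.
under eq_integral do rewrite /= normrM.
rewrite (ge0_integral_indep_mul (f := Num.norm) (g := Num.norm))//.
by rewrite lte_mul_pinfty// ?integral_ge0// ge0_fin_numE// integral_ge0.
Qed.

Lemma integral_indep_mul : P.-integrable setT (EFin \o zeta) ->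
  P.-integrable setT (EFin \o Delta) ->
  \int[P]_w (zeta w * Delta w)%:E = \int[P]_w (zeta w)%:E * \int[P]_w (Delta w)%:E.
Proof.
move=> iz iD; have izD := integrable_indep_mul iz iD.
have mprod : measurable_fun [set: R * R] (fun p : R * R => (p.1 * p.2)%:E).
  by apply/measurable_EFinP; apply: measurable_funM.
have ipush : (distribution P ZD).-integrable setT (fun p : R * R => (p.1 * p.2)%:E).
  by apply: integrable_pushforward.
transitivity (\int[distribution P ZD]_p (p.1 * p.2)%:E).
  by rewrite integral_distribution.
rewrite eq_integral_joint.
rewrite -fubini1; last first.
  apply/integrableP; split => //.
  have /integrableP[_] := ipush.
  by rewrite eq_integral_joint.
rewrite /fubini_F /=.
have iD' : (distribution P D).-integrable setT (EFin : R -> _) by apply: integrable_pushforward.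
have iZ' : (distribution P Z).-integrable setT (EFin : R -> _) by apply: integrable_pushforward.
have fD : \int[distribution P D]_x x%:E \is a fin_num by apply: integrable_fin_num.
under eq_integral.
  move=> x _; under eq_integral do rewrite EFinM.
  rewrite integralZl//=.
  over.
rewrite /= -(fineK fD) integralZr//= !fineK//.
by rewrite !integral_distribution//.
Qed.
End product.
End independence.

(** * Independence of the past *)

Section wrt_calculus.
Context {R : realType} {dT : measure_display} {T : measurableType dT}.
Implicit Types (C : set (set T)) (Y Z : T -> R).

(** Gives access to the closure properties of measurable functions for each generated sigma-algebra,
    in particular for the filtration and for [past]. *)
Lemma wrtP C Y : wrt <<s C>> Y <->
  measurable_fun setT (Y : g_sigma_algebraType C -> R).
Proof.
split=> [H _ U mU|H U mU]; first by rewrite setTI; exact: H.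
by rewrite -[X in <<s C>> X]setTI; exact: (H measurableT).
Qed.

Lemma wrt_sub (G H : set (set T)) Y : G `<=` H -> wrt G Y -> wrt H Y.
Proof. by move=> GH GY U mU; exact/GH/GY. Qed.

Lemma wrt_cst C (c : R) : wrt <<s C>> (fun=> c).
Proof. by apply/wrtP; exact: measurable_cst. Qed.

Lemma wrtD C Y Z : wrt <<s C>> Y -> wrt <<s C>> Z -> wrt <<s C>> (fun w => Y w + Z w).
Proof. by move=> /wrtP ? /wrtP ?; apply/wrtP; exact: measurable_funD. Qed.

Lemma wrtB C Y Z : wrt <<s C>> Y -> wrt <<s C>> Z -> wrt <<s C>> (fun w => Y w - Z w).
Proof. by move=> /wrtP ? /wrtP ?; apply/wrtP; exact: measurable_funB. Qed.

Lemma wrtM C Y Z : wrt <<s C>> Y -> wrt <<s C>> Z -> wrt <<s C>> (fun w => Y w * Z w).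
Proof. by move=> /wrtP ? /wrtP ?; apply/wrtP; exact: measurable_funM. Qed.

Lemma wrt_comp C Y (f : R -> R) : measurable_fun setT f ->
  wrt <<s C>> Y -> wrt <<s C>> (fun w => f (Y w)).
Proof. by move=> mf /wrtP mY; apply/wrtP; exact: (measurableT_comp mf mY). Qed.

Lemma wrt_sum C (I : Type) (r : seq I) (p : pred I) (F : I -> T -> R) :
  (forall i, wrt <<s C>> (F i)) -> wrt <<s C>> (fun w => \sum_(i <- r | p i) F i w).
Proof.
move=> mF; elim: r => [|i r ih].
  by under eq_fun do rewrite big_nil; exact: wrt_cst.
under eq_fun do rewrite big_cons.
by case: (p i) => //; exact: wrtD.
Qed.

Lemma wrt_indic C (A : set T) : <<s C>> A -> wrt <<s C>> (fun w => \1_A w : R).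
Proof.
move=> CA; apply/wrtP.
exact: (@measurable_indic _ (g_sigma_algebraType C) R setT A).
Qed.

Lemma wrt_if C (A : set T) Y Z : <<s C>> A -> wrt <<s C>> Y -> wrt <<s C>> Z ->
  wrt <<s C>> (fun w => if w \in A then Y w else Z w).
Proof.
move=> CA /wrtP mY /wrtP mZ; apply/wrtP.
have -> : (fun w => if w \in A then Y w else Z w) = (fun w => \1_A w * Y w + (1 - \1_A w) * Z w).
  by apply/funext => w; rewrite indicE; case: (w \in A); rewrite ?mul1r ?subrr ?mul0r ?addr0 ?subr0 ?mul1r ?add0r.
have /wrtP mA := wrt_indic CA.
by apply: measurable_funD; apply: measurable_funM => //; apply: measurable_funB.
Qed.

Lemma wrt_lim C (Yn : nat -> T -> R) Y : (forall n, wrt <<s C>> (Yn n)) ->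
  (forall w, Yn ^~ w @ \oo --> Y w) -> wrt <<s C>> Y.
Proof.
move=> mY YnY; apply/wrtP; apply: (@measurable_fun_cvg _ (g_sigma_algebraType C) _ _ Yn).
  by move=> n; exact/wrtP.
by move=> w _; exact: YnY.
Qed.
End wrt_calculus.

Section past.
Context {R : realType} {dO : measure_display} {Omega : measurableType dO}.
Variables (P : probability Omega R) (d : nat) (beta : 'I_d -> R -> Omega -> R).
Hypothesis hbeta : independent_brownian_motions P beta.
Local Open Scope ereal_scope.

Let bm j : brownian_motion P (beta j). Proof. by case: hbeta. Qed.

Let nulls : set (set Omega) := [set N | measurable N /\ P N = 0].

Let span (l : 'I_d) (s : R) (j : 'I_d) : set R :=
  if j == l then `[0%R, s]%classic else `[0%R, +oo[%classic.

(* Everything independent of the increments of [beta l] after time [s]. *)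
Definition past (l : 'I_d) (s : R) : set (set Omega) :=
  (\bigcup_j \bigcup_(r in span l s j)
     preimage_set_system setT (beta j r) measurable) `|` nulls.

Lemma augmented_filtration_past l (s t : R) : (s <= t)%R ->
  augmented_filtration P beta s `<=` <<s past l t>>.
Proof.
move=> st; apply: sub_sigma_algebra2 => A [[j _ [r rs Ar]]|]; last by right.
left; exists j => //; exists r => //; rewrite /span; case: ifP => _.
  by move: rs; rewrite /= !in_itv/= => /andP[-> rs]; exact: le_trans rs st.
by move: rs; rewrite /= !in_itv/= => /andP[->].
Qed.

Lemma augmented_filtration_le (s t : R) : (s <= t)%R ->
  augmented_filtration P beta s `<=` augmented_filtration P beta t.
Proof.
move=> st; apply: sub_sigma_algebra2 => A [[j _ [r rs Ar]]|]; last by right.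
left; exists j => //; exists r => //.
by move: rs; rewrite /= !in_itv/= => /andP[-> rs]; exact: le_trans rs st.
Qed.

Lemma wrt_preimage (C : set (set Omega)) (Y : Omega -> R) :
  preimage_set_system setT Y measurable `<=` C -> wrt <<s C>> Y.
Proof.
move=> sub U mU; apply: sub_sigma_algebra; apply: sub.
by exists U => //; rewrite setTI.
Qed.

Lemma wrt_beta (j : 'I_d) (s t : R) : (0 <= s <= t)%R ->
  wrt (augmented_filtration P beta t) (beta j s).
Proof.
move=> st; apply: wrt_preimage => A Aj; left; exists j => //; exists s => //.
Qed.

Lemma wrt_past_beta (l j : 'I_d) (s t : R) : (0 <= s)%R -> (j == l -> s <= t)%R ->
  wrt <<s past l t>> (beta j s).
Proof.
move=> s0 st; apply: wrt_preimage => A Aj; left; exists j => //; exists s => //.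
by rewrite /span; case: ifP => [/st|_]; rewrite /= in_itv/= s0.
Qed.

Lemma augmented_filtration_measurable (t : R) :
  augmented_filtration P beta t `<=` measurable.
Proof.
apply: smallest_sub; first exact: sigma_algebra_measurable.
move=> A [[j _ [r]]|[]//]; rewrite /= in_itv/= => /andP[r0 _] [U mU <-].
exact: (bm_measurable (bm j) r0).
Qed.

Lemma wrt_measurable (G : set (set Omega)) (Y : Omega -> R) :
  G `<=` measurable -> wrt G Y -> measurable_fun setT Y.
Proof. by move=> GM mY _ U mU; rewrite setTI; exact/GM/mY. Qed.

(** A pi-system that generates the same sigma-algebra as [past]: one event per Brownian motion, so
    that mutual independence applies directly, together with the null sets of the augmentation. *)
Let cyl l s : set (set Omega) :=
  [set E | exists F : 'I_d -> set Omega,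
    (forall j, sigma_process (beta j) (span l s j) (F j)) /\ E = \bigcap_j F j]
  `|` nulls.

Let sub_span l s j : span l s j `<=` `[0%R, +oo[%classic.
Proof.
move=> r; rewrite /span; case: ifP => // _.
by rewrite /= !in_itv/= => /andP[->].
Qed.

Let sigma_process_sub (W : R -> Omega -> R) (D D' : set R) : D `<=` D' ->
  sigma_process W D `<=` sigma_process W D'.
Proof.
by move=> DD'; apply: sub_sigma_algebra2; exact: bigcup_subset.
Qed.

Let sigma_process_measurable j : sigma_process (beta j) `[0%R, +oo[ `<=` measurable.
Proof.
apply: smallest_sub; first exact: sigma_algebra_measurable.
move=> A [r]; rewrite /= in_itv/= andbT => r0 [U mU <-].
exact: (bm_measurable (bm j) r0).
Qed.

Let sigma_processI (W : R -> Omega -> R) D : setI_closed (sigma_process W D).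
Proof.
move=> A B mA mB.
exact: (@measurableI _ (g_sigma_algebraType
 (\bigcup_(s in D) preimage_set_system setT (W s) measurable)) A B mA mB).
Qed.

Let cylI l s : setI_closed (cyl l s).
Proof.
have cm E : cyl l s E -> measurable E.
  move=> [[F [mF ->]]|[]//]; apply: fin_bigcap_measurable => // j _.
  apply: (@sigma_process_measurable j).
  exact: (sigma_process_sub (@sub_span l s j)) (mF j).
move=> A B cA cB; have mA := cm _ cA; have mB := cm _ cB.
have [[_ NA]|[F [mF EA]]] : (nulls A) \/ exists F : 'I_d -> set Omega,
    (forall j, sigma_process (beta j) (span l s j) (F j)) /\ A = \bigcap_j F j.
  by case: cA; [right|left].
  right; split; first exact: measurableI.
  by apply: (subset_measure0 _ mA (@subIsetl _ _ _)) => //; exact: measurableI.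
have [[_ NB]|[F' [mF' EB]]] : (nulls B) \/ exists F : 'I_d -> set Omega,
    (forall j, sigma_process (beta j) (span l s j) (F j)) /\ B = \bigcap_j F j.
  by case: cB; [right|left].
  right; split; first exact: measurableI.
  by apply: (subset_measure0 _ mB (@subIsetr _ _ _)) => //; exact: measurableI.
left; exists (fun j => F j `&` F' j); split; first by move=> j; exact: sigma_processI.
by rewrite bigcapI EA EB.
Qed.

(** The increment event involves [beta l] alone, so it can be merged into the factor of index [l].
    Mutual independence with and without the merged event reduces the claim to that factor, where
    the independence of increments of [beta l] splits it. *)
Let cyl_indep l s t E U : (0 <= s)%R -> (s < t)%R -> cyl l s E -> measurable U ->
  let V := (fun w => beta l t w - beta l s w)%R @^-1` U in
  P (E `&` V) = P E * P V.
Proof.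
move=> s0 st cE mU V.
have t0 : (0 <= t)%R by rewrite (le_trans s0)// ltW.
have VS : sigma_process (beta l) `[0%R, +oo[ V.
  have wb r : (0 <= r)%R -> wrt (sigma_process (beta l) `[0%R, +oo[) (beta l r).
    by move=> r0; apply: wrt_preimage => A Ar; exists r => //; rewrite /= in_itv/= r0.
  exact: (wrtB (wb _ t0) (wb _ s0)).
have mV : measurable V := sigma_process_measurable VS.
case: cE => [[F [mF EF]]|[mE E0]]; last first.
  rewrite E0 mul0e; apply: (subset_measure0 _ mE (@subIsetl _ _ _)) => //.
  exact: measurableI.
pose F' j := if j == l then F l `&` V else F j.
have -> : E `&` V = \bigcap_j F' j.
  rewrite EF; apply/seteqP; split => w.
    by move=> [Fw Vw] j _; rewrite /F'; case: eqP => [jl|_]; [split => //|]; exact: Fw.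
  move=> F'w; split; last by have := F'w l I; rewrite /F' eqxx => -[].
  by move=> j _; have := F'w j I; rewrite /F'; case: eqP => [->|_] // => -[].
have mFo j : sigma_process (beta j) `[0%R, +oo[ (F j).
  exact: (sigma_process_sub (@sub_span l s j)) (mF j).
rewrite EF hbeta.2; last first.
  by move=> j; rewrite /F'; case: eqP => [->|_] //; exact: sigma_processI.
rewrite hbeta.2//.
rewrite (bigD1 l)//= [X in _ = X * _](bigD1 l)//= /F' eqxx.
have := mF l; rewrite /span eqxx => mFl.
rewrite (bm_indep (bm l) s0 st mFl mU) -/V.
rewrite -!muleA; congr (_ * _); rewrite muleC; congr (_ * _).
by apply: eq_bigr => j /negbTE ->.
Qed.

(** Dynkin's pi-lambda theorem: for a fixed increment event the events independent of it form a
    Dynkin system, which contains the pi-system [cyl]. *)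
Lemma past_indep l s t E U : (0 <= s)%R -> (s < t)%R -> <<s past l s>> E ->
  measurable U ->
  let V := (fun w => beta l t w - beta l s w)%R @^-1` U in
  P (E `&` V) = P E * P V.
Proof.
move=> s0 st pE mU V.
have t0 : (0 <= t)%R by rewrite (le_trans s0)// ltW.
have mV : measurable V.
  rewrite /V -[X in measurable X]setTI; apply: measurable_funB => //.
    exact: (bm_measurable (bm l) t0).
  exact: (bm_measurable (bm l) s0).
have sub : <<s past l s>> `<=` <<s cyl l s>>.
  apply: smallest_sub; first exact: smallest_sigma_algebra.
  move=> A [[j _ [r rs [B mB AB]]]|nA]; apply: sub_sigma_algebra; last by right.
  left; exists (fun i => if i == j then A else setT); split.
    move=> i; case: eqP => [->|_].
      by apply: sub_sigma_algebra; exists r => //; exists B.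
    rewrite -setC0; apply: (@sigma_algebraC _ (\bigcup_(s0 in span l s i) preimage_set_system setT
      (beta i s0) measurable)).
    exact: sigma_algebra0.
  apply/seteqP; split => w; first by move=> Aw i _; case: eqP.
  by move=> /(_ j I); rewrite eqxx.
have {}pE := sub _ pE.
move: E pE; rewrite -setI_closed_g_dynkin_g_sigma_algebra; last exact: cylI.
suff : <<d cyl l s>> `<=` [set E | measurable E /\ P (E `&` V) = P E * P V].
  by move=> H E /H[].
apply: smallest_sub; last first.
  move=> E cE; split; last exact: cyl_indep.
  case: cE => [[F [mF ->]]|[]//]; apply: fin_bigcap_measurable => // j _.
  apply: (@sigma_process_measurable j).
  exact: (sigma_process_sub (@sub_span l s j)) (mF j).
split.
- by split=> //; rewrite setTI probability_setT mul1e.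
- move=> E [mE PE]; split; first exact: measurableC.
  rewrite setIC -setDE measureD//; last by rewrite -ge0_fin_numE// fin_num_measure.
  transitivity (P V - P E * P V); first by congr (_ - _); rewrite setIC; exact: PE.
  rewrite probability_setC// muleBl ?mul1e//.
  exact: fin_num_measure.
- move=> F tF HF; have mF n : measurable (F n) by case: (HF n).
  split; first exact: bigcup_measurable.
  rewrite setI_bigcupl !measure_bigcup//; last 2 first.
  + by move=> n _; exact: measurableI.
  + exact: trivIset_setIr.
  have fV : P V \is a fin_num by exact: fin_num_measure.
  rewrite -(fineK fV) muleC -nneseriesZl//.
  by apply: eq_eseriesr => n _; rewrite fineK// muleC; case: (HF n).
Qed.

Lemma past_indep_fun l s t zeta (A U : set R) : (0 <= s)%R -> (s < t)%R ->
  wrt <<s past l s>> zeta -> measurable A -> measurable U ->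
  P (zeta @^-1` A `&` (fun w => beta l t w - beta l s w)%R @^-1` U) =
  P (zeta @^-1` A) * P ((fun w => beta l t w - beta l s w)%R @^-1` U).
Proof. by move=> s0 st wz mA mU; apply: past_indep => //; exact: wz. Qed.

End past.

(** * Square-integrable martingale transforms *)

Section L2.
Context {R : realType} {dO : measure_display} {Omega : measurableType dO}.
Variable P : probability Omega R.
Implicit Types (f g : Omega -> R).

Definition L1 f := P.-integrable setT (EFin \o f).
Definition L2 f := measurable_fun setT f /\ L1 (fun w => f w ^+ 2).
Local Notation Ex f := (Rintegral P setT f).

Lemma L1_measurable f : L1 f -> measurable_fun setT f.
Proof. by move=> /integrableP[/measurable_EFinP]. Qed.

Lemma L1_cst (c : R) : L1 (fun=> c).
Proof. exact: finite_measure_integrable_cst. Qed.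

Lemma L1_indic (A : set Omega) : measurable A -> L1 (fun w => \1_A w).
Proof.
move=> mA; apply: (@le_integrable _ _ _ P setT measurableT _ (EFin \o (fun=> 1))) => //.
- by apply/measurable_EFinP; exact: measurable_indic.
- move=> w _ /=; rewrite lee_fin indicE normr1.
  by case: (w \in A); rewrite ?normr1 ?normr0.
exact: L1_cst.
Qed.

Lemma L1D f g : L1 f -> L1 g -> L1 (fun w => f w + g w).
Proof. by move=> lf lg; exact: (integrableD measurableT lf lg). Qed.

Lemma L1B f g : L1 f -> L1 g -> L1 (fun w => f w - g w).
Proof. by move=> lf lg; exact: (integrableB measurableT lf lg). Qed.

Lemma L1Z (c : R) f : L1 f -> L1 (fun w => c * f w).
Proof. by move=> lf; exact: (integrableZl measurableT c lf). Qed.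

Lemma L1_sum (I : Type) (r : seq I) (F : I -> Omega -> R) :
  (forall i, L1 (F i)) -> L1 (fun w => \sum_(i <- r) F i w).
Proof.
move=> LF; elim: r => [|i r ih].
  by under eq_fun do rewrite big_nil; exact: L1_cst.
by under eq_fun do rewrite big_cons; exact: L1D.
Qed.

Lemma L1_le f g : measurable_fun setT f -> (forall w, `|f w| <= g w) -> L1 g -> L1 f.
Proof.
move=> mf fg lg; apply: (@le_integrable _ _ _ P setT measurableT _ (EFin \o g)) => //.
  exact/measurable_EFinP.
by move=> w _ /=; rewrite lee_fin (le_trans (fg w))// ler_norm.
Qed.

Lemma Ex_cst (c : R) : Ex (fun=> c) = c.
Proof. by rewrite /Rintegral integral_cst//= probability_setT mule1. Qed.

Lemma Ex_indic (A : set Omega) : measurable A -> Ex (fun w => \1_A w) = fine (P A).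
Proof. by move=> mA; rewrite /Rintegral integral_indic// setIT. Qed.

Lemma ExD f g : L1 f -> L1 g -> Ex (fun w => f w + g w) = Ex f + Ex g.
Proof. by move=> lf lg; rewrite RintegralD. Qed.

Lemma ExB f g : L1 f -> L1 g -> Ex (fun w => f w - g w) = Ex f - Ex g.
Proof. by move=> lf lg; rewrite RintegralB. Qed.

Lemma ExZ (c : R) f : L1 f -> Ex (fun w => c * f w) = c * Ex f.
Proof. by move=> lf; rewrite RintegralZl. Qed.

Lemma Ex_sum (I : Type) (r : seq I) (F : I -> Omega -> R) :
  (forall i, L1 (F i)) -> Ex (fun w => \sum_(i <- r) F i w) = \sum_(i <- r) Ex (F i).
Proof.
move=> LF; elim: r => [|i r ih].
  by rewrite big_nil; under eq_Rintegral do rewrite big_nil; rewrite Ex_cst.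
rewrite big_cons -ih -ExD//; last exact: L1_sum.
by apply: eq_Rintegral => w _; rewrite big_cons.
Qed.

Lemma Ex_ge0 f : (forall w, 0 <= f w) -> 0 <= Ex f.
Proof. by move=> f0; apply: Rintegral_ge0 => w _. Qed.

Lemma Ex_le f g : L1 f -> L1 g -> (forall w, f w <= g w) -> Ex f <= Ex g.
Proof. by move=> lf lg fg; apply: le_Rintegral. Qed.

Lemma ExE f : L1 f -> (\int[P]_w (f w)%:E)%E = (Ex f)%:E.
Proof. by move=> lf; rewrite /Rintegral fineK//; exact: integrable_fin_num. Qed.

Lemma L1_ge0 f (c : R) : measurable_fun setT f -> (forall w, 0 <= f w) ->
  (\int[P]_w (f w)%:E <= c%:E)%E -> L1 f /\ Ex f <= c.
Proof.
move=> mf f0 fc; have lf : L1 f.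
  apply/integrableP; split; first exact/measurable_EFinP.
  under eq_integral do rewrite /= ger0_norm//.
  by rewrite (le_lt_trans fc)// ltry.
by split => //; rewrite -lee_fin -ExE.
Qed.

Lemma L2_measurable f : L2 f -> measurable_fun setT f. Proof. by case. Qed.

Lemma L2_sqr f : L2 f -> L1 (fun w => f w ^+ 2). Proof. by case. Qed.

Lemma L2_mul f g : L2 f -> L2 g -> L1 (fun w => f w * g w).
Proof.
move=> [mf lf] [mg lg].
apply: (@L1_le _ (fun w => f w ^+ 2 + g w ^+ 2)); first exact: measurable_funM.
  move=> w; rewrite normrM -(real_normK (num_real (f w))) -(real_normK (num_real (g w))).
  by have := sqr_ge0 (`|f w| - `|g w|); have := normr_ge0 (f w); have := normr_ge0 (g w); nra.
exact: L1D.
Qed.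

Lemma L2_le f g : measurable_fun setT f -> (forall w, `|f w| <= `|g w|) -> L2 g -> L2 f.
Proof.
move=> mf fg [mg lg]; split => //; apply: (@L1_le _ (fun w => g w ^+ 2)) => //.
  exact: measurable_funX.
move=> w; rewrite normrX -[leRHS]real_normK ?num_real// lerXn2r ?nnegrE//.
Qed.

Lemma L2_cst (c : R) : L2 (fun=> c).
Proof. by split; [exact: measurable_cst|exact: L1_cst]. Qed.

Lemma L2D f g : L2 f -> L2 g -> L2 (fun w => f w + g w).
Proof.
move=> Lf Lg; split; first exact: (measurable_funD (L2_measurable Lf) (L2_measurable Lg)).
under eq_fun do rewrite sqrrD.
apply: L1D (L2_sqr Lg); apply: L1D (L2_sqr Lf) _.
under eq_fun do rewrite -mulr_natl.
exact/L1Z/L2_mul.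
Qed.

Lemma L2Z (c : R) f : L2 f -> L2 (fun w => c * f w).
Proof.
move=> [mf lf]; split; first exact: measurable_funM.
by under eq_fun do rewrite exprMn; exact: L1Z.
Qed.

Lemma L2B f g : L2 f -> L2 g -> L2 (fun w => f w - g w).
Proof.
move=> Lf Lg; under eq_fun do rewrite -mulN1r.
by apply: L2D => //; exact: L2Z.
Qed.

Lemma L2_sum (I : Type) (r : seq I) (F : I -> Omega -> R) :
  (forall i, L2 (F i)) -> L2 (fun w => \sum_(i <- r) F i w).
Proof.
move=> LF; elim: r => [|i r ih].
  by under eq_fun do rewrite big_nil; exact: L2_cst.
by under eq_fun do rewrite big_cons; exact: L2D.
Qed.

Lemma L2_L1 f : L2 f -> L1 f.
Proof.
move=> Lf; have := L2_mul Lf (L2_cst 1).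
by under eq_fun do rewrite mulr1.
Qed.

Lemma L2_indic_mul (A : set Omega) f : measurable A -> L2 f -> L2 (fun w => \1_A w * f w).
Proof.
move=> mA Lf; apply: (L2_le _ _ Lf).
  by apply: measurable_funM; [exact: measurable_indic|exact: L2_measurable].
move=> w; rewrite normrM ler_piMl// indicE.
by case: (w \in A); rewrite ?normr1 ?normr0.
Qed.

Lemma Ex_sqr_cvg0P (f : nat -> Omega -> R) (r : nat -> R) : (forall m, L2 (f m)) ->
  (forall m, Ex (fun w => f m w ^+ 2) <= r m) -> r @ \oo --> 0 ->
  (fun m => \int[P]_w (f m w ^+ 2)%:E)%E @ \oo --> 0%E.
Proof.
move=> Lf fr r0.
rewrite (_ : (fun m => _) = (fun m => (Ex (fun w => f m w ^+ 2))%:E)); last first.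
  by apply/funext => m; rewrite ExE//; exact: L2_sqr.
apply: cvg_EFin; first by near=> m.
apply: (squeeze_cvgr _ (cvg_cst 0) r0); near=> m; rewrite fr andbT.
by apply: Ex_ge0 => w; exact: sqr_ge0.
Unshelve. all: by end_near. Qed.
End L2.

Section increments.
Context {R : realType} {dO : measure_display} {Omega : measurableType dO}.
Variables (P : probability Omega R) (d : nat) (beta : 'I_d -> R -> Omega -> R).
Hypothesis hbeta : independent_brownian_motions P beta.
Local Notation Ex f := (Rintegral P setT f).
Local Notation L1 := (L1 P).
Local Notation L2 := (L2 P).
Local Notation F := (augmented_filtration P beta).

Definition incr (j : 'I_d) (s t : R) (w : Omega) : R := beta j t w - beta j s w.

Lemma measurable_incr j s t : 0 <= s -> 0 <= t -> measurable_fun setT (incr j s t).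
Proof.
by case: hbeta => bm _ s0 t0; apply: measurable_funB; exact: (bm_measurable (bm j)).
Qed.

Lemma past_incr_mean l s t zeta : 0 <= s <= t -> wrt <<s past P beta l s>> zeta ->
  L1 zeta ->
  L1 (fun w => zeta w * incr l s t w) /\ Ex (fun w => zeta w * incr l s t w) = 0.
Proof.
move=> /andP[s0]; rewrite le_eqVlt => /predU1P[<-|st] wz Lz.
  under eq_fun do rewrite /incr subrr mulr0.
  by split; [exact: L1_cst|rewrite Ex_cst].
have t0 : 0 <= t by rewrite (le_trans s0)// ltW.
have mi := measurable_incr l s0 t0.
have mz := L1_measurable Lz.
have dt : 0 < Num.sqrt (t - s) by rewrite sqrtr_gt0 subr_gt0.
have law U : measurable U -> P (incr l s t @^-1` U) = normal_prob 0 (Num.sqrt (t - s)) U.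
  by case: hbeta => bm _; exact: (bm_normal (bm l)).
have ind A U : measurable A -> measurable U ->
    P (zeta @^-1` A `&` incr l s t @^-1` U) = (P (zeta @^-1` A) * P (incr l s t @^-1` U))%E.
  by move=> mA mU; exact: (past_indep_fun hbeta).
have iD := normal_variable_integrable dt mi law.
split; first exact: integrable_indep_mul.
rewrite /Rintegral integral_indep_mul// (normal_variable_mean dt mi law).
by rewrite mule0.
Qed.

(** Independence factorises the expectation of the square, and the constant 8 is that of
    [integral_normal_prob_sqr]. This inequality takes the place of Ito's isometry for a single
    step. *)
Lemma past_incr_sqr l s t zeta : 0 <= s <= t -> wrt <<s past P beta l s>> zeta ->
  L2 zeta ->
  L2 (fun w => zeta w * incr l s t w) /\
  Ex (fun w => (zeta w * incr l s t w) ^+ 2) <= 8 * (t - s) * Ex (fun w => zeta w ^+ 2).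
Proof.
move=> /andP[s0]; rewrite le_eqVlt => /predU1P[<-|st] wz Lz.
  under eq_fun do rewrite /incr subrr mulr0.
  split; first exact: L2_cst.
  under [leLHS]eq_Rintegral do rewrite /incr subrr mulr0 expr0n.
  by rewrite subrr mulr0 mul0r Ex_cst.
have t0 : 0 <= t by rewrite (le_trans s0)// ltW.
have mi := measurable_incr l s0 t0.
have mz := L2_measurable Lz.
have dt : 0 < Num.sqrt (t - s) by rewrite sqrtr_gt0 subr_gt0.
have law U : measurable U -> P (incr l s t @^-1` U) = normal_prob 0 (Num.sqrt (t - s)) U.
  by case: hbeta => bm _; exact: (bm_normal (bm l)).
have ind A U : measurable A -> measurable U ->
    P (zeta @^-1` A `&` incr l s t @^-1` U) = (P (zeta @^-1` A) * P (incr l s t @^-1` U))%E.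
  by move=> mA mU; exact: (past_indep_fun hbeta).
have m2 : measurable_fun [set: R] (fun x : R => x ^+ 2) by exact: exprn_measurable.
have mzi : measurable_fun setT (fun w => zeta w * incr l s t w) by exact: measurable_funM.
suff [] : L1 (fun w => (zeta w * incr l s t w) ^+ 2) /\
    Ex (fun w => (zeta w * incr l s t w) ^+ 2) <= 8 * (t - s) * Ex (fun w => zeta w ^+ 2).
  by split.
apply: L1_ge0; [exact: measurable_funX|by move=> w; rewrite sqr_ge0|].
under eq_integral do rewrite exprMn.
rewrite (ge0_integral_indep_mul mz mi ind m2 m2); [|by move=> x; exact: sqr_ge0..].
have /= := normal_variable_sqr dt mi law.
rewrite sqr_sqrtr ?subr_ge0 ?(ltW st)// => H.
rewrite EFinM -ExE; last exact: L2_sqr.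
rewrite muleC lee_wpmul2r// integral_ge0// => w _.
by rewrite lee_fin sqr_ge0.
Qed.

(** The cross term has mean zero because the product of [S] and [zeta] belongs to the past of the
    increment. *)
Lemma past_step l s t S zeta : 0 <= s <= t -> wrt <<s past P beta l s>> S -> L2 S ->
  wrt <<s past P beta l s>> zeta -> L2 zeta ->
  L2 (fun w => S w + zeta w * incr l s t w) /\
  Ex (fun w => (S w + zeta w * incr l s t w) ^+ 2) <=
    Ex (fun w => S w ^+ 2) + 8 * (t - s) * Ex (fun w => zeta w ^+ 2).
Proof.
move=> st wS LS wz Lz.
have [Li Ei] := past_incr_sqr st wz Lz.
have [Lm Em] := past_incr_mean st (wrtM wS wz) (L2_mul LS Lz).
split; first exact: L2D.
rewrite [leLHS](_ : _ = Ex (fun w => S w ^+ 2 + (2 * (S w * zeta w * incr l s t w) +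
    (zeta w * incr l s t w) ^+ 2))); last first.
  by apply: eq_Rintegral => w _; ring.
rewrite ExD ?ExD ?ExZ ?Em ?mulr0 ?add0r ?lerD2l//.
- exact: L1Z.
- exact: L2_sqr.
- exact: L2_sqr.
- by apply: L1D; [exact: L1Z|exact: L2_sqr].
Qed.

Lemma wrt_past l s t (Y : Omega -> R) : s <= t -> wrt (F s) Y -> wrt <<s past P beta l t>> Y.
Proof. by move=> st; apply: wrt_sub; exact: augmented_filtration_past. Qed.

Lemma wrt_filtration_le s t (Y : Omega -> R) : s <= t -> wrt (F s) Y -> wrt (F t) Y.
Proof. by move=> st; apply: wrt_sub; exact: augmented_filtration_le. Qed.

(** The Brownian motions are added one at a time. When [beta l] is added, the sum already contains
    increments of the other ones over the same interval, which the filtration at time [s] does not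
    know but [past l s] does; this is why [past] keeps the whole paths of the others. *)
Lemma step_sum s t S (zeta : 'I_d -> Omega -> R) : 0 <= s <= t ->
  wrt (F s) S -> L2 S -> (forall j, wrt (F s) (zeta j)) -> (forall j, L2 (zeta j)) ->
  L2 (fun w => S w + \sum_j zeta j w * incr j s t w) /\
  Ex (fun w => (S w + \sum_j zeta j w * incr j s t w) ^+ 2) <=
    Ex (fun w => S w ^+ 2) + 8 * (t - s) * \sum_j Ex (fun w => zeta j w ^+ 2).
Proof.
move=> st wS LS wz Lz; have /andP[s0 st'] := st.
elim: (index_enum _) (index_enum_uniq ('I_d)) => [_|l r ih /= /andP[lr ur]].
  split; first by under eq_fun do rewrite big_nil addr0.
  by under [leLHS]eq_Rintegral do rewrite big_nil addr0; rewrite big_nil mulr0 addr0.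
have {ih}[ih1 ih2] := ih ur.
pose S' w := S w + \sum_(j <- r) zeta j w * incr j s t w.
have wS' : wrt <<s past P beta l s>> S'.
  apply: wrtD; first exact: wrt_past wS.
  rewrite (_ : (fun w => _) = (fun w => \sum_(j <- r | j != l) zeta j w * incr j s t w)); last first.
    apply/funext => w; rewrite [LHS]big_seq_cond [RHS]big_seq_cond; apply: eq_bigl => j.
    rewrite andbT; case: (boolP (j \in r)) => //= jr.
    by apply/esym/eqP => jl; rewrite -jl jr in lr.
  under eq_fun do rewrite big_mkcond/=.
  apply: wrt_sum => j; case: (eqVneq j l) => [_|jl] /=; first exact: wrt_cst.
  apply: wrtM; first exact: wrt_past (wz j).
  apply: wrtB; apply: wrt_past_beta => //; rewrite ?(negbTE jl)//.
  exact: le_trans st'.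
have [H1 H2] := past_step st wS' ih1 (wrt_past (lexx s) (wz l)) (Lz l).
have E w : S w + \sum_(j <- l :: r) zeta j w * incr j s t w = S' w + zeta l w * incr l s t w.
  by rewrite big_cons /S'; ring.
split; first by under eq_fun do rewrite E.
under [leLHS]eq_Rintegral do rewrite E.
apply: (le_trans H2); rewrite big_cons; move: (8 * (t - s)) ih2 => c ih2.
rewrite mulrDr [leRHS]addrCA [leLHS]addrC lerD2l.
exact: ih2.
Qed.

Lemma wrt_incr j s t : 0 <= s <= t -> wrt (F t) (incr j s t).
Proof.
move=> /andP[s0 st]; apply: wrtB; apply: wrt_beta; rewrite ?lexx ?andbT ?s0//.
exact: le_trans st.
Qed.

(* Kolmogorov's inequality: stopping the sum at its first exit from
   [-lambda, lambda] keeps it a martingale transform. *)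
Lemma maximal_inequality j (tau : nat -> R) (zeta : nat -> Omega -> R) K (lambda : R) :
  (forall k, 0 <= tau k <= tau k.+1) -> (forall k, wrt (F (tau k)) (zeta k)) ->
  (forall k, L2 (zeta k)) -> 0 < lambda ->
  lambda ^+ 2 * fine (P [set w | exists2 k, (k <= K)%N &
     lambda < `|\sum_(i < k) zeta i w * incr j (tau i) (tau i.+1) w| ]) <=
  8 * \sum_(i < K) (tau i.+1 - tau i) * Ex (fun w => zeta i w ^+ 2).
Proof.
move=> tau0 wz Lz l0.
pose N k w := \sum_(i < k) zeta i w * incr j (tau i) (tau i.+1) w.
have wN k : wrt (F (tau k)) (N k).
  elim: k => [|k ih].
    by rewrite (_ : N _ = fun=> 0); [exact: wrt_cst|apply/funext => w; rewrite /N big_ord0].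
  rewrite (_ : N _ = fun w => N k w + zeta k w * incr j (tau k) (tau k.+1) w); last first.
    by apply/funext => w; rewrite /N big_ord_recr.
  apply: wrtD; first exact: wrt_filtration_le (andP (tau0 k)).2 ih.
  apply: wrtM; first exact: wrt_filtration_le (andP (tau0 k)).2 (wz k).
  exact: wrt_incr.
pose Q k : set Omega := [set w | forall i, (i <= k)%N -> `|N i w| <= lambda].
have FQ k : F (tau k) (Q k).
  elim: k => [|k ih].
    rewrite (_ : Q _ = setT); last first.
      apply/seteqP; split=> // w _ i; rewrite leqn0 => /eqP ->.
      by rewrite /N big_ord0 normr0 ltW.
    exact: (@measurableT _ (g_sigma_algebraType _)).
  rewrite (_ : Q _ = Q k `&` N k.+1 @^-1` [set x | `|x| <= lambda]); last first.
    apply/seteqP; split=> [w Qw|w [Qw Nw] i].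
      by split; [move=> i ik; apply: Qw; rewrite leqW|exact: Qw].
    by rewrite leq_eqVlt => /predU1P[->//|]; rewrite ltnS; exact: Qw.
  apply: (@measurableI _ (g_sigma_algebraType _)).
    exact: (augmented_filtration_le (andP (tau0 k)).2).
  apply: wN; rewrite (_ : mkset _ = `[- lambda, lambda]%classic)//.
  by apply/seteqP; split=> x /=; rewrite in_itv/= ler_norml.
have mQ k : measurable (Q k) by exact: (augmented_filtration_measurable hbeta (FQ k)).
pose zQ k w := \1_(Q k) w * zeta k w.
have LzQ k : L2 (zQ k) by exact: L2_indic_mul.
have wzQ k : wrt (F (tau k)) (zQ k).
  by apply: (wrtM _ (wz k)); exact: wrt_indic (FQ k).
pose N' k w := \sum_(i < k) zQ i w * incr j (tau i) (tau i.+1) w.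
have N'S k w : N' k.+1 w = N' k w + zQ k w * incr j (tau k) (tau k.+1) w.
  by rewrite /N' big_ord_recr.
have HN' k : [/\ wrt (F (tau k)) (N' k), L2 (N' k) &
    Ex (fun w => N' k w ^+ 2) <= 8 * \sum_(i < k) (tau i.+1 - tau i) * Ex (fun w => zeta i w ^+ 2)].
  elim: k => [|k [ih1 ih2 ih3]].
    have -> : N' 0%N = fun=> 0 by apply/funext => w; rewrite /N' big_ord0.
    rewrite big_ord0 mulr0 expr0n /=; split; [exact: wrt_cst|exact: L2_cst|by rewrite Ex_cst].
  have E : N' k.+1 = fun w => N' k w + zQ k w * incr j (tau k) (tau k.+1) w.
    by apply/funext => w; exact: N'S.
  rewrite E.
  have [H1 H2] := past_step (l := j) (tau0 k) (wrt_past (lexx _) ih1) ih2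
    (wrt_past (lexx _) (wzQ k)) (LzQ k).
  split => //.
    apply: wrtD; first exact: wrt_filtration_le (andP (tau0 k)).2 ih1.
    apply: wrtM; first exact: wrt_filtration_le (andP (tau0 k)).2 (wzQ k).
    exact: wrt_incr.
  apply: (le_trans H2); rewrite big_ord_recr/= [leRHS]mulrDr lerD// mulrA ler_wpM2l//.
    by rewrite mulr_ge0// subr_ge0 (andP (tau0 k)).2.
  apply: Ex_le; [exact: L2_sqr|exact: L2_sqr|move=> w].
  rewrite /zQ indicE; case: (w \in Q k); rewrite ?mul1r// mul0r expr0n sqr_ge0//.
set A := [set w | _].
have AQ : A = ~` Q K.
  apply/seteqP; split=> w.
    by move=> [k kK lk] /(_ k kK); rewrite leNgt lk.
  move=> /existsNP[k /not_implyP[kK /negP]]; rewrite -ltNge => lk.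
  by exists k.
have mA : measurable A by rewrite AQ; exact: measurableC.
have [_ LN EN] := HN' K.
apply: le_trans EN; rewrite -Ex_indic// -ExZ; last exact: L1_indic.
apply: Ex_le; [exact/L1Z/L1_indic|exact: L2_sqr|move=> w].
rewrite indicE; case: (boolP (w \in A)); last by rewrite mulr0 sqr_ge0.
rewrite mulr1 inE => -[k kK lk].
have exk : exists k, (k <= K)%N && (lambda < `|N k w|) by exists k; rewrite kK.
case: (ex_minnP exk) => k0 /andP[k0K lk0] k0min.
have Qlt i : (i < k0)%N -> w \in Q i.
  move=> ik; rewrite inE => i' i'i; rewrite leNgt; apply/negP => lt.
  have i'k0 : (i' < k0)%N := leq_ltn_trans i'i ik.
  by have := k0min i'; rewrite lt andbT (leq_trans (ltnW i'k0) k0K) leqNgt i'k0 => /(_ isT).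
have Qge i : (k0 <= i)%N -> w \notin Q i.
  by move=> ki; rewrite notin_setE => /(_ k0 ki); rewrite leNgt lk0.
(* The term of index [i] is kept when the sums up to [i] are within the bound, so the last kept term
   is the one that leaves it: the stopped sum freezes at its exit value. *)
have -> : N' K w = N k0 w.
  rewrite /N' /N -(subnKC k0K) big_split_ord/= [X in _ + X]big1 ?addr0; last first.
    by move=> i _; rewrite /zQ indicE (negbTE (Qge _ _)) ?leq_addr// !mul0r.
  by apply: eq_bigr => i _; rewrite /zQ indicE Qlt ?mul1r.
by rewrite -[leRHS]real_normK ?num_real//; apply: lerXn2r; rewrite ?nnegrE//; exact: ltW.
Qed.
End increments.

(** * Euclidean vectors *)

Section euclid.
Context {R : realType}.

Lemma enorm_ge0 m n (M : 'M[R]_(m, n)) : 0 <= enorm M.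
Proof. exact: sqrtr_ge0. Qed.

Lemma enorm_sqr m n (M : 'M[R]_(m, n)) : enorm M ^+ 2 = \sum_i \sum_j M i j ^+ 2.
Proof.
rewrite sqr_sqrtr//; apply: sumr_ge0 => i _; apply: sumr_ge0 => j _.
exact: sqr_ge0.
Qed.

Lemma ler_enorm_entry m n (M : 'M[R]_(m, n)) i j : `|M i j| <= enorm M.
Proof.
rewrite -(@ler_pXn2r _ 2)// ?nnegrE ?enorm_ge0// enorm_sqr real_normK ?num_real//.
rewrite (bigD1 i)//= (bigD1 j)//= -addrA lerDl addr_ge0//.
  by apply: sumr_ge0 => k _; exact: sqr_ge0.
by apply: sumr_ge0 => k _; apply: sumr_ge0 => l _; exact: sqr_ge0.
Qed.

Lemma enorm0 m n : enorm (0 : 'M[R]_(m, n)) = 0.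
Proof.
rewrite /enorm big1 ?sqrtr0// => i _; rewrite big1// => j _.
by rewrite mxE expr0n.
Qed.

Lemma enorm_eq0 m n (M : 'M[R]_(m, n)) : (enorm M == 0) = (M == 0).
Proof.
apply/eqP/eqP => [M0|->]; last exact: enorm0.
apply/matrixP => i j; rewrite mxE; apply/eqP; rewrite -normr_le0 -M0.
exact: ler_enorm_entry.
Qed.

Lemma enormZ m n (c : R) (M : 'M[R]_(m, n)) : enorm (c *: M) = `|c| * enorm M.
Proof.
rewrite /enorm -sqrtr_sqr -sqrtrM ?sqr_ge0//; congr Num.sqrt.
rewrite mulr_sumr; apply: eq_bigr => i _; rewrite mulr_sumr; apply: eq_bigr => j _.
by rewrite mxE exprMn.
Qed.

Lemma enormN m n (M : 'M[R]_(m, n)) : enorm (- M) = enorm M.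
Proof. by rewrite -scaleN1r enormZ normrN1 mul1r. Qed.

Lemma enormBC m n (M N : 'M[R]_(m, n)) : enorm (M - N) = enorm (N - M).
Proof. by rewrite -enormN opprB. Qed.

Lemma enorm_tr m n (M : 'M[R]_(m, n)) : enorm M^T = enorm M.
Proof.
rewrite /enorm exchange_big; congr Num.sqrt; apply: eq_bigr => i _.
by apply: eq_bigr => j _; rewrite mxE.
Qed.

Definition dot n (u v : 'cV[R]_n) : R := \sum_i u i 0 * v i 0.

Lemma dotC n (u v : 'cV[R]_n) : dot u v = dot v u.
Proof. by apply: eq_bigr => i _; rewrite mulrC. Qed.

Lemma dotDl n (u v w : 'cV[R]_n) : dot (u + v) w = dot u w + dot v w.
Proof. by rewrite -big_split; apply: eq_bigr => i _; rewrite mxE mulrDl. Qed.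

Lemma dotZl n c (u w : 'cV[R]_n) : dot (c *: u) w = c * dot u w.
Proof. by rewrite mulr_sumr; apply: eq_bigr => i _; rewrite mxE mulrA. Qed.

Lemma dotNl n (u w : 'cV[R]_n) : dot (- u) w = - dot u w.
Proof. by rewrite -scaleN1r dotZl mulN1r. Qed.

Lemma dotBl n (u v w : 'cV[R]_n) : dot (u - v) w = dot u w - dot v w.
Proof. by rewrite dotDl dotNl. Qed.

Lemma dotDr n (u v w : 'cV[R]_n) : dot w (u + v) = dot w u + dot w v.
Proof. by rewrite dotC dotDl !(dotC w). Qed.

Lemma dotBr n (u v w : 'cV[R]_n) : dot w (u - v) = dot w u - dot w v.
Proof. by rewrite dotC dotBl !(dotC w). Qed.

Lemma dotNr n (u w : 'cV[R]_n) : dot w (- u) = - dot w u.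
Proof. by rewrite dotC dotNl dotC. Qed.

Lemma dotZr n c (u w : 'cV[R]_n) : dot w (c *: u) = c * dot w u.
Proof. by rewrite dotC dotZl dotC. Qed.

Lemma dot_enorm n (u : 'cV[R]_n) : dot u u = enorm u ^+ 2.
Proof. by rewrite enorm_sqr; apply: eq_bigr => i _; rewrite big_ord1 expr2. Qed.

Lemma dot_mx n (u v : 'cV[R]_n) : (u^T *m v) 0 0 = dot u v.
Proof. by rewrite mxE; apply: eq_bigr => i _; rewrite mxE. Qed.

Lemma dot_adj m n (A : 'M[R]_(m, n)) u v : dot (A *m u) v = dot u (A^T *m v).
Proof. by rewrite -!dot_mx trmx_mul mulmxA. Qed.

Lemma enormD_sqr n (u v : 'cV[R]_n) :
  enorm (u + v) ^+ 2 = enorm u ^+ 2 + 2 * dot u v + enorm v ^+ 2.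
Proof. by rewrite -!dot_enorm dotDl !dotDr (dotC v u); ring. Qed.

Lemma dot_le n (u v : 'cV[R]_n) : dot u v <= enorm u * enorm v.
Proof.
have [->|v0] := eqVneq v 0.
  by rewrite enorm0 mulr0 /dot big1// => i _; rewrite mxE mulr0.
have v1 : 0 < enorm v by rewrite lt_def enorm_ge0 enorm_eq0 v0.
have := sqr_ge0 (enorm (enorm v *: u - enorm u *: v)).
rewrite enormD_sqr enormN !enormZ !ger0_norm ?enorm_ge0// dotZl dotNr dotZr => H.
have [->|u0] := eqVneq u 0.
  by rewrite enorm0 mul0r /dot big1// => i _; rewrite mxE mul0r.
have u1 : 0 < enorm u by rewrite lt_def enorm_ge0 enorm_eq0 u0.
rewrite -subr_ge0 -(@pmulr_rge0 _ (2 * (enorm u * enorm v))) ?mulr_gt0//.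
by apply: le_trans H _; rewrite le_eqVlt; apply/orP; left; apply/eqP; ring.
Qed.

Lemma normr_dot_le n (u v : 'cV[R]_n) : `|dot u v| <= enorm u * enorm v.
Proof.
by rewrite ler_norml dot_le andbT lerNl -dotNl -(enormN u) dot_le.
Qed.

Lemma ler_enormD n (u v : 'cV[R]_n) : enorm (u + v) <= enorm u + enorm v.
Proof.
rewrite -(@ler_pXn2r _ 2)// ?nnegrE ?addr_ge0 ?enorm_ge0//.
by rewrite enormD_sqr sqrrD; have := dot_le u v; lra.
Qed.

Lemma ler_enormB n (u v : 'cV[R]_n) : enorm (u - v) <= enorm u + enorm v.
Proof. by rewrite -(enormN v) ler_enormD. Qed.

Lemma ler_enorm_dist n (u v w : 'cV[R]_n) : enorm (u - w) <= enorm (u - v) + enorm (v - w).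
Proof. by apply: le_trans (ler_enormD _ _); rewrite addrA subrK. Qed.

Lemma ler_enorm_sum n (I : Type) (r : seq I) (p : pred I) (F : I -> 'cV[R]_n) :
  enorm (\sum_(i <- r | p i) F i) <= \sum_(i <- r | p i) enorm (F i).
Proof.
elim/big_rec2: _ => [|i y x _ xy]; first by rewrite enorm0.
by rewrite (le_trans (ler_enormD _ _))// lerD2l.
Qed.

Lemma ler_enorm_sum_entry n (v : 'cV[R]_n) : enorm v <= \sum_i `|v i 0|.
Proof.
have -> : v = \sum_i v i 0 *: delta_mx i 0.
  by rewrite [LHS]matrix_sum_delta; apply: eq_bigr => i _; rewrite big_ord1.
apply: le_trans (ler_enorm_sum _ _ _) _; apply: ler_sum => i _.
have e1 : enorm (delta_mx i 0 : 'cV[R]_n) = 1.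
  rewrite /enorm (bigD1 i)//= big_ord1 mxE !eqxx expr1n big1 ?addr0 ?sqrtr1// => k ki.
  by rewrite big_ord1 mxE (negbTE ki) expr0n.
rewrite enormZ e1 mulr1 summxE (bigD1 i)//= big1 ?addr0.
  by rewrite !mxE !eqxx mulr1.
by move=> k ki; rewrite !mxE eq_sym (negbTE ki) mulr0.
Qed.

Lemma ler_enorm_mul m n (A : 'M[R]_(m, n)) (v : 'cV[R]_n) :
  enorm (A *m v) <= enorm A * enorm v.
Proof.
rewrite -(@ler_pXn2r _ 2)// ?nnegrE ?mulr_ge0 ?enorm_ge0//.
rewrite exprMn (enorm_sqr A) (enorm_sqr (A *m v)) mulr_suml; apply: ler_sum => i _.
rewrite big_ord1.
have -> : (A *m v) i 0 = dot (row i A)^T v.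
  by rewrite mxE; apply: eq_bigr => j _; rewrite !mxE.
have -> : \sum_j A i j ^+ 2 = enorm (row i A)^T ^+ 2.
  by rewrite -dot_enorm; apply: eq_bigr => j _; rewrite !mxE expr2.
rewrite -exprMn -(real_normK (num_real (dot _ _))).
by rewrite ler_pXn2r// ?nnegrE ?mulr_ge0 ?enorm_ge0// normr_dot_le.
Qed.

(** A measurable selection of [sign_map]: at the origin the convention [0^-1 = 0] selects 0, which
    lies in the closed unit ball. *)
Definition sgv n (z : 'cV[R]_n) : 'cV[R]_n := (enorm z)^-1 *: z.

Lemma enorm_sgv n (z : 'cV[R]_n) : enorm (sgv z) <= 1.
Proof.
rewrite enormZ ger0_norm ?invr_ge0 ?enorm_ge0//.
have [->|z0] := eqVneq (enorm z) 0; first by rewrite mulr0.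
by rewrite mulVf.
Qed.

Lemma dot_sgv n (z : 'cV[R]_n) : dot (sgv z) z = enorm z.
Proof.
rewrite dotZl dot_enorm; have [->|z0] := eqVneq (enorm z) 0.
  by rewrite expr0n mulr0.
by rewrite expr2 mulKf.
Qed.

(** Each [dot (sgv c) e] is at most [enorm e], with equality for [c = e], so the two diagonal terms
    dominate the two mixed ones. *)
Lemma sgv_mono n (a b : 'cV[R]_n) : 0 <= dot (sgv a - sgv b) (a - b).
Proof.
rewrite dotBl !dotBr !dot_sgv.
have h c e : dot (sgv c) e <= enorm (e : 'cV[R]_n).
  by rewrite (le_trans (dot_le _ _))// ler_piMl ?enorm_ge0 ?enorm_sgv.
by have := h a b; have := h b a; lra.
Qed.

Lemma psd_coercive n (B : 'M[R]_n) (g : R) : 0 < g ->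
  psd (B *m B^T - (g ^+ 2)%:M) -> forall z : 'cV[R]_n, g * enorm z <= enorm (B^T *m z).
Proof.
move=> g0 hB z; have := hB z.
rewrite mulmxBr mulmxBl mxE [X in _ + X]mxE mul_mx_scalar -scalemxAl.
have -> : (z^T *m (B *m B^T) *m z) = (B^T *m z)^T *m (B^T *m z).
  by rewrite trmx_mul trmxK !mulmxA.
rewrite dot_mx dot_enorm mxE dot_mx dot_enorm => H.
rewrite -(@ler_pXn2r _ 2)// ?nnegrE ?mulr_ge0 ?enorm_ge0 ?(ltW g0)//.
by rewrite exprMn -subr_ge0.
Qed.

(** The coercivity of the transpose forces any row vector annihilated by [B] to have norm zero. *)
Lemma psd_unitmx n (B : 'M[R]_n) (g : R) : 0 < g ->
  psd (B *m B^T - (g ^+ 2)%:M) -> B \in unitmx.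
Proof.
move=> g0 hB; rewrite -row_free_unit; apply: inj_row_free => v vB.
have := psd_coercive g0 hB v^T.
rewrite -trmx_mul vB trmx0 enorm0 pmulr_rle0// => v0.
apply: trmx_inj; rewrite trmx0; apply/eqP.
by rewrite -enorm_eq0 eq_le v0 enorm_ge0.
Qed.

(* The tangent of the square root at [enorm a ^+ 2]. *)
Lemma ler_enormD_concave n (a b : 'cV[R]_n) : a != 0 ->
  enorm (a + b) <= enorm a + (2 * dot a b + enorm b ^+ 2) / (2 * enorm a).
Proof.
move=> a0; have a1 : 0 < enorm a by rewrite lt_def enorm_ge0 enorm_eq0 a0.
have /= H := enormD_sqr a b.
rewrite -(ler_pM2l (x := 2 * enorm a)) ?mulr_gt0// mulrDr mulrCA divff ?mulr1; last first.
  by rewrite gt_eqF// mulr_gt0.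
have -> : 2 * dot a b + enorm b ^+ 2 = enorm (a + b) ^+ 2 - enorm a ^+ 2 by rewrite H; ring.
by have := sqr_ge0 (enorm (a + b) - enorm a); nra.
Qed.

Lemma lipschitz_entry n m p (f : 'cV[R]_n -> 'M[R]_(m, p)) (L : R) :
  (forall x y, enorm (f x - f y) <= L * enorm (x - y)) ->
  forall i j x y, `|f x i j - f y i j| <= L * enorm (x - y).
Proof.
move=> Lf i j x y; apply: le_trans (Lf x y).
by have := ler_enorm_entry (f x - f y) i j; rewrite !mxE.
Qed.

End euclid.

(** The continuous functions x / (x^2 + 1/(k+1)) converge pointwise to the inverse, also at 0, where
    they all vanish in accordance with [0^-1 = 0]. *)
Lemma measurable_inv {R : realType} : measurable_fun [set: R] (fun x : R => x^-1).
Proof.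
pose g (k : nat) (x : R) := x * (x ^+ 2 + k.+1%:R^-1)^-1.
have p (k : nat) (x : R) : 0 < x ^+ 2 + k.+1%:R^-1 by rewrite ltr_wpDl ?sqr_ge0 ?invr_gt0.
apply: (@measurable_fun_cvg _ _ _ _ g).
  move=> k; apply: measurable_funM => //; apply: continuous_measurable_fun => x.
  apply: cvgV; first by rewrite gt_eqF.
  by apply: cvgD; [exact: exprn_continuous|exact: cvg_cst].
move=> x _; have [->|x0] := eqVneq x 0.
  by rewrite invr0 /g; under eq_fun do rewrite mul0r; exact: cvg_cst.
have -> : x^-1 = x * (x ^+ 2 + 0)^-1 by rewrite addr0 expr2 invfM mulrA mulfV// mul1r.
apply: cvgM; first exact: cvg_cst.
apply: cvgV; first by rewrite addr0 sqrf_eq0.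
by apply: cvgD; [exact: cvg_cst|exact: cvg_harmonic].
Qed.

(** * Measurability and square integrability of vector-valued maps *)

Section vector_wrt.
Context {R : realType} {dT : measure_display} {T : measurableType dT}.
Implicit Types (C : set (set T)).

Definition wrtm C m p (Z : T -> 'M[R]_(m, p)) : Prop :=
  forall i j, wrt <<s C>> (fun w => Z w i j).

Lemma eq_wrt C (Y Z : T -> R) : Y =1 Z -> wrt <<s C>> Y -> wrt <<s C>> Z.
Proof. by move=> /funext ->. Qed.

Lemma wrtm_cst C m p (M : 'M[R]_(m, p)) : wrtm C (fun=> M).
Proof. by move=> i j; exact: wrt_cst. Qed.

Lemma wrtmD C m p (Y Z : T -> 'M[R]_(m, p)) : wrtm C Y -> wrtm C Z ->
  wrtm C (fun w => Y w + Z w).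
Proof. by move=> mY mZ i j; apply: eq_wrt (wrtD (mY i j) (mZ i j)) => w; rewrite mxE. Qed.

Lemma wrtmB C m p (Y Z : T -> 'M[R]_(m, p)) : wrtm C Y -> wrtm C Z ->
  wrtm C (fun w => Y w - Z w).
Proof. by move=> mY mZ i j; apply: eq_wrt (wrtB (mY i j) (mZ i j)) => w; rewrite !mxE. Qed.

Lemma wrtmZ C m p (c : T -> R) (Z : T -> 'M[R]_(m, p)) : wrt <<s C>> c -> wrtm C Z ->
  wrtm C (fun w => c w *: Z w).
Proof. by move=> mc mZ i j; apply: eq_wrt (wrtM mc (mZ i j)) => w; rewrite mxE. Qed.

Lemma wrtm_mul C m p q (Y : T -> 'M[R]_(m, p)) (Z : T -> 'M[R]_(p, q)) :
  wrtm C Y -> wrtm C Z -> wrtm C (fun w => Y w *m Z w).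
Proof.
move=> mY mZ i j.
apply: (@eq_wrt _ (fun w => \sum_k Y w i k * Z w k j)); first by move=> w; rewrite mxE.
by apply: wrt_sum => k; exact: wrtM.
Qed.

Lemma wrt_enorm_sqr C m p (Z : T -> 'M[R]_(m, p)) : wrtm C Z ->
  wrt <<s C>> (fun w => enorm (Z w) ^+ 2).
Proof.
move=> mZ; apply: (@eq_wrt _ (fun w => \sum_i \sum_j Z w i j ^+ 2)).
  by move=> w; rewrite enorm_sqr.
apply: wrt_sum => i; apply: wrt_sum => j.
have m2 : measurable_fun [set: R] (fun x : R => x ^+ 2) by exact: exprn_measurable.
exact: (wrt_comp m2 (mZ i j)).
Qed.

Lemma rat_dense n (z : 'cV[R]_n) (e : R) : 0 < e ->
  exists q : 'cV[rat]_n, enorm (z - map_mx ratr q) < e.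
Proof.
move=> e0; have n0 : 0 < n.+1%:R :> R by [].
have e1 : 0 < e / n.+1%:R by rewrite divr_gt0.
have H i : {q : rat | `|z i 0 - ratr q| < e / n.+1%:R}.
  apply: cid; have [|q] := @rat_in_itvoo R (z i 0 - e / n.+1%:R) (z i 0 + e / n.+1%:R).
    by rewrite ltrD2l gtrN.
  by rewrite in_itv/= => Hq; exists q; rewrite distrC ltr_distl.
exists (\col_i sval (H i)); apply: le_lt_trans (ler_enorm_sum_entry _) _.
apply: (@le_lt_trans _ _ (\sum_(i < n) e / n.+1%:R)).
  by apply: ler_sum => i _; rewrite !mxE; case: (H i) => q /= /ltW.
rewrite sumr_const card_ord -[ltLHS]mulr_natr mulrAC ltr_pdivrMr// ltr_pM2l//.
by rewrite ltr_nat.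
Qed.

(** Measurability is known entry by entry only. The set where [f] is below [c] is a countable union
    of balls with rational centres [q] and radii (c - f q) / K, and a ball is described by the
    squared distance, a polynomial in the entries. *)
Lemma wrt_lipschitz C n (f : 'cV[R]_n -> R) (L : R) (Z : T -> 'cV[R]_n) :
  (forall u v, `|f u - f v| <= L * enorm (u - v)) -> wrtm C Z ->
  wrt <<s C>> (fun w => f (Z w)).
Proof.
move=> Lf0 mZ; pose K := `|L| + 1.
have K0 : 0 < K by rewrite ltr_wpDl.
have Lf u v : `|f u - f v| <= K * enorm (u - v).
  rewrite (le_trans (Lf0 u v))// ler_wpM2r ?enorm_ge0//.
  by rewrite (le_trans (ler_norm L))// lerDl.
apply/wrtP; apply: (@measurability _ _ (g_sigma_algebraType C) _ _ _ _ (RGenInftyO.measurableE R)).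
move=> _ [_ [c ->] <-].
pose r (q : 'cV[rat]_n) := (c - f (map_mx ratr q)) / K.
pose E (q : 'cV[rat]_n) : set T := if 0 < r q then
  (fun w => enorm (Z w - map_mx ratr q) ^+ 2) @^-1` `]-oo, r q ^+ 2[ else set0.
have mE q : (<<s C>>) (E q).
  rewrite /E; case: ifP => _; last exact: sigma_algebra0.
  have := wrt_enorm_sqr (wrtmB mZ (wrtm_cst (C := C) (map_mx ratr q))).
  by apply; exact: measurable_itv.
have Er q w : E q w <-> f (map_mx ratr q) + K * enorm (Z w - map_mx ratr q) < c.
  rewrite /E /r; split.
    case: ifP => // r0; rewrite /= in_itv/= ltr_pXn2r ?nnegrE ?enorm_ge0 ?(ltW r0)//.
    by rewrite ltr_pdivlMr// mulrC; lra.
  move=> H; have H' : K * enorm (Z w - map_mx ratr q) < c - f (map_mx ratr q) by lra.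
  have r0 : 0 < (c - f (map_mx ratr q)) / K.
    by rewrite divr_gt0// (le_lt_trans _ H')// mulr_ge0 ?enorm_ge0// ltW.
  rewrite r0 /= in_itv/= ltr_pXn2r ?nnegrE ?enorm_ge0 ?(ltW r0)//.
  by rewrite ltr_pdivlMr// mulrC.
rewrite [X in measurable X](_ : _ = \bigcup_k (if unpickle k is Some q then E q else set0)).
  apply: bigcupT_measurable => k; case: (unpickle k) => [q|]; first exact: mE.
  exact: measurable0.
rewrite setTI; apply/seteqP; split => w.
  rewrite /= in_itv/= => fc.
  (* Half of the available radius: the bound f q + K |Z w - q| exceeds f (Z w) by at most 2 K |Z w -
     q|, hence stays below [c]. *)
  have [|q Hq] := rat_dense (Z w) (e := (c - f (Z w)) / (2 * K)).
    by rewrite divr_gt0 ?subr_gt0 ?mulr_gt0.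
  exists (pickle q) => //; rewrite pickleK; apply/Er.
  move: Hq; rewrite ltr_pdivlMr ?mulr_gt0// => Hq.
  by have := Lf (Z w) (map_mx ratr q); rewrite ler_norml => /andP[]; lra.
move=> [k _]; case: (unpickle k) => // q /Er H; rewrite /= in_itv/=.
by have := Lf (Z w) (map_mx ratr q); rewrite ler_norml => /andP[]; lra.
Qed.

Lemma wrt_enorm C n (Z : T -> 'cV[R]_n) : wrtm C Z -> wrt <<s C>> (fun w => enorm (Z w)).
Proof.
apply: (@wrt_lipschitz C n (@enorm R n 1) 1) => u v; rewrite mul1r ler_distlC.
have := ler_enormD (u - v) v; have := ler_enormD (v - u) u.
by rewrite !subrK (enormBC v u) => H1 H2; apply/andP; split; lra.
Qed.

Lemma wrtm_sgv C n (Z : T -> 'cV[R]_n) : wrtm C Z -> wrtm C (fun w => sgv (Z w)).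
Proof.
move=> mZ; apply: wrtmZ => //.
exact: (wrt_comp measurable_inv (wrt_enorm mZ)).
Qed.

Lemma wrtm_lipschitz C n m p (f : 'cV[R]_n -> 'M[R]_(m, p)) (L : R) (Z : T -> 'cV[R]_n) :
  (forall u v, enorm (f u - f v) <= L * enorm (u - v)) -> wrtm C Z ->
  wrtm C (fun w => f (Z w)).
Proof.
move=> Lf mZ i j; apply: (wrt_lipschitz (f := fun z => f z i j) (L := L)) => //.
exact: lipschitz_entry.
Qed.
End vector_wrt.

Section vector_L2.
Context {R : realType} {dO : measure_display} {Omega : measurableType dO}.
Variable P : probability Omega R.
Local Notation Ex f := (Rintegral P setT f).
Local Notation L1 := (L1 P).
Local Notation L2 := (L2 P).

Definition L2m m p (Z : Omega -> 'M[R]_(m, p)) : Prop := forall i j, L2 (fun w => Z w i j).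
Definition M2 m p (Z : Omega -> 'M[R]_(m, p)) : R := Ex (fun w => enorm (Z w) ^+ 2).

Lemma eq_L2 (f g : Omega -> R) : f =1 g -> L2 f -> L2 g.
Proof. by move=> /funext ->. Qed.

Lemma eq_L1 (f g : Omega -> R) : f =1 g -> L1 f -> L1 g.
Proof. by move=> /funext ->. Qed.

Lemma eq_Ex (f g : Omega -> R) : f =1 g -> Ex f = Ex g.
Proof. by move=> /funext ->. Qed.

Lemma L2m_cst m p (M : 'M[R]_(m, p)) : L2m (fun=> M).
Proof. by move=> i j; exact: L2_cst. Qed.

Lemma L2mD m p (Y Z : Omega -> 'M[R]_(m, p)) : L2m Y -> L2m Z -> L2m (fun w => Y w + Z w).
Proof. by move=> mY mZ i j; apply: eq_L2 (L2D (mY i j) (mZ i j)) => w; rewrite mxE. Qed.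

Lemma L2mB m p (Y Z : Omega -> 'M[R]_(m, p)) : L2m Y -> L2m Z -> L2m (fun w => Y w - Z w).
Proof. by move=> mY mZ i j; apply: eq_L2 (L2B (mY i j) (mZ i j)) => w; rewrite !mxE. Qed.

Lemma L2mZ m p (c : R) (Z : Omega -> 'M[R]_(m, p)) : L2m Z -> L2m (fun w => c *: Z w).
Proof. by move=> mZ i j; apply: eq_L2 (L2Z c (mZ i j)) => w; rewrite mxE. Qed.

Lemma L2m_L1 m p (Z : Omega -> 'M[R]_(m, p)) : L2m Z -> L1 (fun w => enorm (Z w) ^+ 2).
Proof.
move=> LZ; apply: (@eq_L1 (fun w => \sum_i \sum_j Z w i j ^+ 2)).
  by move=> w; rewrite enorm_sqr.
by apply: L1_sum => i; apply: L1_sum => j; exact: L2_sqr.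
Qed.

Lemma M2_ge0 m p (Z : Omega -> 'M[R]_(m, p)) : 0 <= M2 Z.
Proof. by apply: Ex_ge0 => w; exact: sqr_ge0. Qed.

Lemma M2E m p (Z : Omega -> 'M[R]_(m, p)) : L2m Z ->
  M2 Z = \sum_i \sum_j Ex (fun w => Z w i j ^+ 2).
Proof.
move=> LZ; rewrite /M2 (@eq_Ex _ (fun w => \sum_i \sum_j Z w i j ^+ 2)).
  rewrite Ex_sum; last by move=> i; apply: L1_sum => j; exact: L2_sqr.
  by apply: eq_bigr => i _; rewrite Ex_sum// => j; exact: L2_sqr.
by move=> w; rewrite enorm_sqr.
Qed.

Lemma L2_dominated (f : Omega -> R) m p (Z : Omega -> 'M[R]_(m, p)) (c0 c1 : R) :
  measurable_fun setT f -> L2m Z ->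
  (forall w, `|f w| <= c0 + c1 * enorm (Z w)) -> L2 f.
Proof.
move=> mf LZ fZ; split => //.
apply: (@L1_le _ _ _ _ _ (fun w => 2 * c0 ^+ 2 + 2 * c1 ^+ 2 * enorm (Z w) ^+ 2)).
- exact: measurable_funX.
- move=> w; rewrite normrX; have := fZ w; have := enorm_ge0 (Z w).
  have := normr_ge0 (f w); have := sqr_ge0 (c0 - c1 * enorm (Z w)).
  move: `|f w| (enorm (Z w)) => u v H u0 v0 H'.
  have : u ^+ 2 <= (c0 + c1 * v) ^+ 2.
    by rewrite ler_pXn2r// nnegrE (le_trans u0).
  by rewrite !expr2 in H *; lra.
- by apply: L1D; [exact: L1_cst|exact/L1Z/L2m_L1].
Qed.

Lemma L2_enorm n (Z : Omega -> 'cV[R]_n) : measurable_fun setT (fun w => enorm (Z w)) ->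
  L2m Z -> L2 (fun w => enorm (Z w)).
Proof. by move=> mZ LZ; split => //; exact: L2m_L1. Qed.

End vector_L2.

Section vector_step.
Context {R : realType} {dO : measure_display} {Omega : measurableType dO}.
Variables (P : probability Omega R) (d : nat) (beta : 'I_d -> R -> Omega -> R).
Hypothesis hbeta : independent_brownian_motions P beta.

Definition filtration_gen (t : R) : set (set Omega) :=
  (\bigcup_j \bigcup_(s in `[0, t]) preimage_set_system setT (beta j s) measurable)
  `|` [set N | measurable N /\ P N = 0%E].

Definition dbeta (s t : R) (w : Omega) : 'cV[R]_d := \col_j incr beta j s t w.

Lemma wrtm_le s t m p (Z : Omega -> 'M[R]_(m, p)) : s <= t ->
  wrtm (filtration_gen s) Z -> wrtm (filtration_gen t) Z.
Proof. by move=> st mZ i j; apply: (wrt_filtration_le st); exact: mZ. Qed.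

Lemma wrtm_dbeta s t : 0 <= s <= t -> wrtm (filtration_gen t) (dbeta s t).
Proof.
move=> st j k; apply: (@eq_wrt _ _ _ _ (incr beta j s t)); first by move=> w; rewrite mxE.
exact: wrt_incr.
Qed.

Lemma wrtm_measurable t m p (Z : Omega -> 'M[R]_(m, p)) i j : wrtm (filtration_gen t) Z ->
  measurable_fun setT (fun w => Z w i j).
Proof. by move=> mZ; apply: (wrt_measurable _ (mZ i j)); exact: augmented_filtration_measurable. Qed.

Lemma vector_step n s t (S : Omega -> 'cV[R]_n) (G : Omega -> 'M[R]_(n, d)) :
  0 <= s <= t -> wrtm (filtration_gen s) S -> L2m P S ->
  wrtm (filtration_gen s) G -> L2m P G ->
  L2m P (fun w => S w + G w *m dbeta s t w) /\
  M2 P (fun w => S w + G w *m dbeta s t w) <= M2 P S + 8 * (t - s) * M2 P G.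
Proof.
move=> st mS LS mG LG.
have H i := step_sum hbeta st (mS i 0) (LS i 0) (mG i) (LG i).
have E i (w : Omega) : (S w + G w *m dbeta s t w) i 0 =
    S w i 0 + \sum_j G w i j * incr beta j s t w.
  by rewrite !mxE; congr +%R; apply: eq_bigr => j _; rewrite mxE.
have L : L2m P (fun w => S w + G w *m dbeta s t w).
  move=> i j; rewrite ord1; have [+ _] := H i.
  by apply: eq_L2 => w; rewrite E.
split => //; rewrite !M2E// mulr_sumr -big_split/=; apply: ler_sum => i _.
rewrite !big_ord1; have [_ +] := H i; apply: le_trans.
by rewrite le_eqVlt; apply/orP; left; apply/eqP; apply: eq_Ex => w; rewrite E.
Qed.

End vector_step.

Lemma discrete_gronwall {R : realType} (a : nat -> R) (C h e : R) N : 0 <= C -> 0 <= h ->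
  0 <= e -> 0 <= a 0%N -> (forall k, (k < N)%N -> a k.+1 <= (1 + h * C) * a k + h * e) ->
  forall k, (k <= N)%N -> a k <= expR (C * (h * k%:R)) * (a 0%N + e * (h * k%:R)).
Proof.
move=> C0 h0 e0 a0 H; elim => [_|k ih kN].
  by rewrite !mulr0 expR0 mul1r addr0.
have := ih (ltnW kN) => {}ih; apply: (le_trans (H _ kN)).
have hC : 0 <= h * C by rewrite mulr_ge0.
apply: (@le_trans _ _ ((1 + h * C) * (expR (C * (h * k%:R)) * (a 0%N + e * (h * k%:R))) + h * e)).
  by rewrite lerD2r ler_wpM2l// addr_ge0.
have -> : C * (h * k.+1%:R) = C * (h * k%:R) + h * C by rewrite -natr1; ring.
have -> : a 0%N + e * (h * k.+1%:R) = a 0%N + e * (h * k%:R) + h * e by rewrite -natr1; ring.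
rewrite expRD; set E := expR (C * (h * k%:R)).
have E1 : 1 <= E by rewrite -expR0 ler_expR !mulr_ge0.
have X1 : 1 + h * C <= expR (h * C) by exact: expR_ge1Dx.
set G := a 0%N + e * (h * k%:R).
have G0 : 0 <= G by rewrite addr_ge0// !mulr_ge0.
have he : 0 <= h * e by rewrite mulr_ge0.
rewrite [leRHS]mulrDr lerD//.
  rewrite mulrA ler_wpM2r// mulrC ler_wpM2l//; lra.
rewrite -[leLHS]mul1r ler_wpM2r// -[leLHS]mulr1 ler_pM//; lra.
Qed.

(** * The explicit Euler scheme *)

Section grid.
Context {R : realType}.
Variable T : R.
Hypothesis hT : 0 < T.

Definition step (m : nat) : R := T / 2 ^+ m.
Definition tm (m k : nat) : R := step m * k%:R.

Lemma step_gt0 m : 0 < step m. Proof. by rewrite divr_gt0// exprn_gt0. Qed.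
Lemma step_le m : step m <= T.
Proof. rewrite ler_pdivrMr ?exprn_gt0// ler_peMr//; [exact: ltW|by rewrite exprn_ege1 ?ler1n]. Qed.
Lemma tm0 m : tm m 0 = 0. Proof. exact: mulr0. Qed.
Lemma tmS m k : tm m k.+1 = tm m k + step m.
Proof. by rewrite /tm -natr1 mulrDr mulr1. Qed.
Lemma tm_last m : tm m (2 ^ m) = T.
Proof. by rewrite /tm /step natrX divfK// expf_neq0. Qed.
Lemma tm_le m k l : (tm m k <= tm m l) = (k <= l)%N.
Proof. by rewrite ler_pM2l ?step_gt0// ler_nat. Qed.
Lemma tm_ge0 m k : 0 <= tm m k.
Proof. by rewrite mulr_ge0// ltW// step_gt0. Qed.
Lemma tm_leT m k : (k <= 2 ^ m)%N -> tm m k <= T.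
Proof. by rewrite -[leRHS](tm_last m) tm_le. Qed.
Lemma tm_leS m k : 0 <= tm m k <= tm m k.+1.
Proof. by rewrite tm_ge0 tm_le leqnSn. Qed.
Lemma step_add m q : step (m + q) = step m / 2 ^+ q.
Proof. by rewrite /step exprD invfM mulrA. Qed.
Lemma tm_refine m q k : tm (m + q) (k * 2 ^ q) = tm m k.
Proof.
by rewrite /tm step_add natrM natrX mulrACA mulVf ?mulr1 ?expf_neq0.
Qed.
Lemma tm_cell m t : 0 <= t <= T ->
  exists2 c, (c < 2 ^ m)%N & tm m c <= t <= tm m c.+1.
Proof.
move=> /andP[t0 tT].
have ex : exists k, (k < 2 ^ m)%N && (t <= tm m k.+1).
  exists (2 ^ m).-1; rewrite prednK ?expn_gt0// leqnn tm_last tT//.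
case: (ex_minnP ex) => c /andP[c1 c2] cmin; exists c => //; rewrite c2 andbT.
case: c c1 c2 cmin => [|c] c1 c2 cmin; first by rewrite tm0.
rewrite leNgt; apply/negP => tc.
by have := cmin c; rewrite (ltnW c1) (ltW tc) ltnn => /(_ isT).
Qed.
Lemma step_cvg0 : step @ \oo --> 0.
Proof.
rewrite -(mulr0 T) /step; apply: cvgM; first exact: cvg_cst.
under eq_fun do rewrite -exprVn.
by apply: cvg_expr; rewrite ger0_norm// invf_lt1// ltr1n.
Qed.
End grid.

(* The data of the equation, extended to all times, with the constants of the
   a priori estimates; [modulus m] bounds the oscillation of the coefficients
   over one step of the dyadic grid of level [m]. *)
Record setting (R : realType) (n d : nat) := Setting {
  horizon : R ;
  matA : R -> 'M[R]_n ;
  matB : R -> 'M[R]_n ;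
  noise : 'cV[R]_n -> 'M[R]_(n, d) ;
  start : 'cV[R]_n ;
  target : 'cV[R]_n ;
  gain : R ;
  boundA : R ;
  boundB : R ;
  lipC : R ;
  modulus : nat -> R ;
  coercivity : R ;
  horizon_gt0 : 0 < horizon ;
  gain_gt0 : 0 < gain ;
  boundA_ge0 : 0 <= boundA ;
  boundB_ge0 : 0 <= boundB ;
  lipC_ge0 : 0 <= lipC ;
  coercivity_gt0 : 0 < coercivity ;
  matA_le : forall t, enorm (matA t) <= boundA ;
  matB_le : forall t, enorm (matB t) <= boundB ;
  modulus_ge0 : forall m, 0 <= modulus m ;
  matA_modulus : forall m s t, `|s - t| <= step horizon m ->
    enorm (matA s - matA t) <= modulus m ;
  matB_modulus : forall m s t, `|s - t| <= step horizon m ->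
    enorm (matB s - matB t) <= modulus m ;
  modulus_cvg0 : modulus @ \oo --> 0 ;
  matB_coercive : forall t, psd (matB t *m (matB t)^T - (coercivity ^+ 2)%:M) ;
  noise_lip : forall u v, enorm (noise u - noise v) <= lipC * enorm (u - v) ;
  noise_target : noise target = 0 }.

Section scheme.
Context {R : realType} {dO : measure_display} {Omega : measurableType dO}.
Variables (P : probability Omega R) (n d : nat) (beta : 'I_d -> R -> Omega -> R).
Hypothesis hbeta : independent_brownian_motions P beta.
Variable S : setting R n d.
Local Notation T := (horizon S).
Local Notation A := (matA S).
Local Notation B := (matB S).
Local Notation sigma := (noise S).
Local Notation x := (start S).
Local Notation y := (target S).
Local Notation rho := (gain S).
Local Notation a := (boundA S).
Local Notation b := (boundB S).
Local Notation L := (lipC S).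
Let hT : 0 < T := horizon_gt0 S.
Let rho0 : 0 < rho := gain_gt0 S.
Let a0 : 0 <= a := boundA_ge0 S.
Let b0 : 0 <= b := boundB_ge0 S.
Let L0 : 0 <= L := lipC_ge0 S.
Let Aa : forall t, enorm (A t) <= a := matA_le S.
Let Bb : forall t, enorm (B t) <= b := matB_le S.
Let sigmaL : forall u v, enorm (sigma u - sigma v) <= L * enorm (u - v) := noise_lip S.
Let sigmay : sigma y = 0 := noise_target S.
Local Notation gen := (filtration_gen P beta).
Local Notation L1 := (L1 P).
Local Notation L2 := (L2 P).
Local Notation L2m := (L2m P).
Local Notation M2 := (M2 P).
Local Notation tm := (tm T).
Local Notation step := (step T).

Definition sign_control (t : R) (z : 'cV[R]_n) : 'cV[R]_n := - rho *: sgv ((B t)^T *m (z - y)).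
Definition drift_at (t : R) (z : 'cV[R]_n) : 'cV[R]_n := B t *m sign_control t z - A t *m z.

Fixpoint euler (m k : nat) (w : Omega) : 'cV[R]_n :=
  if k is k'.+1 then
    euler m k' w + step m *: drift_at (tm m k') (euler m k' w)
    + sigma (euler m k' w) *m dbeta beta (tm m k') (tm m k'.+1) w
  else x.

Lemma enorm_sign_control t z : enorm (sign_control t z) <= rho.
Proof. by rewrite enormZ normrN gtr0_norm// ler_piMr ?(ltW rho0)// enorm_sgv. Qed.

(** Bounds the drift at the target, where [A *m y] and the control contribute; away from it the
    drift grows linearly with slope [a]. *)
Definition drift_const : R := a * enorm y + b * rho.

Lemma drift_const_ge0 : 0 <= drift_const.
Proof. by rewrite addr_ge0// mulr_ge0// ?enorm_ge0// ltW. Qed.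

Lemma enorm_matB_control t t' z : enorm (B t *m sign_control t' z) <= b * rho.
Proof.
apply: le_trans (ler_enorm_mul _ _) _.
by apply: ler_pM; rewrite ?enorm_ge0// enorm_sign_control.
Qed.

Lemma enorm_drift_at t z : enorm (drift_at t z) <= a * enorm (z - y) + drift_const.
Proof.
rewrite /drift_at (le_trans (ler_enormB _ _))// addrC.
have : enorm (A t *m z) <= a * enorm (z - y) + a * enorm y.
  apply: le_trans (ler_enorm_mul _ _) _; rewrite -mulrDr.
  by apply: ler_pM; rewrite ?enorm_ge0// -[X in enorm X](subrK y z) ler_enormD.
by have := enorm_matB_control t t z; rewrite /drift_const; lra.
Qed.

Lemma enorm_drift_at_sqr t z : enorm (drift_at t z) ^+ 2 <= 2 * a ^+ 2 * enorm (z - y) ^+ 2 + 2 * drift_const ^+ 2.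
Proof.
have h : enorm (drift_at t z) ^+ 2 <= (a * enorm (z - y) + drift_const) ^+ 2.
  by rewrite ler_pXn2r// ?nnegrE ?enorm_ge0// ?enorm_drift_at// addr_ge0 ?mulr_ge0 ?enorm_ge0 ?drift_const_ge0.
by apply: (le_trans h); have := sqr_ge0 (a * enorm (z - y) - drift_const); rewrite !expr2; lra.
Qed.

Lemma enorm_sigma z : enorm (sigma z) <= L * enorm (z - y).
Proof. by have := sigmaL z y; rewrite sigmay subr0. Qed.

Lemma enorm_sigma_sqr z : enorm (sigma z) ^+ 2 <= L ^+ 2 * enorm (z - y) ^+ 2.
Proof.
by rewrite -exprMn ler_pXn2r// ?nnegrE ?mulr_ge0 ?enorm_ge0// enorm_sigma.
Qed.

Lemma L2m_dominated t m p q (Y : Omega -> 'M[R]_(m, p)) (Z : Omega -> 'M[R]_(q, 1)) (k0 k1 : R) :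
  wrtm (gen t) Y -> L2m Z -> (forall w, enorm (Y w) <= k0 + k1 * enorm (Z w)) -> L2m Y.
Proof.
move=> mY LZ YZ i j; apply: (L2_dominated (Z := Z) (c0 := k0) (c1 := k1)) => //.
  exact: (wrtm_measurable hbeta).
by move=> w; exact: le_trans (ler_enorm_entry _ _ _) (YZ w).
Qed.

Lemma wrtm_sign_control t s (Z : Omega -> 'cV[R]_n) : wrtm (gen t) Z ->
  wrtm (gen t) (fun w => sign_control s (Z w)).
Proof.
move=> mZ; apply: wrtmZ; first exact: wrt_cst.
apply: wrtm_sgv; apply: wrtm_mul; first exact: wrtm_cst.
by apply: wrtmB => //; exact: wrtm_cst.
Qed.

Lemma wrtm_drift_at t s (Z : Omega -> 'cV[R]_n) : wrtm (gen t) Z -> wrtm (gen t) (fun w => drift_at s (Z w)).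
Proof.
move=> mZ; apply: wrtmB; apply: wrtm_mul => //; try exact: wrtm_cst.
exact: wrtm_sign_control.
Qed.

Lemma wrtm_sigma t (Z : Omega -> 'cV[R]_n) : wrtm (gen t) Z -> wrtm (gen t) (fun w => sigma (Z w)).
Proof. exact: wrtm_lipschitz. Qed.

Lemma L2m_drift_at t s (Z : Omega -> 'cV[R]_n) : wrtm (gen t) Z -> L2m Z -> L2m (fun w => drift_at s (Z w)).
Proof.
move=> mZ LZ; apply: (L2m_dominated (Z := fun w => Z w - y) (k0 := drift_const) (k1 := a) (wrtm_drift_at s mZ)).
  by apply: L2mB => //; exact: L2m_cst.
by move=> w; rewrite addrC enorm_drift_at.
Qed.

Lemma L2m_sigma t (Z : Omega -> 'cV[R]_n) : wrtm (gen t) Z -> L2m Z -> L2m (fun w => sigma (Z w)).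
Proof.
move=> mZ LZ; apply: (L2m_dominated (Z := fun w => Z w - y) (k0 := 0) (k1 := L) (wrtm_sigma mZ)).
  by apply: L2mB => //; exact: L2m_cst.
by move=> w; rewrite add0r enorm_sigma.
Qed.

Lemma euler_wrt_L2 m k : wrtm (gen (tm m k)) (euler m k) /\ L2m (euler m k).
Proof.
elim: k => [|k [ih1 ih2]]; first by split; [exact: wrtm_cst|exact: L2m_cst].
have st := tm_leS hT m k.
have mS : wrtm (gen (tm m k)) (fun w => euler m k w + step m *: drift_at (tm m k) (euler m k w)).
  by apply: wrtmD => //; apply: wrtmZ; [exact: wrt_cst|exact: wrtm_drift_at].
have LS : L2m (fun w => euler m k w + step m *: drift_at (tm m k) (euler m k w)).
  by apply: L2mD => //; apply: L2mZ; exact: L2m_drift_at ih1 ih2.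
have [H _] := vector_step hbeta st mS LS (wrtm_sigma ih1) (L2m_sigma ih1 ih2).
split => //=; apply: wrtmD; first exact: wrtm_le (andP st).2 mS.
apply: wrtm_mul; last exact: wrtm_dbeta.
exact: wrtm_le (andP st).2 (wrtm_sigma ih1).
Qed.

Lemma euler_wrt m k : wrtm (gen (tm m k)) (euler m k). Proof. by case: (euler_wrt_L2 m k). Qed.
Lemma euler_L2 m k : L2m (euler m k). Proof. by case: (euler_wrt_L2 m k). Qed.

Lemma euler_L2y m k : L2m (fun w => euler m k w - y).
Proof. by apply: L2mB; [exact: euler_L2|exact: L2m_cst]. Qed.

(** Gronwall rate for the mean square of X - y: with V the state minus [y] and f the drift, 1 and
    part of the next term come from 2 <V, f> <= |V|^2 + |f|^2, the factor 1 + T from h + h^2 <= h (1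
    + T), and 8 from the noise step. [moment_source] collects what is left of the drift at V = 0. *)
Definition moment_rate : R := 1 + 2 * (1 + T) * a ^+ 2 + 8 * L ^+ 2.
Definition moment_source : R := 2 * (1 + T) * drift_const ^+ 2.
Definition moment_bound : R := expR (moment_rate * T) * (enorm (x - y) ^+ 2 + moment_source * T).

Lemma moment_rate_ge0 : 0 <= moment_rate.
Proof.
by rewrite /moment_rate; have := sqr_ge0 a; have := sqr_ge0 L; have := hT; nra.
Qed.

Lemma moment_source_ge0 : 0 <= moment_source.
Proof. by have := hT; rewrite /moment_source => ?; rewrite mulr_ge0 ?sqr_ge0// mulr_ge0//; lra. Qed.

Lemma moment_bound_ge0 : 0 <= moment_bound.
Proof. by rewrite mulr_ge0 ?expR_ge0// addr_ge0 ?sqr_ge0// mulr_ge0 ?moment_source_ge0// ltW. Qed.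

Lemma M2_sigma t (Z : Omega -> 'cV[R]_n) : wrtm (gen t) Z -> L2m Z ->
  M2 (fun w => sigma (Z w)) <= L ^+ 2 * M2 (fun w => Z w - y).
Proof.
move=> mZ LZ; have Ly : L2m (fun w => Z w - y) by apply: L2mB => //; exact: L2m_cst.
rewrite /M2 -ExZ; last exact: L2m_L1.
apply: Ex_le; [exact/L2m_L1/(L2m_sigma mZ)|exact/L1Z/L2m_L1|].
by move=> w; exact: enorm_sigma_sqr.
Qed.

Lemma M2_drift_at t s (Z : Omega -> 'cV[R]_n) : wrtm (gen t) Z -> L2m Z ->
  M2 (fun w => drift_at s (Z w)) <= 2 * a ^+ 2 * M2 (fun w => Z w - y) + 2 * drift_const ^+ 2.
Proof.
move=> mZ LZ; have Ly : L2m (fun w => Z w - y) by apply: L2mB => //; exact: L2m_cst.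
rewrite /M2 -ExZ; last exact: L2m_L1.
rewrite -[X in _ <= _ + X](Ex_cst P) -ExD; [|exact/L1Z/L2m_L1|exact: L1_cst].
apply: Ex_le; first exact/L2m_L1/(L2m_drift_at _ mZ).
  by apply: L1D; [exact/L1Z/L2m_L1|exact: L1_cst].
by move=> w; exact: enorm_drift_at_sqr.
Qed.

Lemma euler_moment m k : (k <= 2 ^ m)%N -> M2 (fun w => euler m k w - y) <= moment_bound.
Proof.
have h0 := step_gt0 hT m; have hh := step_le hT m.
move=> kN.
have /= := @discrete_gronwall R (fun k => M2 (fun w => euler m k w - y)) moment_rate (step m) moment_source (2 ^ m)
  moment_rate_ge0 (ltW h0) moment_source_ge0 (M2_ge0 _ _).
rewrite [M2 (fun=> x - y)]Ex_cst => /(_ _ _ kN) H.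
apply: le_trans (H _) _; last first.
  rewrite -/(tm m k); have := tm_leT hT kN => tT; apply: ler_pM.
  - exact: expR_ge0.
  - by rewrite addr_ge0 ?sqr_ge0// mulr_ge0 ?moment_source_ge0// tm_ge0.
  - by rewrite ler_expR ler_wpM2l ?moment_rate_ge0.
  - by rewrite lerD2l ler_wpM2l ?moment_source_ge0.
move=> {kN H}k _.
set V := fun w => euler m k w - y.
set f := fun w => drift_at (tm m k) (euler m k w).
have LV : L2m V by exact: euler_L2y.
have Lf : L2m f := L2m_drift_at (tm m k) (@euler_wrt m k) (@euler_L2 m k).
have mS : wrtm (gen (tm m k)) (fun w => V w + step m *: f w).
  apply: wrtmD; first by apply: wrtmB; [exact: euler_wrt|exact: wrtm_cst].
  by apply: wrtmZ; [exact: wrt_cst|apply: wrtm_drift_at; exact: euler_wrt].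
have LS : L2m (fun w => V w + step m *: f w) by apply: L2mD => //; exact: L2mZ.
have [_ H] := vector_step hbeta (tm_leS hT m k) mS LS (wrtm_sigma (@euler_wrt m k))
   (L2m_sigma (@euler_wrt m k) (@euler_L2 m k)).
rewrite (_ : (fun w => euler m k.+1 w - y) = (fun w => V w + step m *: f w
    + sigma (euler m k w) *m dbeta beta (tm m k) (tm m k.+1) w)); last first.
  by apply/funext => w /=; rewrite /V /f addrAC; congr +%R; rewrite addrAC.
apply: (le_trans H); rewrite tmS addrAC subrr add0r.
have HS : M2 (fun w => V w + step m *: f w) <= (1 + step m) * M2 V + (step m + step m ^+ 2) * M2 f.
  rewrite /M2 -!ExZ; [|exact: L2m_L1..].
  rewrite -ExD; [|exact/L1Z/L2m_L1..].
  apply: Ex_le; [exact: L2m_L1|by apply: L1D; exact/L1Z/L2m_L1|move=> w].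
  rewrite enormD_sqr dotZr enormZ gtr0_norm// exprMn.
  have := dot_le (V w) (f w); have := sqr_ge0 (enorm (V w) - enorm (f w)).
  have := enorm_ge0 (V w); have := enorm_ge0 (f w).
  move: (enorm (V w)) (enorm (f w)) (dot _ _) => v u e u0 v0 uv eb.
  have h2 : 2 * e <= v ^+ 2 + u ^+ 2 by rewrite !expr2 in uv *; lra.
  have := ler_wpM2l (ltW h0) h2.
  by lra.
have := M2_sigma (@euler_wrt m k) (@euler_L2 m k); rewrite -/V.
have := M2_drift_at (tm m k) (@euler_wrt m k) (@euler_L2 m k); rewrite -/V -/f.
have := M2_ge0 P V; have := M2_ge0 P f.
move: HS; rewrite /moment_rate /moment_source.
move: (M2 V) (M2 f) (M2 (fun w => V w + step m *: f w)) (M2 (fun w => sigma (euler m k w))) =>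
  v u e s HS u0 v0 Hu Hs.
have hu : (step m + step m ^+ 2) * u <= step m * (1 + T) * (2 * a ^+ 2 * v + 2 * drift_const ^+ 2).
  apply: ler_pM => //; first by rewrite addr_ge0 ?sqr_ge0 ?ltW.
  by rewrite expr2 mulrDr mulr1 lerD2l ler_pM2l.
have hs : 8 * step m * s <= 8 * step m * (L ^+ 2 * v).
  by rewrite ler_wpM2l// mulr_ge0// ltW.
by lra.
Qed.

End scheme.
Arguments euler {R dO Omega n d} beta S m k w.
Arguments sign_control {R n d} S t z.
Arguments drift_at {R n d} S t z.
Arguments drift_const {R n d} S.
Arguments moment_bound {R n d} S.
Arguments euler_wrt {R dO Omega P n d beta} hbeta S m k.
Arguments euler_L2 {R dO Omega P n d beta} hbeta S m k.
Arguments euler_moment {R dO Omega P n d beta} hbeta S [m k].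
Arguments wrtm_drift_at {R dO Omega P n d beta} S {t} s {Z}.
Arguments L2m_drift_at {R dO Omega P n d beta} hbeta S {t} s {Z}.
Arguments wrtm_sigma {R dO Omega P n d beta} S {t Z}.
Arguments L2m_sigma {R dO Omega P n d beta} hbeta S {t Z}.
Arguments M2_drift_at {R dO Omega P n d beta} hbeta S {t} s {Z}.
Arguments M2_sigma {R dO Omega P n d beta} hbeta S {t Z}.

(** * Sums along nested dyadic grids *)

Section grid_sums.
Context {R : realType} {V : zmodType}.
Variable T : R.
Hypothesis hT : 0 < T.
Local Notation tm := (tm T).
Implicit Types (G : nat -> R -> V).

Lemma tm_add1 m k : tm m.+1 k.*2 = tm m k.
Proof. by have := tm_refine T m 1 k; rewrite addn1 expn1 muln2. Qed.

Lemma sum_double (F : nat -> V) N :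
  \sum_(k < N.*2) F k = \sum_(k < N) (F k.*2 + F k.*2.+1).
Proof.
elim: N => [|N ih]; first by rewrite !big_ord0.
by rewrite doubleS !big_ord_recr/= ih addrA.
Qed.

(** The function frozen on a coarse cell stays the same on its 2^q subcells, where its increments
    telescope. This writes schemes of different levels over one common grid. *)
Lemma grid_sum_refine G m q t :
  \sum_(c < 2 ^ m) (G c (Num.min (tm m c.+1) t) - G c (Num.min (tm m c) t)) =
  \sum_(k < 2 ^ (m + q)) (G (k %/ 2 ^ q)%N (Num.min (tm (m + q) k.+1) t)
                        - G (k %/ 2 ^ q)%N (Num.min (tm (m + q) k) t)).
Proof.
elim: q => [|q ih].
  by rewrite addn0; apply: eq_bigr => c _; rewrite expn0 divn1.
rewrite ih addnS expnS mul2n.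
rewrite (sum_double (fun k => G (k %/ 2 ^ q.+1)%N (Num.min (tm (m + q).+1 k.+1) t)
                        - G (k %/ 2 ^ q.+1)%N (Num.min (tm (m + q).+1 k) t))).
apply: eq_bigr => k _; rewrite expnS !divnMA !divn2 doubleK.
rewrite -uphalfE uphalf_double -doubleS !tm_add1.
by rewrite [RHS]addrC addrA subrK.
Qed.

Lemma grid_sum_cell G m c t : (c < 2 ^ m)%N -> tm m c <= t <= tm m c.+1 ->
  \sum_(k < 2 ^ m) (G k (Num.min (tm m k.+1) t) - G k (Num.min (tm m k) t)) =
  \sum_(k < c) (G k (tm m k.+1) - G k (tm m k)) + (G c t - G c (tm m c)).
Proof.
move=> cm /andP[ct tc]; move: (2 ^ m)%N cm => N /subnKC <-; rewrite big_split_ord/= [X in _ + X]big1 ?addr0;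
  last first.
  move=> i _; rewrite !min_r ?subrr//; apply: (le_trans tc); rewrite tm_le//.
    by rewrite leq_addr.
  by rewrite leqW// leq_addr.
rewrite big_ord_recr/= (min_r tc) (min_l ct); congr +%R; apply: eq_bigr => i _.
by rewrite !min_l// (le_trans _ ct)// tm_le// ltnW.
Qed.

Lemma grid_sum_upto G m l : (l <= 2 ^ m)%N ->
  \sum_(k < 2 ^ m) (G k (Num.min (tm m k.+1) (tm m l)) - G k (Num.min (tm m k) (tm m l))) =
  \sum_(k < l) (G k (tm m k.+1) - G k (tm m k)).
Proof.
case: l => [_|l lm].
  rewrite big_ord0 big1// => k _; rewrite !min_r ?subrr// tm_le//.
have := @grid_sum_cell G m l (tm m l.+1) lm; rewrite !(tm_le hT) leqnSn leqnn => /(_ isT) ->.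
by rewrite [RHS]big_ord_recr.
Qed.
End grid_sums.

Section isometry.
Context {R : realType} {dO : measure_display} {Omega : measurableType dO}.
Variables (P : probability Omega R) (d : nat) (beta : 'I_d -> R -> Omega -> R).
Hypothesis hbeta : independent_brownian_motions P beta.
Local Notation F := (augmented_filtration P beta).
Local Notation Ex f := (Rintegral P setT f).
Local Notation L2 := (L2 P).
Local Notation incr := (incr beta).

Lemma sum_isometry j (tau : nat -> R) (zeta : nat -> Omega -> R) K :
  (forall k, 0 <= tau k <= tau k.+1) ->
  (forall k, (k < K)%N -> wrt (F (tau k)) (zeta k)) ->
  (forall k, (k < K)%N -> L2 (zeta k)) ->
  [/\ wrt (F (tau K)) (fun w => \sum_(i < K) zeta i w * incr j (tau i) (tau i.+1) w),
    L2 (fun w => \sum_(i < K) zeta i w * incr j (tau i) (tau i.+1) w) &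
  Ex (fun w => (\sum_(i < K) zeta i w * incr j (tau i) (tau i.+1) w) ^+ 2) <=
  8 * \sum_(i < K) (tau i.+1 - tau i) * Ex (fun w => zeta i w ^+ 2)].
Proof.
move=> tau0; elim: K => [|K ih] wz Lz.
  have E : (fun w => \sum_(i < 0) zeta i w * incr j (tau i) (tau i.+1) w) = fun=> 0.
    by apply/funext => w; rewrite big_ord0.
  rewrite E; split; [exact: wrt_cst|exact: L2_cst|].
  by under [leLHS]eq_Rintegral do rewrite big_ord0 expr0n; rewrite Ex_cst big_ord0 mulr0.
have [||H1 H2 H3] := ih; [by move=> k kK; apply: wz; exact: ltnW|by move=> k kK; apply: Lz; exact: ltnW|].
have E : (fun w => \sum_(i < K.+1) zeta i w * incr j (tau i) (tau i.+1) w) =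
   (fun w => \sum_(i < K) zeta i w * incr j (tau i) (tau i.+1) w + zeta K w * incr j (tau K) (tau K.+1) w).
  by apply/funext => w; rewrite big_ord_recr.
have [Hs1 Hs2] := past_step hbeta (l := j) (tau0 K) (wrt_past (lexx _) H1) H2
    (wrt_past (lexx _) (wz K (ltnSn K))) (Lz K (ltnSn K)).
rewrite E; split => //.
  apply: wrtD; first exact: wrt_filtration_le (andP (tau0 K)).2 H1.
  apply: wrtM; first exact: wrt_filtration_le (andP (tau0 K)).2 (wz K _).
  exact: wrt_incr.
rewrite [leLHS](_ : _ = Ex (fun w =>
  (\sum_(i < K) zeta i w * incr j (tau i) (tau i.+1) w + zeta K w * incr j (tau K) (tau K.+1) w) ^+ 2));
    last first.
  by apply: eq_Ex => w; rewrite big_ord_recr.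
apply: (le_trans Hs2); rewrite big_ord_recr/= [leRHS]mulrDr lerD// mulrA//.
Qed.

Lemma sum_isometry_min j (tau : nat -> R) (zeta : nat -> Omega -> R) K t :
  (forall k, 0 <= tau k <= tau k.+1) -> 0 <= t ->
  (forall k, wrt (F (tau k)) (zeta k)) ->
  (forall k, (k < K)%N -> L2 (zeta k)) ->
  [/\ wrt (F t) (fun w => \sum_(i < K) zeta i w * incr j (Num.min (tau i) t) (Num.min (tau i.+1) t) w),
   L2 (fun w => \sum_(i < K) zeta i w * incr j (Num.min (tau i) t) (Num.min (tau i.+1) t) w) &
  Ex (fun w => (\sum_(i < K) zeta i w * incr j (Num.min (tau i) t) (Num.min (tau i.+1) t) w) ^+ 2) <=
  8 * \sum_(i < K) (Num.min (tau i.+1) t - Num.min (tau i) t) * Ex (fun w => zeta i w ^+ 2)].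
Proof.
move=> tau0 t0 wz Lz.
(* Coefficients of cells that start after [t] meet an empty increment and may be set to 0; this
   makes them measurable at the truncated time. *)
pose z k w := if tau k <= t then zeta k w else 0.
pose s k := Num.min (tau k) t.
have s0 k : 0 <= s k <= s k.+1.
  have /andP[t1 t2] := tau0 k; rewrite /s le_min t1 t0/= le_min !ge_min t2 lexx orbT//.
have wzs k : wrt (F (s k)) (z k).
  rewrite /z /s; case: (leP (tau k) t) => _; [exact: wz|exact: wrt_cst].
have Lzs k : (k < K)%N -> L2 (z k).
  by move=> kK; rewrite /z; case: (tau k <= t); [exact: Lz|exact: L2_cst].
have E w : \sum_(i < K) zeta i w * incr j (Num.min (tau i) t) (Num.min (tau i.+1) t) w =
   \sum_(i < K) z i w * incr j (s i) (s i.+1) w.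
  apply: eq_bigr => i _; rewrite /z /s; case: (leP (tau i) t) => // ti.
  rewrite min_r; last by rewrite (le_trans (ltW ti))// (andP (tau0 i)).2.
  by rewrite /incr subrr mulr0 mul0r.
have [H1 H2 H3] := sum_isometry j s0 (fun k _ => wzs k) Lzs.
split.
- apply: eq_wrt (fun w => esym (E w)) _; apply: wrt_filtration_le H1.
  by rewrite /s ge_min lexx orbT.
- exact: eq_L2 (fun w => esym (E w)) _.
rewrite (@eq_Ex _ _ _ P _ (fun w => (\sum_(i < K) z i w * incr j (s i) (s i.+1) w) ^+ 2)); last first.
  by move=> w; rewrite E.
apply: (le_trans H3); rewrite ler_wpM2l//; apply: ler_sum => i _.
apply: ler_wpM2l; first by rewrite subr_ge0; case/andP: (s0 i).
rewrite /z; case: (tau i <= t) => //; rewrite expr0n Ex_cst.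
by apply: Ex_ge0 => w; exact: sqr_ge0.
Qed.
End isometry.

(** * Continuous-time interpolation of the scheme *)

Section interpolation.
Context {R : realType} {dO : measure_display} {Omega : measurableType dO}.
Variables (P : probability Omega R) (n d : nat) (beta : 'I_d -> R -> Omega -> R).
Hypothesis hbeta : independent_brownian_motions P beta.
Variable S : setting R n d.
Local Notation T := (horizon S).
Local Notation A := (matA S).
Local Notation B := (matB S).
Local Notation sigma := (noise S).
Local Notation x := (start S).
Local Notation y := (target S).
Local Notation rho := (gain S).
Local Notation a := (boundA S).
Local Notation b := (boundB S).
Local Notation L := (lipC S).
Let hT : 0 < T := horizon_gt0 S.
Let rho0 : 0 < rho := gain_gt0 S.
Let a0 : 0 <= a := boundA_ge0 S.
Let b0 : 0 <= b := boundB_ge0 S.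
Let L0 : 0 <= L := lipC_ge0 S.
Let Aa : forall t, enorm (A t) <= a := matA_le S.
Let Bb : forall t, enorm (B t) <= b := matB_le S.
Let sigmaL : forall u v, enorm (sigma u - sigma v) <= L * enorm (u - v) := noise_lip S.
Let sigmay : sigma y = 0 := noise_target S.
Local Notation gen := (filtration_gen P beta).
Local Notation L1 := (L1 P).
Local Notation L2 := (L2 P).
Local Notation L2m := (L2m P).
Local Notation M2 := (M2 P).
Local Notation tm := (tm T).
Local Notation step := (step T).
Local Notation euler := (euler beta S).
Local Notation drift_at := (drift_at S).
Local Notation incr := (incr beta).
Local Notation dbeta := (dbeta beta).
Local Notation moment_bound := (moment_bound S).
Local Notation drift_const := (drift_const S).
Local Notation euler_wrt := (euler_wrt hbeta S).
Local Notation euler_L2 := (euler_L2 hbeta S).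
Local Notation euler_moment := (euler_moment hbeta S).

(** The sum runs over all cells with times truncated at [t], so cells after [t] contribute nothing.
    One formula thus serves every [t], and two levels can be subtracted term by term after
    refinement. *)
Definition mart (m : nat) i j (t : R) (w : Omega) : R :=
  \sum_(k < 2 ^ m) sigma (euler m k w) i j * incr j (Num.min (tm m k) t) (Num.min (tm m k.+1) t) w.

Definition drift (m : nat) (t : R) (w : Omega) : 'cV[R]_n :=
  \sum_(k < 2 ^ m) (Num.min (tm m k.+1) t - Num.min (tm m k) t) *: drift_at (tm m k) (euler m k w).

Definition interp (m : nat) (t : R) (w : Omega) : 'cV[R]_n :=
  x + drift m t w + \col_i \sum_j mart m i j t w.

Lemma mart_cell m i j c t w : (c < 2 ^ m)%N -> tm m c <= t <= tm m c.+1 ->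
  mart m i j t w = \sum_(k < c) sigma (euler m k w) i j * incr j (tm m k) (tm m k.+1) w
    + sigma (euler m c w) i j * incr j (tm m c) t w.
Proof.
move=> cm ct; have := grid_sum_cell hT (fun k s => sigma (euler m k w) i j * beta j s w) cm ct.
rewrite -mulrBr => H; rewrite /mart [RHS](_ : _ = \sum_(k < c)
    (sigma (euler m k w) i j * beta j (tm m k.+1) w - sigma (euler m k w) i j * beta j (tm m k) w)
    + sigma (euler m c w) i j * (beta j t w - beta j (tm m c) w)).
  by rewrite -H; apply: eq_bigr => k _; rewrite -mulrBr.
by congr +%R; apply: eq_bigr => k _; rewrite -mulrBr.
Qed.

Lemma drift_cell m c t w : (c < 2 ^ m)%N -> tm m c <= t <= tm m c.+1 ->
  drift m t w = \sum_(k < c) step m *: drift_at (tm m k) (euler m k w)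
    + (t - tm m c) *: drift_at (tm m c) (euler m c w).
Proof.
move=> cm ct; have := grid_sum_cell hT (fun k s => s *: drift_at (tm m k) (euler m k w)) cm ct.
rewrite -scalerBl => H; rewrite /drift [RHS](_ : _ = \sum_(k < c)
    (tm m k.+1 *: drift_at (tm m k) (euler m k w) - tm m k *: drift_at (tm m k) (euler m k w))
    + (t - tm m c) *: drift_at (tm m c) (euler m c w)).
  by rewrite -H; apply: eq_bigr => k _; rewrite -scalerBl.
by congr +%R; apply: eq_bigr => k _; rewrite -scalerBl tmS addrAC subrr add0r.
Qed.

Lemma eulerE m c w : euler m c w = x + \sum_(k < c) step m *: drift_at (tm m k) (euler m k w)
  + \sum_(k < c) sigma (euler m k w) *m dbeta (tm m k) (tm m k.+1) w.
Proof.
elim: c => [|c ih]; first by rewrite !big_ord0 !addr0.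
rewrite !big_ord_recr/= {1}ih -!addrA; congr +%R; congr +%R.
by rewrite addrCA.
Qed.

Lemma interp_cell m c t w : (c < 2 ^ m)%N -> tm m c <= t <= tm m c.+1 ->
  interp m t w = euler m c w + (t - tm m c) *: drift_at (tm m c) (euler m c w)
    + sigma (euler m c w) *m dbeta (tm m c) t w.
Proof.
move=> cm ct; rewrite /interp (drift_cell w cm ct) [X in _ = X + _ + _]eulerE.
rewrite [X in _ + X](_ : _ = \sum_(k < c) sigma (euler m k w) *m dbeta (tm m k) (tm m k.+1) w
   + sigma (euler m c w) *m dbeta (tm m c) t w); last first.
  apply/colP => i; rewrite !mxE summxE.
  rewrite [LHS](eq_bigr (fun j => \sum_(k < c) sigma (euler m k w) i j * incr j (tm m k) (tm m k.+1) w
    + sigma (euler m c w) i j * incr j (tm m c) t w)); last first.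
    by move=> j _; rewrite (mart_cell _ _ _ cm ct).
  rewrite big_split exchange_big/=; congr +%R; apply: eq_bigr => k _; last by rewrite !mxE.
  by rewrite mxE; apply: eq_bigr => j _; rewrite !mxE.
rewrite !addrA; congr +%R; rewrite -!addrA; congr +%R; congr +%R.
by rewrite addrC.
Qed.

Lemma interp_increment m c s t w : (c < 2 ^ m)%N -> tm m c <= s -> s <= t -> t <= tm m c.+1 ->
  interp m t w = interp m s w + (t - s) *: drift_at (tm m c) (euler m c w)
    + sigma (euler m c w) *m dbeta s t w.
Proof.
move=> cm cs st tc; rewrite (interp_cell w cm (t := t)) ?(le_trans cs st)//.
rewrite (interp_cell w cm (t := s)) ?cs ?(le_trans st tc)//.
have -> : dbeta (tm m c) t w = dbeta (tm m c) s w + dbeta s t w.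
  by apply/colP => j; rewrite !mxE /incr addrC addrA subrK.
rewrite mulmxDr -!addrA; congr +%R.
have -> : t - tm m c = (t - s) + (s - tm m c) by rewrite addrA subrK.
rewrite scalerDl -!addrA addrCA; congr +%R; rewrite addrCA; congr +%R.
Qed.

Lemma interp0 m w : interp m 0 w = x.
Proof.
have cm : (0 < 2 ^ m)%N by rewrite expn_gt0.
rewrite (interp_cell w cm) ?tm0 ?lexx ?(ltW (step_gt0 hT m)) ?tm_ge0//=.
rewrite subrr scale0r addr0 (_ : dbeta 0 0 w = 0) ?mulmx0 ?addr0//.
by apply/colP => j; rewrite !mxE /incr subrr.
Qed.

Lemma interp_grid m k w : (k <= 2 ^ m)%N -> interp m (tm m k) w = euler m k w.
Proof.
case: k => [|k] km; first by rewrite tm0 interp0.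
have -> : euler m k.+1 w = euler m k w + (tm m k.+1 - tm m k) *: drift_at (tm m k) (euler m k w)
    + sigma (euler m k w) *m dbeta (tm m k) (tm m k.+1) w.
  by rewrite tmS [_ + step m]addrC addrK -[step m + _]addrC -tmS.
by rewrite (interp_cell w km)// !(tm_le hT) leqnSn leqnn.
Qed.

Definition drift_moment : R := 2 * a ^+ 2 * moment_bound + 2 * drift_const ^+ 2.
(** One factor t - s of the squared drift term is bounded by [T], which brings drift and noise to
    the same order t - s within a cell. *)
Definition increment_rate : R := T * drift_moment + 8 * L ^+ 2 * moment_bound.

Lemma drift_moment_ge0 : 0 <= drift_moment.
Proof. apply: addr_ge0; last by rewrite mulr_ge0 ?sqr_ge0.
by apply: mulr_ge0; [rewrite mulr_ge0 ?sqr_ge0|exact: moment_bound_ge0]. Qed.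

Lemma increment_rate_ge0 : 0 <= increment_rate.
Proof. apply: addr_ge0; first by apply: mulr_ge0; [exact: ltW|exact: drift_moment_ge0].
by apply: mulr_ge0; [rewrite mulr_ge0 ?sqr_ge0|exact: moment_bound_ge0]. Qed.

Lemma euler_M2_drift m k s : (k <= 2 ^ m)%N -> M2 (fun w => drift_at s (euler m k w)) <= drift_moment.
Proof.
move=> km; apply: le_trans (M2_drift_at hbeta S s (euler_wrt m k) (euler_L2 m k)) _.
by rewrite lerD2r ler_wpM2l ?mulr_ge0 ?sqr_ge0// euler_moment.
Qed.

Lemma euler_M2_sigma m k : (k <= 2 ^ m)%N -> M2 (fun w => sigma (euler m k w)) <= L ^+ 2 * moment_bound.
Proof.
move=> km; apply: le_trans (M2_sigma hbeta S (euler_wrt m k) (euler_L2 m k)) _.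
by rewrite ler_wpM2l ?sqr_ge0// euler_moment.
Qed.

Lemma step_increment m c s t : (c < 2 ^ m)%N -> tm m c <= s -> s <= t -> t <= tm m c.+1 ->
  let Y w := (t - s) *: drift_at (tm m c) (euler m c w) + sigma (euler m c w) *m dbeta s t w in
  [/\ wrtm (gen t) Y, L2m Y & M2 Y <= (t - s) * increment_rate].
Proof.
move=> cm cs st tc Y.
have s0 : 0 <= s by rewrite (le_trans _ cs)// tm_ge0.
have st' : 0 <= s <= t by rewrite s0.
have wf : wrtm (gen s) (fun w => (t - s) *: drift_at (tm m c) (euler m c w)).
  apply: wrtmZ; first exact: wrt_cst.
  by apply: wrtm_drift_at; apply: wrtm_le cs _; exact: euler_wrt.
have Lf : L2m (fun w => drift_at (tm m c) (euler m c w)).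
  exact: (L2m_drift_at hbeta S _ (euler_wrt m c) (euler_L2 m c)).
have ws : wrtm (gen (tm m c)) (fun w => sigma (euler m c w)).
  exact: (wrtm_sigma S (euler_wrt m c)).
have Ls : L2m (fun w => sigma (euler m c w)).
  exact: (L2m_sigma hbeta S (euler_wrt m c) (euler_L2 m c)).
have [H1 H2] := vector_step hbeta st' wf (L2mZ (t - s) Lf) (wrtm_le cs ws) Ls.
split => //.
  apply: wrtmD; first exact: wrtm_le st wf.
  by apply: wrtm_mul; [exact: wrtm_le (le_trans cs st) ws|exact: wrtm_dbeta].
apply: (le_trans H2).
have ts0 : 0 <= t - s by rewrite subr_ge0.
have tsT : t - s <= T.
  have := step_le hT m; move: tc; rewrite tmS; lra.
rewrite [X in X + _ <= _](_ : _ = (t - s) ^+ 2 * M2 (fun w => drift_at (tm m c) (euler m c w))); last first.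
  by rewrite /M2 -ExZ; [apply: eq_Ex => w; rewrite enormZ exprMn real_normK ?num_real|exact: L2m_L1].
rewrite /increment_rate [leRHS]mulrDr lerD//.
  by rewrite expr2 -mulrA ler_wpM2l// ler_pM ?M2_ge0 ?euler_M2_drift// ltnW.
have -> : (t - s) * (8 * L ^+ 2 * moment_bound) = 8 * (t - s) * (L ^+ 2 * moment_bound) by ring.
by rewrite ler_wpM2l ?mulr_ge0// euler_M2_sigma// ltnW.
Qed.

Lemma interp_wrt_L2 m t : 0 <= t <= T -> wrtm (gen t) (interp m t) /\ L2m (interp m t).
Proof.
move=> tT; have [c cm /andP[ct tc]] := tm_cell m tT.
have [H1 H2 _] := step_increment cm (lexx _) ct tc.
have E : interp m t = fun w => euler m c w + ((t - tm m c) *: drift_at (tm m c) (euler m c w) +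
  sigma (euler m c w) *m dbeta (tm m c) t w).
  by apply/funext => w; rewrite (interp_cell w cm) ?ct// addrA.
rewrite E; split; last by apply: L2mD => //; exact: euler_L2.
by apply: wrtmD => //; apply: wrtm_le ct _; exact: euler_wrt.
Qed.

Lemma interp_increment_M2 m c s t : (c < 2 ^ m)%N -> tm m c <= s -> s <= t -> t <= tm m c.+1 ->
  M2 (fun w => interp m t w - interp m s w) <= (t - s) * increment_rate.
Proof.
move=> cm cs st tc; have [_ _] := step_increment cm cs st tc; apply: le_trans.
rewrite le_eqVlt; apply/orP; left; apply/eqP; apply: eq_Ex => w.
by rewrite (interp_increment w cm cs st tc) addrAC [interp m s w + _]addrC addrK.
Qed.

End interpolation.
Arguments mart {R dO Omega n d} beta S m i j t w.
Arguments drift {R dO Omega n d} beta S m t w.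
Arguments interp {R dO Omega n d} beta S m t w.
Arguments drift_moment {R n d} S.
Arguments increment_rate {R n d} S.
Arguments interp_wrt_L2 {R dO Omega P n d beta} hbeta S m [t].
Arguments interp_increment_M2 {R dO Omega P n d beta} hbeta S [m c s t].
Arguments interp_increment {R dO Omega n d} beta S [m c s t] w.
Arguments interp_cell {R dO Omega n d} beta S [m c t] w.
Arguments interp_grid {R dO Omega n d} beta S [m k] w.
Arguments mart_cell {R dO Omega n d} beta S [m] i j [c t] w.
Arguments euler_M2_drift {R dO Omega P n d beta} hbeta S [m k] s.
Arguments euler_M2_sigma {R dO Omega P n d beta} hbeta S [m k].
Arguments step_increment {R dO Omega P n d beta} hbeta S [m c s t].

(** * Comparison of two dyadic levels *)

Section square_inequalities.
Context {R : realType} {n : nat}.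
Implicit Types u v : 'cV[R]_n.

Lemma dot_le_sqr u v : 2 * dot u v <= enorm u ^+ 2 + enorm v ^+ 2.
Proof. by have := dot_le u v; have := sqr_ge0 (enorm u - enorm v); rewrite !expr2; lra. Qed.

Lemma enormD_sqr_le u v : enorm (u + v) ^+ 2 <= 2 * enorm u ^+ 2 + 2 * enorm v ^+ 2.
Proof. by rewrite enormD_sqr; have := dot_le_sqr u v; lra. Qed.

Lemma enormB_sqr_le u v : enorm (u - v) ^+ 2 <= 2 * enorm u ^+ 2 + 2 * enorm v ^+ 2.
Proof. by rewrite -(enormN v) enormD_sqr_le. Qed.
End square_inequalities.

Lemma cell_lag {R : realType} (u u' v v' s : R) :
  u <= v -> v' <= u' -> v <= v' -> u' = u + s -> v - u <= s.
Proof. lra. Qed.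

Section comparison.
Context {R : realType} {dO : measure_display} {Omega : measurableType dO}.
Variables (P : probability Omega R) (n d : nat) (beta : 'I_d -> R -> Omega -> R).
Hypothesis hbeta : independent_brownian_motions P beta.
Variable S : setting R n d.
Local Notation T := (horizon S).
Local Notation A := (matA S).
Local Notation B := (matB S).
Local Notation sigma := (noise S).
Local Notation y := (target S).
Local Notation rho := (gain S).
Local Notation a := (boundA S).
Local Notation b := (boundB S).
Local Notation L := (lipC S).
Local Notation om := (modulus S).
Let hT : 0 < T := horizon_gt0 S.
Local Notation gen := (filtration_gen P beta).
Local Notation Ex f := (Rintegral P setT f).
Local Notation L1 := (L1 P).
Local Notation L2m := (L2m P).
Local Notation M2 := (M2 P).
Local Notation tm := (tm T).
Local Notation step := (step T).
Local Notation euler := (euler beta S).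
Local Notation interp := (interp beta S).
Local Notation drift_at := (drift_at S).
Local Notation sign_control := (sign_control S).
Local Notation dbeta := (dbeta beta).
Local Notation moment_bound := (moment_bound S).
Local Notation increment_rate := (increment_rate S).
Local Notation drift_moment := (drift_moment S).

Lemma subrBB (V : zmodType) (p q r s : V) : (p - q) - (r - s) = - (q - s) + (p - r).
Proof. by rewrite !opprB addrACA [RHS]addrACA (addrC p). Qed.

Lemma addB3 (V : zmodType) (i u v j u' v' : V) :
  (i + u + v) - (j + u' + v') = (i - j) + (u - u') + (v - v').
Proof. by rewrite opprD addrACA; congr (_ + _); rewrite opprD addrACA. Qed.

Ltac L1_tac := repeat first [done | apply: L1D | apply: L1Z | exact: L1_cst | apply: L2m_L1].

(* Monotonicity of [sgv] stands in for the Lipschitz continuity that the feedback lacks. *)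
Lemma control_monotone s t e (Y Y' : 'cV[R]_n) : enorm (B s - B t) <= e ->
  dot (Y - Y') (B s *m sign_control s Y - B t *m sign_control t Y') <=
  rho * e * (enorm (Y - y) + enorm (Y' - y)).
Proof.
move=> Be; have rho0 := gain_gt0 S.
set u := sign_control s Y; set u' := sign_control t Y'.
set z := (B s)^T *m (Y - y); set z'' := (B t)^T *m (Y' - y).
(* The two states are seen through [B] at different times. Only the first term is monotone; the
   other two carry the difference of [B s] and [B t]. *)
have E : dot (Y - Y') (B s *m u - B t *m u') = dot (z - z'') (u - u')
   + dot (z'' - (B s)^T *m (Y' - y)) u - dot ((B t)^T *m (Y - y) - z) u'.
  have adj (M : 'M[R]_n) v q : dot v (M *m q) = dot (M^T *m v) q.
    by rewrite dotC dot_adj dotC.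
  rewrite [LHS]dotBr !adj.
  have -> : Y - Y' = (Y - y) - (Y' - y) by rewrite opprB addrA subrK.
  by rewrite !(mulmxBr _ (Y - y)) -/z -/z'' !dotBl !dotBr; ring.
have H1 : dot (z - z'') (u - u') <= 0.
  rewrite /u /u' /sign_control -/z -/z'' -scalerBr dotZr mulNr oppr_le0 mulr_ge0 ?(ltW rho0)//.
  by rewrite dotC sgv_mono.
have H2 : dot (z'' - (B s)^T *m (Y' - y)) u <= e * enorm (Y' - y) * rho.
  rewrite /z'' -mulmxBl; apply: le_trans (dot_le _ _) _.
  apply: ler_pM; rewrite ?enorm_ge0 ?enorm_sign_control//.
  apply: le_trans (ler_enorm_mul _ _) _; apply: ler_wpM2r; first exact: enorm_ge0.
  by rewrite -linearB enorm_tr enormBC.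
have H3 : - dot ((B t)^T *m (Y - y) - z) u' <= e * enorm (Y - y) * rho.
  rewrite /z -mulmxBl -dotNl; apply: le_trans (dot_le _ _) _.
  apply: ler_pM; rewrite ?enorm_ge0 ?enorm_sign_control// enormN.
  apply: le_trans (ler_enorm_mul _ _) _; apply: ler_wpM2r; first exact: enorm_ge0.
  by rewrite -linearB enorm_tr enormBC.
by rewrite E; lra.
Qed.

(** Here [e1] is the linear part, [e2] the monotone comparison of controls and [e3] the control
    tested against the lag [E]. Controls may differ by an amount that does not shrink, so [e3] is of
    first order in [E]; Young's inequality with weight [th] turns 2 E into E^2 / th + th. *)
Lemma drift_comparison_arith (D E Y' r r' e a' b' rho' th e1 e2 e3 : R) :
  0 <= D -> 0 <= E -> 0 <= Y' -> 0 <= r -> 0 <= r' -> 0 <= e -> 0 <= a' -> 0 <= b' -> 0 < rho' -> 0 < th ->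
  e1 <= D * (a' * (D + E) + e * Y') -> e2 <= rho' * e * (r + r') -> e3 <= E * (2 * (b' * rho')) ->
  2 * (e1 + e2 + e3) <= (3 * a' + 1) * D ^+ 2 + (a' + 2 * (b' * rho') / th) * E ^+ 2
    + 2 * (b' * rho') * th + e ^+ 2 * Y' ^+ 2 + rho' * e * (2 + r ^+ 2 + r' ^+ 2).
Proof.
move=> D0 E0 Y0 r0 r'0 e0 a0 b0 rho0 th0 H1 H2 H3.
have I1 : 2 * (D * (a' * (D + E) + e * Y')) <= (3 * a' + 1) * D ^+ 2 + a' * E ^+ 2 + e ^+ 2 * Y' ^+ 2.
  have : 0 <= a' * (D - E) ^+ 2 by rewrite mulr_ge0 ?sqr_ge0.
  by have := sqr_ge0 (D - e * Y'); rewrite !expr2; lra.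
have I2 : 2 * (rho' * e * (r + r')) <= rho' * e * (2 + r ^+ 2 + r' ^+ 2).
  have re : 0 <= rho' * e by rewrite mulr_ge0// ltW.
  have h : 2 * (r + r') <= 2 + r ^+ 2 + r' ^+ 2.
    by have := sqr_ge0 (r - 1); have := sqr_ge0 (r' - 1); rewrite !expr2; lra.
  by have := ler_wpM2l re h; lra.
have I3 : 2 * (E * (2 * (b' * rho'))) <= 2 * (b' * rho') / th * E ^+ 2 + 2 * (b' * rho') * th.
  have br : 0 <= 2 * (b' * rho') by rewrite !mulr_ge0// ltW.
  have h : 2 * E <= th^-1 * E ^+ 2 + th.
    rewrite -subr_ge0.
    have -> : th^-1 * E ^+ 2 + th - 2 * E = th^-1 * (E - th) ^+ 2 by field; rewrite gt_eqF.
    by rewrite mulr_ge0 ?sqr_ge0// invr_ge0 ltW.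
  by have := ler_wpM2l br h; lra.
lra.
Qed.

(** [X] is the interpolated coarse path, [Y] the state at which its drift is frozen, [Y'] the fine
    state. Monotonicity speaks about Y - Y' whereas the error is X - Y'; the price of exchanging
    them is the bounded control tested against the lag X - Y. *)
Lemma drift_comparison s t e th (Y Y' X : 'cV[R]_n) : 0 <= e -> 0 < th ->
  enorm (A s - A t) <= e -> enorm (B s - B t) <= e ->
  2 * dot (X - Y') (drift_at s Y - drift_at t Y') <=
    (3 * a + 1) * enorm (X - Y') ^+ 2 + (a + 2 * (b * rho) / th) * enorm (X - Y) ^+ 2
    + 2 * (b * rho) * th + e ^+ 2 * enorm Y' ^+ 2
    + rho * e * (2 + enorm (Y - y) ^+ 2 + enorm (Y' - y) ^+ 2).
Proof.
move=> e0 th0 Ae Be.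
have a0 := boundA_ge0 S; have b0 := boundB_ge0 S; have rho0 := gain_gt0 S.
have -> : dot (X - Y') (drift_at s Y - drift_at t Y') =
   - dot (X - Y') (A s *m Y - A t *m Y') + dot (Y - Y') (B s *m sign_control s Y - B t *m sign_control t Y')
   + dot (X - Y) (B s *m sign_control s Y - B t *m sign_control t Y').
  rewrite /drift_at subrBB.
  rewrite dotDr dotNr -addrA -dotDl; congr (_ + dot _ _).
  by rewrite [RHS]addrC addrA subrK.
apply: drift_comparison_arith => //; try exact: enorm_ge0.
- rewrite -dotNr; apply: le_trans (dot_le _ _) _; rewrite enormN ler_wpM2l ?enorm_ge0//.
  have -> : A s *m Y - A t *m Y' = A s *m (Y - Y') + (A s - A t) *m Y'.
    by rewrite mulmxBr mulmxBl addrA subrK.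
  apply: le_trans (ler_enormD _ _) _; apply: lerD.
    apply: le_trans (ler_enorm_mul _ _) _; apply: ler_pM; rewrite ?enorm_ge0 ?matA_le//.
    have -> : Y - Y' = (X - Y') - (X - Y) by rewrite opprB [RHS]addrC addrA subrK.
    exact: ler_enormB.
  by apply: le_trans (ler_enorm_mul _ _) _; rewrite ler_wpM2r ?enorm_ge0.
- exact: control_monotone.
- apply: le_trans (dot_le _ _) _; rewrite ler_wpM2l ?enorm_ge0//.
  by apply: le_trans (ler_enormB _ _) _; have := enorm_matB_control S s s Y;
    have := enorm_matB_control S t t Y'; lra.
Qed.

Lemma Ex_le6 (f p1 p2 p3 p4 p5 p6 : Omega -> R) k0 k1 k2 k3 k4 k5 k6 :
  L1 f -> L1 p1 -> L1 p2 -> L1 p3 -> L1 p4 -> L1 p5 -> L1 p6 ->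
  (forall w, f w <= k0 + k1 * p1 w + k2 * p2 w + k3 * p3 w + k4 * p4 w + k5 * p5 w + k6 * p6 w) ->
  Ex f <= k0 + k1 * Ex p1 + k2 * Ex p2 + k3 * Ex p3 + k4 * Ex p4 + k5 * Ex p5 + k6 * Ex p6.
Proof.
move=> lf l1 l2 l3 l4 l5 l6 H.
rewrite -!ExZ// -[X in X + _ + _ + _ + _ + _ + _](Ex_cst P) -!ExD;
  try by repeat (apply: L1D || apply: L1Z || exact: L1_cst || done).
by apply: Ex_le => //; repeat (apply: L1D || apply: L1Z || exact: L1_cst || done).
Qed.

(** The weight that balances Young's splitting: the lag has mean square of order [step m], so both
    terms are of order sqrt (step m). *)
Definition theta (m : nat) : R := Num.sqrt (step m).
(** [3 * a + 1] comes from [drift_comparison]; 16 is the noise constant 8 times the 2 lost when the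
    difference of frozen states is split into the error and the lag. *)
Definition comparison_rate : R := 3 * a + 1 + 16 * L ^+ 2.
(** In order: the lag in the linear drift and in the noise, the control tested against the lag, the
    oscillation of [A] and [B] over one coarse step in two terms, and the squares of the two drift
    steps. Every term vanishes as the mesh is refined. *)
Definition step_error (m : nat) : R :=
  (a + 16 * L ^+ 2) * (increment_rate * step m)
  + 2 * (b * rho) * (1 + increment_rate) * theta m
  + om m ^+ 2 * (2 * moment_bound + 2 * enorm y ^+ 2)
  + 2 * rho * (1 + moment_bound) * om m + 4 * (drift_moment * step m).
Definition grid_error (m : nat) : R := expR (comparison_rate * T) * (step_error m * T).
Definition noise_gap (m : nat) : R := L ^+ 2 * (2 * grid_error m + 2 * (step m * increment_rate)).
Definition path_error (m : nat) : R := 3 * (grid_error m + 2 * (step m * increment_rate)).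

Lemma theta_gt0 m : 0 < theta m. Proof. by rewrite sqrtr_gt0 step_gt0. Qed.
Lemma theta_sqr m : theta m ^+ 2 = step m.
Proof. by rewrite sqr_sqrtr// ltW// step_gt0. Qed.
Lemma comparison_rate_ge0 : 0 <= comparison_rate.
Proof. by have := boundA_ge0 S; have := sqr_ge0 L; rewrite /comparison_rate; lra. Qed.
Lemma step_error_ge0 m : 0 <= step_error m.
Proof.
have := boundA_ge0 S; have := boundB_ge0 S; have := ltW (gain_gt0 S) => r0 b0 a0.
have CM0 := moment_bound_ge0 S; have CI0 := increment_rate_ge0 S; have Kf0 := drift_moment_ge0 S.
have s0 := ltW (step_gt0 hT m); have t0 := ltW (theta_gt0 m); have o0 := modulus_ge0 S m.
have L0 := sqr_ge0 L; have y0 := sqr_ge0 (enorm y); have o2 := sqr_ge0 (om m).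
rewrite /step_error; repeat (done || apply: addr_ge0 || apply: mulr_ge0).
Qed.

Lemma grid_error_cvg0 : grid_error @ \oo --> 0.
Proof.
have s0 := step_cvg0 T; have o0 := modulus_cvg0 S.
have th0 : theta @ \oo --> 0.
  have : Num.sqrt (step m) @[m --> \oo] --> (Num.sqrt 0 : R).
    by apply: continuous_cvg => //; exact: sqrt_continuous.
  by rewrite sqrtr0.
have z : 0 = expR (comparison_rate * T) *
  (((a + 16 * L ^+ 2) * (increment_rate * 0) + 2 * (b * rho) * (1 + increment_rate) * 0
    + 0 ^+ 2 * (2 * moment_bound + 2 * enorm y ^+ 2) + 2 * rho * (1 + moment_bound) * 0
    + 4 * (drift_moment * 0)) * T).
  by rewrite expr0n !mulr0 !mul0r !addr0 !mul0r mulr0.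
rewrite [X in _ --> X]z.
apply: cvgMl_tmp; apply: cvgMr_tmp; apply: cvgD; last by do 2 apply: cvgMl_tmp.
apply: cvgD; last exact: cvgMl_tmp.
apply: cvgD; last by apply: cvgMr_tmp; apply: cvgM.
by apply: cvgD; [do 2 apply: cvgMl_tmp|apply: cvgMl_tmp].
Qed.

Lemma noise_gap_cvg0 : noise_gap @ \oo --> 0.
Proof.
have z : 0 = L ^+ 2 * (2 * 0 + 2 * (0 * increment_rate)) by rewrite mul0r !mulr0 addr0 mulr0.
rewrite [X in _ --> X]z; apply: cvgMl_tmp; apply: cvgD.
  by apply: cvgMl_tmp; exact: grid_error_cvg0.
by apply: cvgMl_tmp; apply: cvgMr_tmp; exact: step_cvg0.
Qed.

Lemma path_error_cvg0 : path_error @ \oo --> 0.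
Proof.
have z : 0 = 3 * (0 + 2 * (0 * increment_rate)) by rewrite mul0r !mulr0 addr0 mulr0.
rewrite [X in _ --> X]z; apply: cvgMl_tmp; apply: cvgD; first exact: grid_error_cvg0.
by apply: cvgMl_tmp; apply: cvgMr_tmp; exact: step_cvg0.
Qed.

Section levels.
Variables (m q : nat).
Let p := (m + q)%N.

Lemma level_cell k : (k < 2 ^ p)%N -> [/\ (k %/ 2 ^ q < 2 ^ m)%N,
  tm m (k %/ 2 ^ q) <= tm p k & tm p k.+1 <= tm m (k %/ 2 ^ q).+1].
Proof.
move=> kp; have q0 : (0 < 2 ^ q)%N by rewrite expn_gt0.
split.
- by rewrite ltn_divLR// -expnD.
- by rewrite -(tm_refine T m q) (tm_le hT) leq_trunc_div.
- by rewrite -(tm_refine T m q) (tm_le hT) ltn_ceil.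
Qed.

(** The comparison is made at the times of the fine grid: there the fine path is an Euler state, and
    within a fine cell the coarse path also moves with one frozen drift and one frozen noise
    coefficient. *)
Let D k w := interp m (tm p k) w - euler p k w.

Lemma tm_in k : (k <= 2 ^ p)%N -> 0 <= tm p k <= T.
Proof. by move=> kp; rewrite (tm_ge0 hT) (tm_leT hT). Qed.

Let D_wrt_L2 k : (k <= 2 ^ p)%N -> wrtm (gen (tm p k)) (D k) /\ L2m (D k).
Proof.
move=> kp; have [w1 w2] := interp_wrt_L2 hbeta S m (tm_in kp).
split; first exact: (wrtmB w1 (euler_wrt hbeta S p k)).
exact: (L2mB w2 (euler_L2 hbeta S p k)).
Qed.

Let lag k w := interp m (tm p k) w - euler m (k %/ 2 ^ q) w.

Let lag_M2 k : (k < 2 ^ p)%N -> L2m (lag k) /\ M2 (lag k) <= step m * increment_rate.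
Proof.
move=> kp; have [c1 c2 c3] := level_cell kp.
have [w1 w2] := interp_wrt_L2 hbeta S m (tm_in (ltnW kp)).
split; first exact: (L2mB w2 (euler_L2 hbeta S m _)).
have H := interp_increment_M2 hbeta S c1 (lexx _) c2 (le_trans _ c3).
rewrite [leLHS](_ : _ = M2 (fun w => interp m (tm p k) w - interp m (tm m (k %/ 2 ^ q)) w)); last first.
  by apply: eq_Ex => w; rewrite (interp_grid beta S)// ltnW.
apply: (le_trans (H _)); first by rewrite (tm_le hT).
rewrite ler_wpM2r ?increment_rate_ge0//; have := tmS T m (k %/ 2 ^ q).
have : tm p k <= tm p k.+1 by rewrite (tm_le hT).
by move: c3; lra.
Qed.

Lemma comparison_step_arith (vD vE vY vY' vf vf' vS vG h h' th aa bb e CC CCM KK LL yy : R) :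
  0 <= h' -> h' <= h -> 0 < th -> th ^+ 2 = h -> 0 <= bb -> 0 <= e -> 0 <= aa -> 0 <= LL ->
  0 <= rho -> 0 <= vf -> 0 <= vf' ->
  vE <= h * CC -> vY <= CCM -> vY' <= CCM -> vf <= KK -> vf' <= KK ->
  vS <= h' * (2 * (bb * rho) * th + e ^+ 2 * (2 * yy) + rho * e * 2)
    + (1 + h' * (3 * aa + 1)) * vD + h' * (aa + 2 * (bb * rho) / th) * vE
    + h' * (rho * e) * vY + h' * (2 * e ^+ 2 + rho * e) * vY' + h' ^+ 2 * 2 * vf + h' ^+ 2 * 2 * vf' ->
  vG <= LL * (2 * vD + 2 * vE) ->
  vS + 8 * h' * vG <= (1 + h' * (3 * aa + 1 + 16 * LL)) * vD + h' *
   ((aa + 16 * LL) * (CC * h) + 2 * (bb * rho) * (1 + CC) * th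
  + e ^+ 2 * (2 * CCM + 2 * yy) + 2 * rho * (1 + CCM) * e + 4 * (KK * h)).
Proof.
move=> h0 hh th0 thh bb0 e0 aa0 LL0 r0 f0 f'0 HE HY HY' Hf Hf' HS HG.
have re : 0 <= rho * e by rewrite mulr_ge0.
have br : 0 <= 2 * (bb * rho) by rewrite !mulr_ge0.
have i1 : (aa + 2 * (bb * rho) / th) * vE <= aa * (h * CC) + 2 * (bb * rho) * (th * CC).
  have -> : aa * (h * CC) + 2 * (bb * rho) * (th * CC) = (aa + 2 * (bb * rho) / th) * (h * CC).
    by rewrite -thh; field; rewrite gt_eqF.
  by apply: ler_wpM2l => //; rewrite addr_ge0// mulr_ge0// invr_ge0 ltW.
have i2 : rho * e * vY <= rho * e * CCM by rewrite ler_wpM2l.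
have i3 : (2 * e ^+ 2 + rho * e) * vY' <= (2 * e ^+ 2 + rho * e) * CCM.
  by rewrite ler_wpM2l// addr_ge0// mulr_ge0// sqr_ge0.
have i4 : h' * 2 * vf <= h * 2 * KK by apply: ler_pM; rewrite ?mulr_ge0// ler_wpM2r.
have i5 : h' * 2 * vf' <= h * 2 * KK by apply: ler_pM; rewrite ?mulr_ge0// ler_wpM2r.
have i6 : 8 * vG <= 16 * LL * vD + 16 * LL * (h * CC).
  have : LL * vE <= LL * (h * CC) by rewrite ler_wpM2l.
  by lra.
have K := ler_wpM2l h0 (lerD (lerD (lerD (lerD (lerD i1 i2) i3) i4) i5) i6).
rewrite !expr2 in HS K *.
lra.
Qed.

(** Both paths are driven by the same Brownian increment, so the next error is a vector known at the
    start of the cell plus a known matrix times that increment, as in [vector_step]. The scalar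
    product of error and drift difference is where [drift_comparison] enters. *)
Lemma comparison_step k : (k < 2 ^ p)%N ->
  M2 (D k.+1) <= (1 + step p * comparison_rate) * M2 (D k) + step p * step_error m /\
  M2 (fun w => sigma (euler m (k %/ 2 ^ q) w) - sigma (euler p k w))
   <= L ^+ 2 * (2 * M2 (D k) + 2 * (step m * increment_rate)).
Proof.
move=> kp; have [c1 c2 c3] := level_cell kp.
set c := (k %/ 2 ^ q)%N in c1 c2 c3 *.
have kp' : tm p k <= tm p k.+1 by rewrite (tm_le hT).
have [wD LD] := D_wrt_L2 (ltnW kp).
have [LE ME] := lag_M2 kp.
set Y := euler m c; set Y' := euler p k.
have wY : wrtm (gen (tm p k)) Y := wrtm_le c2 (euler_wrt hbeta S m c).
have wY' : wrtm (gen (tm p k)) Y' := euler_wrt hbeta S p k.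
have LY : L2m Y := euler_L2 hbeta S m c.
have LY' : L2m Y' := euler_L2 hbeta S p k.
pose f w := drift_at (tm m c) (Y w); pose f' w := drift_at (tm p k) (Y' w).
have wf : wrtm (gen (tm p k)) f := wrtm_drift_at S _ wY.
have wf' : wrtm (gen (tm p k)) f' := wrtm_drift_at S _ wY'.
have Lf : L2m f := L2m_drift_at hbeta S _ wY LY.
have Lf' : L2m f' := L2m_drift_at hbeta S _ wY' LY'.
pose G w := sigma (Y w) - sigma (Y' w).
have wG : wrtm (gen (tm p k)) G := wrtmB (wrtm_sigma S wY) (wrtm_sigma S wY').
have LG : L2m G := L2mB (L2m_sigma hbeta S wY LY) (L2m_sigma hbeta S wY' LY').
pose V w := D k w + step p *: (f w - f' w).
have wV : wrtm (gen (tm p k)) V.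
  by apply: (wrtmD wD); apply: wrtmZ; [exact: wrt_cst|exact: wrtmB].
have LV : L2m V by apply: (L2mD LD); apply: L2mZ; exact: L2mB.
have [_ H] := vector_step hbeta (tm_leS hT p k) wV LV wG LG.
have h0 := step_gt0 hT p.
have MG : M2 G <= L ^+ 2 * (2 * M2 (D k) + 2 * M2 (lag k)).
  rewrite /M2 -!ExZ; try by L1_tac.
  rewrite -ExD; try by L1_tac.
  rewrite -ExZ; try by L1_tac.
  apply: Ex_le; try by L1_tac.
  move=> w; apply: (@le_trans _ _ ((L * enorm (Y w - Y' w)) ^+ 2)).
    by rewrite ler_pXn2r// ?nnegrE ?mulr_ge0 ?enorm_ge0 ?lipC_ge0// noise_lip.
  rewrite exprMn ler_wpM2l ?sqr_ge0//.
  have -> : Y w - Y' w = D k w - lag k w by rewrite /D /lag opprB [RHS]addrC addrA subrK.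
  exact: enormB_sqr_le.
split; last by apply: (le_trans MG); rewrite ler_wpM2l ?sqr_ge0// lerD2l ler_wpM2l.
rewrite [leLHS](_ : _ = M2 (fun w => V w + G w *m dbeta (tm p k) (tm p k.+1) w)); last first.
  apply: eq_Ex => w; congr (enorm _ ^+ 2).
  rewrite /V /G mulmxBl scalerBr {1}/D (interp_increment beta S w c1 c2 kp' c3).
  by rewrite [euler p k.+1 w]/= addB3 tmS [_ + step p]addrC addrK.
apply: (le_trans H); rewrite tmS [_ + step p]addrC addrK.
have e0 := modulus_ge0 S m; have th0 := theta_gt0 m.
have lagc : `|tm m c - tm p k| <= step m.
  rewrite ler0_norm ?subr_le0// opprB; exact: cell_lag c2 c3 kp' (tmS T m c).
have HV : M2 V <= step p * (2 * (b * rho) * theta m + om m ^+ 2 * (2 * enorm y ^+ 2) + rho * om m * 2)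
    + (1 + step p * (3 * a + 1)) * M2 (D k) + step p * (a + 2 * (b * rho) / theta m) * M2 (lag k)
    + step p * (rho * om m) * M2 (fun w => Y w - y)
    + step p * (2 * om m ^+ 2 + rho * om m) * M2 (fun w => Y' w - y)
    + step p ^+ 2 * 2 * M2 f + step p ^+ 2 * 2 * M2 f'.
  apply: Ex_le6; try by L1_tac.
  - by apply: L2m_L1; apply: L2mB => //; exact: L2m_cst.
  - by apply: L2m_L1; apply: L2mB => //; exact: L2m_cst.
  move=> w; have K1 := drift_comparison (Y w) (Y' w) (interp m (tm p k) w) e0 th0
    (matA_modulus lagc) (matB_modulus lagc).
  have {}K1 := ler_wpM2l (ltW h0) K1.
  have K2 : enorm (f w - f' w) ^+ 2 <= 2 * enorm (f w) ^+ 2 + 2 * enorm (f' w) ^+ 2.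
    exact: enormB_sqr_le.
  have {}K2 := ler_wpM2l (sqr_ge0 (step p)) K2.
  have K3 : enorm (Y' w) ^+ 2 <= 2 * enorm (Y' w - y) ^+ 2 + 2 * enorm y ^+ 2.
    by rewrite -{1}(subrK y (Y' w)); exact: enormD_sqr_le.
  have {}K3 := ler_wpM2l (mulr_ge0 (ltW h0) (sqr_ge0 (om m))) K3.
  rewrite /V enormD_sqr dotZr enormZ exprMn (gtr0_norm h0).
  move: K1 K2 K3; rewrite -/(f w) -/(f' w) -/(D k w) -/(lag k w).
  move: (enorm (D k w) ^+ 2) (enorm (lag k w) ^+ 2) (enorm (f w) ^+ 2) (enorm (f' w) ^+ 2)
    (enorm (f w - f' w) ^+ 2) (enorm (Y' w) ^+ 2) (enorm (Y w - y) ^+ 2) (enorm (Y' w - y) ^+ 2)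
    (dot (D k w) (f w - f' w)) (enorm y ^+ 2).
  clear; intros; lra.
have hpm : step p <= step m.
  rewrite /p step_add ler_pdivrMr ?exprn_gt0// ler_peMr ?(ltW (step_gt0 hT m))//.
  by rewrite exprn_ege1 ?ler1n.
apply: (comparison_step_arith (ltW h0) hpm th0 (theta_sqr m) (boundB_ge0 S) e0 (boundA_ge0 S) (sqr_ge0 L)
  (ltW (gain_gt0 S)) (M2_ge0 P f) (M2_ge0 P f') ME _ _ _ _ HV MG).
- by apply: euler_moment => //; exact: ltnW.
- by apply: euler_moment => //; exact: ltnW.
- by apply: euler_M2_drift => //; exact: ltnW.
- by apply: euler_M2_drift => //; exact: ltnW.
Qed.

Lemma comparison_grid k : (k <= 2 ^ p)%N -> M2 (D k) <= grid_error m.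
Proof.
move=> kp; have h0 := step_gt0 hT p.
have D0 : M2 (D 0) = 0.
  rewrite /M2 (@eq_Ex _ _ _ P _ (fun=> 0)) ?Ex_cst// => w.
  by rewrite /D tm0 interp0/= subrr enorm0 expr0n.
have /= := @discrete_gronwall R (fun k => M2 (D k)) comparison_rate (step p) (step_error m) (2 ^ p)
  comparison_rate_ge0 (ltW h0) (step_error_ge0 m) (M2_ge0 P (D 0)) (fun k kp => (comparison_step kp).1) k kp.
move/le_trans; apply; rewrite D0 add0r -/(tm p k) /grid_error; have tT := tm_leT hT kp.
apply: ler_pM; rewrite ?expR_ge0//.
- by rewrite mulr_ge0 ?step_error_ge0// (tm_ge0 hT).
- by rewrite ler_expR ler_wpM2l ?comparison_rate_ge0.
- by rewrite ler_wpM2l ?step_error_ge0.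
Qed.

Lemma comparison_noise k : (k < 2 ^ p)%N ->
  M2 (fun w => sigma (euler m (k %/ 2 ^ q) w) - sigma (euler p k w)) <= noise_gap m.
Proof.
move=> kp; apply: le_trans (comparison_step kp).2 _.
by rewrite ler_wpM2l ?sqr_ge0// lerD2r ler_wpM2l// comparison_grid// ltnW.
Qed.

Lemma interp_comparison t : 0 <= t <= T ->
  M2 (fun w => interp m t w - interp p t w) <= path_error m.
Proof.
move=> tT; have [k kp /andP[kt tk]] := tm_cell p tT.
have [c1 c2 c3] := level_cell kp.
have tkT := tm_in (ltnW kp).
have [_ LX] := interp_wrt_L2 hbeta S m tT; have [_ LX'] := interp_wrt_L2 hbeta S p tT.
have [_ LXk] := interp_wrt_L2 hbeta S m tkT; have [_ LXk'] := interp_wrt_L2 hbeta S p tkT.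
have [_ LD] := D_wrt_L2 (ltnW kp).
pose I1 w := interp m t w - interp m (tm p k) w.
pose I2 w := interp p t w - interp p (tm p k) w.
have LI1 : L2m I1 := L2mB LX LXk.
have LI2 : L2m I2 := L2mB LX' LXk'.
have hpm : step p <= step m.
  rewrite /p step_add ler_pdivrMr ?exprn_gt0// ler_peMr ?(ltW (step_gt0 hT m))//.
  by rewrite exprn_ege1 ?ler1n.
have small : t - tm p k <= step m.
  exact: le_trans (cell_lag kt tk (lexx t) (tmS T p k)) hpm.
have M1 : M2 I1 <= step m * increment_rate.
  apply: le_trans (interp_increment_M2 hbeta S c1 c2 kt (le_trans tk c3)) _.
  by rewrite ler_wpM2r ?increment_rate_ge0.
have M2' : M2 I2 <= step m * increment_rate.
  apply: le_trans (interp_increment_M2 hbeta S kp (lexx _) kt tk) _.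
  by rewrite ler_wpM2r ?increment_rate_ge0.
have LXX : L2m (fun w => interp m t w - interp p t w) := L2mB LX LX'.
apply: (@le_trans _ _ (3 * (M2 (D k) + M2 I1 + M2 I2))).
  rewrite /M2 -!ExD; try by L1_tac.
  rewrite -ExZ; try by L1_tac.
  apply: Ex_le; try by L1_tac.
  move=> w; have -> : interp m t w - interp p t w = D k w + I1 w - I2 w.
    rewrite /D /I1 /I2 (interp_grid beta S w (ltnW kp)).
    by rewrite [_ - _ + (_ - interp m (tm p k) w)]addrC subrKA opprB subrKA.
  rewrite enormD_sqr enormN dotNr enormD_sqr dotDl.
  have := dot_le_sqr (D k w) (I1 w); have := dot_le_sqr (- D k w) (I2 w).
  have := dot_le_sqr (- I1 w) (I2 w); rewrite !dotNl !enormN.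
  by clear; lra.
rewrite /path_error; apply: ler_wpM2l => //; rewrite -addrA.
apply: lerD; first exact: comparison_grid (ltnW kp).
have -> : 2 * (step m * increment_rate) = step m * increment_rate +
  step m * increment_rate by rewrite mulr_natl mulr2n.
exact: (lerD M1 M2').
Qed.
End levels.

End comparison.
Arguments theta {R n d} S m.
Arguments grid_error {R n d} S m.
Arguments noise_gap {R n d} S m.
Arguments path_error {R n d} S m.
Arguments level_cell {R n d} S m q [k].
Arguments comparison_grid {R dO Omega P n d beta} hbeta S m q [k].
Arguments comparison_noise {R dO Omega P n d beta} hbeta S m q [k].
Arguments interp_comparison {R dO Omega P n d beta} hbeta S m q [t].

(** * Martingale parts of two levels, uniformly in time *)

Section martingale_comparison.
Context {R : realType} {dO : measure_display} {Omega : measurableType dO}.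
Variables (P : probability Omega R) (n d : nat) (beta : 'I_d -> R -> Omega -> R).
Hypothesis hbeta : independent_brownian_motions P beta.
Variable S : setting R n d.
Local Notation T := (horizon S).
Local Notation sigma := (noise S).
Let hT : 0 < T := horizon_gt0 S.
Local Notation F := (augmented_filtration P beta).
Local Notation Ex f := (Rintegral P setT f).
Local Notation L2 := (L2 P).
Local Notation tm := (tm T).
Local Notation step := (step T).
Local Notation euler := (euler beta S).
Local Notation mart := (mart beta S).
Local Notation incr := (incr beta).

Lemma mart_refine m q r i j t w : r = (m + q)%N ->
  mart m i j t w = \sum_(k < 2 ^ r) sigma (euler m (k %/ 2 ^ q) w) i j *
    incr j (Num.min (tm r k) t) (Num.min (tm r k.+1) t) w.
Proof.
move=> ->; have := grid_sum_refine T (fun k s => sigma (euler m k w) i j * beta j s w) m q t.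
move=> H; rewrite /mart; under eq_bigr do rewrite /incr mulrBr.
by rewrite H; apply: eq_bigr => k _; rewrite /incr mulrBr.
Qed.

Let zeta m q s i j k w :=
  sigma (euler m (k %/ 2 ^ (q + s)) w) i j - sigma (euler (m + q) (k %/ 2 ^ s) w) i j.

Lemma tm_floor m q k : tm m (k %/ 2 ^ q) <= tm (m + q) k.
Proof. by rewrite -(tm_refine T m q) (tm_le hT) leq_trunc_div. Qed.

Let zeta_wrt m q s i j k : wrt (F (tm (m + q + s) k)) (zeta m q s i j k).
Proof.
apply: wrtB.
  have := wrtm_sigma S (euler_wrt hbeta S m (k %/ 2 ^ (q + s))).
  move=> /(_ i j); apply: wrt_filtration_le.
  by rewrite -addnA tm_floor.
have := wrtm_sigma S (euler_wrt hbeta S (m + q) (k %/ 2 ^ s)).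
by move=> /(_ i j); apply: wrt_filtration_le; exact: tm_floor.
Qed.

Let zeta_L2 m q s i j k : L2 (zeta m q s i j k).
Proof.
apply: L2B.
  exact: (L2m_sigma hbeta S (euler_wrt hbeta S m _) (euler_L2 hbeta S m _)).
exact: (L2m_sigma hbeta S (euler_wrt hbeta S _ _) (euler_L2 hbeta S _ _)).
Qed.

Let zeta_Ex m q s i j k : (k < 2 ^ (m + q + s))%N ->
  Ex (fun w => zeta m q s i j k w ^+ 2) <= noise_gap S m.
Proof.
move=> kr; have kp : (k %/ 2 ^ s < 2 ^ (m + q))%N.
  by rewrite ltn_divLR ?expn_gt0// -expnD.
apply: le_trans (comparison_noise hbeta S m q kp).
have L1' : L2m P (fun w => sigma (euler m (k %/ 2 ^ s %/ 2 ^ q) w)).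
  exact: (L2m_sigma hbeta S (euler_wrt hbeta S m _) (euler_L2 hbeta S m _)).
have L2' : L2m P (fun w => sigma (euler (m + q) (k %/ 2 ^ s) w)).
  exact: (L2m_sigma hbeta S (euler_wrt hbeta S _ _) (euler_L2 hbeta S _ _)).
apply: Ex_le; first exact: L2_sqr (zeta_L2 m q s i j k).
  exact: L2m_L1 (L2mB L1' L2').
move=> w; rewrite /zeta expnD mulnC divnMA.
rewrite -[leLHS]real_normK ?num_real// ler_pXn2r// ?nnegrE ?enorm_ge0//.
set M := (X in enorm X); have := ler_enorm_entry M i j.
by rewrite /M !mxE.
Qed.

Let mart_diff m q s i j t w : mart m i j t w - mart (m + q) i j t w =
  \sum_(k < 2 ^ (m + q + s)) zeta m q s i j k w *
     incr j (Num.min (tm (m + q + s) k) t) (Num.min (tm (m + q + s) k.+1) t) w.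
Proof.
rewrite (@mart_refine m (q + s) (m + q + s))%N ?addnA//.
rewrite (@mart_refine (m + q) s (m + q + s))%N// -sumrB.
by apply: eq_bigr => k _; rewrite -mulrBl.
Qed.

Lemma sum_grid r : \sum_(k < 2 ^ r) (tm r k.+1 - tm r k) = T.
Proof.
under eq_bigr do rewrite tmS [_ + step r]addrC addrK.
by rewrite sumr_const card_ord -mulr_natr -/(tm r (2 ^ r)) tm_last.
Qed.

Lemma sum_gridM r e : \sum_(k < 2 ^ r) (tm r k.+1 - tm r k) * e = T * e.
Proof. by rewrite -mulr_suml sum_grid. Qed.

Lemma mart_comparison m q i j t : 0 <= t <= T ->
  L2 (fun w => mart m i j t w - mart (m + q) i j t w) /\
  Ex (fun w => (mart m i j t w - mart (m + q) i j t w) ^+ 2) <= 8 * (T * noise_gap S m).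
Proof.
move=> /andP[t0 tT].
have [_ H2 H3] := sum_isometry_min hbeta j (K := 2 ^ (m + q + 0)) (tm_leS hT (m + q + 0)) t0
  (fun k => @zeta_wrt m q 0 i j k) (fun k _ => @zeta_L2 m q 0 i j k).
have E w := mart_diff m q 0 i j t w.
split; first by apply: eq_L2 H2 => w; rewrite E.
rewrite (@eq_Ex _ _ _ P _ _ (fun w => congr1 (fun z => z ^+ 2) (E w))).
apply: (le_trans H3); rewrite ler_wpM2l//.
have S0 : 0 <= noise_gap S m.
  have k0 : (0 < 2 ^ (m + q + 0))%N by rewrite expn_gt0.
  by apply: le_trans (zeta_Ex i j k0); apply: Ex_ge0 => w; exact: sqr_ge0.
rewrite -[leRHS](sum_gridM (m + q + 0)); apply: ler_sum => k _.
have tk : tm (m + q + 0) k <= tm (m + q + 0) k.+1 by rewrite (tm_le hT).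
apply: ler_pM; [| |by case: (leP (tm _ k.+1) t) => h1; case: (leP (tm _ k) t) => h2; lra|exact: zeta_Ex].
- by rewrite subr_ge0 le_min !ge_min tk lexx orbT.
- by apply: Ex_ge0 => w; exact: sqr_ge0.
Qed.

Lemma mart_wrt m i j t : 0 <= t -> wrt (F t) (mart m i j t) /\ L2 (mart m i j t).
Proof.
move=> t0.
have [H1 H2 _] := sum_isometry_min hbeta j (K := 2 ^ m) (zeta := fun k w => sigma (euler m k w) i j)
   (tm_leS hT m) t0
   (fun k => wrtm_sigma S (euler_wrt hbeta S m k) i j)
   (fun k _ => L2m_sigma hbeta S (euler_wrt hbeta S m k) (euler_L2 hbeta S m k) i j).
by split.
Qed.

Let exceed m q i j lambda s : set Omega := [set w | exists2 k, (k <= 2 ^ (m + q + s))%N &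
  lambda < `|mart m i j (tm (m + q + s) k) w - mart (m + q) i j (tm (m + q + s) k) w| ].

Let exceed_measurable m q i j lambda s : measurable (exceed m q i j lambda s).
Proof.
rewrite (_ : exceed _ _ _ _ _ _ = \bigcup_(k in [set k | (k <= 2 ^ (m + q + s))%N])
   ((fun w => `|mart m i j (tm (m + q + s) k) w - mart (m + q) i j (tm (m + q + s) k) w|)
     @^-1` `]lambda, +oo[)); last first.
  apply/seteqP; split => w [k kr]; rewrite ?in_itv/= ?andbT => H; exists k => //.
    by rewrite /= in_itv/= andbT.
  by move: H; rewrite /= in_itv/= andbT.
apply: bigcup_measurable => k _; rewrite -[X in measurable X]setTI.
have M l : measurable_fun setT (mart l i j (tm (m + q + s) k)).
  by case: (mart_wrt l i j (tm_ge0 hT (m + q + s) k)) => _ /L2_measurable.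
have : measurable_fun setT (fun w => `|mart m i j (tm (m + q + s) k) w - mart (m + q) i j (tm (m + q + s) k) w|).
  by apply: measurableT_comp => //; exact: measurable_funB.
by move=> /(_ measurableT); apply; exact: measurable_itv.
Qed.

Let exceed_bound m q i j lambda s : 0 < lambda ->
  lambda ^+ 2 * fine (P (exceed m q i j lambda s)) <= 8 * (T * noise_gap S m).
Proof.
move=> l0; have H := maximal_inequality hbeta j (2 ^ (m + q + s)) (tm_leS hT (m + q + s))
  (fun k => @zeta_wrt m q s i j k) (fun k => @zeta_L2 m q s i j k) l0.
have -> : exceed m q i j lambda s = [set w | exists2 k, (k <= 2 ^ (m + q + s))%N &
     lambda < `|\sum_(i0 < k) zeta m q s i j i0 w * incr j (tm (m + q + s) i0) (tm (m + q + s) i0.+1) w| ].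
  have E k w : (k <= 2 ^ (m + q + s))%N ->
    mart m i j (tm (m + q + s) k) w - mart (m + q) i j (tm (m + q + s) k) w =
    \sum_(i0 < k) zeta m q s i j i0 w * incr j (tm (m + q + s) i0) (tm (m + q + s) i0.+1) w.
    move=> kr; rewrite (mart_diff m q s).
    have := grid_sum_upto hT (fun k s' => zeta m q s i j k w * beta j s' w) kr.
    under eq_bigr do rewrite -mulrBr; move=> ->.
    by apply: eq_bigr => k' _; rewrite -mulrBr.
  by apply/seteqP; split => w [k kr] H'; exists k => //; rewrite ?E// -E.
apply: (le_trans H); rewrite ler_wpM2l// -[leRHS](sum_gridM (m + q + s)).
apply: ler_sum => k _; apply: ler_wpM2l; last exact: zeta_Ex.
by rewrite subr_ge0 (tm_le hT).
Qed.

(** The bound of [maximal_inequality] does not depend on the refinement [s], and the exceedance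
    events increase with [s] because the grids are nested; continuity of the measure from below
    yields all dyadic times at once. *)
Lemma mart_sup m q i j lambda : 0 < lambda ->
  let E := [set w | exists s k, (k <= 2 ^ (m + q + s))%N /\
    lambda < `|mart m i j (tm (m + q + s) k) w - mart (m + q) i j (tm (m + q + s) k) w| ] in
  measurable E /\ (P E <= (8 * (T * noise_gap S m) / lambda ^+ 2)%:E)%E.
Proof.
move=> l0 E.
have EU : E = \bigcup_s exceed m q i j lambda s.
  apply/seteqP; split => w.
    by move=> [s [k [kr H]]]; exists s => //; exists k.
  by move=> [s _ [k kr H]]; exists s, k.
have mE : measurable E by rewrite EU; apply: bigcup_measurable => s _; exact: exceed_measurable.
split => //; have nd : nondecreasing_seq (exceed m q i j lambda).
  apply/nondecreasing_seqP => s; apply/subsetPset => w [k kr H].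
  exists k.*2; last by rewrite addnS tm_add1.
  by rewrite addnS expnS mul2n leq_double.
have cv := nondecreasing_cvg_mu (mu := P) (exceed_measurable m q i j lambda) _ nd.
rewrite EU; apply: (cvge_le _ (cv _)); last by rewrite -EU.
near=> s; have mEs := exceed_measurable m q i j lambda s.
rewrite /= -(fineK (fin_num_measure P _ mEs)).
by rewrite lee_fin ler_pdivlMr ?exprn_gt0// mulrC exceed_bound.
Unshelve. all: by end_near. Qed.

End martingale_comparison.

(** * Hitting estimate for the scheme *)

Section hitting.
Context {R : realType} {dO : measure_display} {Omega : measurableType dO}.
Variables (P : probability Omega R) (n d : nat) (beta : 'I_d -> R -> Omega -> R).
Hypothesis hbeta : independent_brownian_motions P beta.
Variable S : setting R n d.
Local Notation T := (horizon S).
Local Notation A := (matA S).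
Local Notation B := (matB S).
Local Notation sigma := (noise S).
Local Notation x := (start S).
Local Notation y := (target S).
Local Notation rho := (gain S).
Local Notation a := (boundA S).
Local Notation L := (lipC S).
Local Notation g := (coercivity S).
Let hT : 0 < T := horizon_gt0 S.
Let rho0 : 0 < rho := gain_gt0 S.
Let a0 : 0 <= a := boundA_ge0 S.
Local Notation F := (augmented_filtration P beta).
Local Notation gen := (filtration_gen P beta).
Local Notation Ex f := (Rintegral P setT f).
Local Notation L1 := (L1 P).
Local Notation L2 := (L2 P).
Local Notation L2m := (L2m P).
Local Notation M2 := (M2 P).
Local Notation tm := (tm T).
Local Notation step := (step T).
Local Notation euler := (euler beta S).
Local Notation drift_at := (drift_at S).
Local Notation incr := (incr beta).
Local Notation dbeta := (dbeta beta).
Local Notation drift_moment := (drift_moment S).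

(* Radial speed towards the target that the control guarantees close to it. *)
Definition margin : R := rho * g - a * enorm y.

Lemma dot_sgv_drift_at t z : z != y -> dot (sgv (z - y)) (drift_at t z) <= a * enorm (z - y) - margin.
Proof.
move=> zy; set V := z - y; have V0 : 0 < enorm V by rewrite lt_def enorm_ge0 enorm_eq0 subr_eq0 zy.
have H : dot V (drift_at t z) <= enorm V * (a * enorm V - margin).
  rewrite /drift_at dotC dotBl dot_adj dotZl dot_sgv -/V.
  have H1 := psd_coercive (coercivity_gt0 S) (matB_coercive S t) V.
  have H2 : rho * (g * enorm V) <= rho * enorm ((B t)^T *m V) by rewrite ler_pM2l.
  have H3 := normr_dot_le (A t *m z) V.
  have H4 : enorm (A t *m z) <= a * enorm V + a * enorm y.
    apply: le_trans (ler_enorm_mul _ _) _; rewrite -mulrDr.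
    by apply: ler_pM; rewrite ?enorm_ge0 ?matA_le// -[X in enorm X](subrK y z) ler_enormD.
  have H5 := ler_wpM2r (ltW V0) H4.
  move: H3; rewrite ler_norml => /andP[H3 _]; rewrite /margin; lra.
rewrite dotZl; have := ler_wpM2l (ltW (_ : 0 < (enorm V)^-1)) H; rewrite invr_gt0 => /(_ V0).
by rewrite mulKf// gt_eqF.
Qed.

Variables (m : nat) (delta : R).
Hypothesis delta0 : 0 < delta.
Local Notation h := (step m).
Let V k w := euler m k w - y.

(** Multiplying by this indicator, decreasing in [k], plays the role of stopping at the first
    entrance into the ball of radius [delta] around the target; on it division by the distance is
    safe. *)
Definition far k w := all (fun j => delta < enorm (euler m j w - y)) (iota 0 k.+1).
Let ind k w : R := (far k w)%:R.
Let Fmeas k (f : Omega -> R) : wrt (F (tm m k)) f -> measurable_fun setT f.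
Proof. apply: wrt_measurable; exact: augmented_filtration_measurable. Qed.

Lemma farS k w : far k.+1 w = far k w && (delta < enorm (V k.+1 w)).
Proof. have -> : far k.+1 w = all (fun j => delta < enorm (euler m j w - y)) (iota 0 (k.+1 + 1)) by rewrite addn1.
by rewrite iotaD all_cat /= andbT. Qed.

Lemma far_last k w : far k w -> delta < enorm (V k w).
Proof. by move=> /allP; apply; rewrite mem_iota add0n/=. Qed.

Let VW k : wrtm (gen (tm m k)) (V k).
Proof. by apply: wrtmB; [exact: euler_wrt|exact: wrtm_cst]. Qed.

Let VL k : L2m (V k). Proof. exact: euler_L2y. Qed.
Arguments VW : clear implicits.
Arguments VL : clear implicits.

Lemma far_wrt k : wrt (F (tm m k)) (fun w => (far k w)%:R : R).
Proof.
change (wrt (F (tm m k)) (ind k)).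
have H j : wrt (F (tm m j)) (fun w => (delta < enorm (V j w))%R%:R : R).
  pose D : set Omega := (fun w => enorm (V j w)) @^-1` `]delta, +oo[.
  have E : (\1_D : Omega -> R) =1 (fun w => (delta < enorm (V j w))%R%:R : R).
    move=> w; rewrite indicE; congr (nat_of_bool _)%:R.
    by apply/idP/idP; rewrite in_setE /D/= in_itv/= andbT.
  apply: eq_wrt E _; apply: wrt_indic; have := wrt_enorm (VW j); by apply; exact: measurable_itv.
elim: k => [|k ih].
  by apply: eq_wrt (H 0%N) => w; rewrite /ind /far/= andbT.
have E : (fun w => ind k w * (delta < enorm (V k.+1 w))%R%:R) =1 ind k.+1.
  by move=> w; rewrite /ind farS -natrM mulnb.
apply: eq_wrt E _; apply: wrtM; last exact: H.
exact: wrt_filtration_le (andP (tm_leS hT m k)).2 ih.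
Qed.

Let U k w := ind k w *: sgv (V k w).
Arguments far_wrt : clear implicits.
Let c k w := ind k w * Num.sqrt (enorm (V k w))^-1.

Let c_wrt k : wrt (F (tm m k)) (c k).
Proof.
apply: wrtM; first exact: far_wrt.
have ms : measurable_fun setT (fun r : R => Num.sqrt r^-1).
  apply: measurableT_comp; last exact: measurable_inv.
  by apply: continuous_measurable_fun; exact: sqrt_continuous.
exact: wrt_comp ms (wrt_enorm (VW k)).
Qed.

Arguments c_wrt : clear implicits.

Let c_sqr k w : c k w ^+ 2 = ind k w * (enorm (V k w))^-1.
Proof. by rewrite /c exprMn sqr_sqrtr ?invr_ge0 ?enorm_ge0// /ind; case: (far k w); rewrite ?expr1n ?expr0n. Qed.

Let c_sqr_le k w : c k w ^+ 2 <= delta^-1.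
Proof.
rewrite c_sqr /ind; case: (boolP (far k w)) => [/far_last fk|_]; last by rewrite mul0r invr_ge0 ltW.
by rewrite mul1r lef_pV2 ?posrE// ?ltW// (lt_trans delta0).
Qed.

Let sqrtr_sqr_ge0 (r : R) : 0 <= r -> Num.sqrt (r ^+ 2) = r.
Proof. by move=> r0; rewrite sqrtr_sqr ger0_norm. Qed.

Let c_ge0 k w : 0 <= c k w. Proof. by rewrite mulr_ge0 ?sqrtr_ge0. Qed.

Let cle k w : `|c k w| <= Num.sqrt delta^-1.
Proof.
rewrite ger0_norm// -[leLHS]sqrtr_sqr_ge0//; apply: ler_wsqrtr; exact: c_sqr_le.
Qed.

Let f k w := drift_at (tm m k) (euler m k w).
Let sg k w := sigma (euler m k w).
Let Lf k : L2m (f k) := L2m_drift_at hbeta S _ (euler_wrt hbeta S m k) (euler_L2 hbeta S m k).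
Let Ls k : L2m (sg k) := L2m_sigma hbeta S (euler_wrt hbeta S m k) (euler_L2 hbeta S m k).
Let wf k : wrtm (gen (tm m k)) (f k) := wrtm_drift_at S _ (euler_wrt hbeta S m k).
Let ws k : wrtm (gen (tm m k)) (sg k) := wrtm_sigma S (euler_wrt hbeta S m k).
Arguments Lf : clear implicits.
Arguments Ls : clear implicits.
Arguments wf : clear implicits.
Arguments ws : clear implicits.

Let L2m_c k p q (Z : Omega -> 'M[R]_(p, q)) : wrtm (gen (tm m k)) Z -> L2m Z ->
  L2m (fun w => c k w *: Z w).
Proof.
move=> wZ LZ i j; apply: (@L2_le _ _ _ _ _ (fun w => Num.sqrt delta^-1 * Z w i j)).
- by apply: (@Fmeas k); exact: (wrtmZ (c_wrt k) wZ).
- by move=> w; rewrite mxE (normrM (c k w)) [leRHS]normrM; apply: ler_wpM2r => //;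
  exact: le_trans (cle k w) (ler_norm _).
- exact: L2Z.
Qed.

Let noise_part k w := \sum_j (\sum_i U k w i 0 * sg k w i j) * incr j (tm m k) (tm m k.+1) w.

Let dot_noise k w : dot (U k w) (sg k w *m dbeta (tm m k) (tm m k.+1) w) = noise_part k w.
Proof.
rewrite /dot /noise_part; rewrite [LHS](eq_bigr (fun i =>
  \sum_j U k w i 0 * (sg k w i j * dbeta (tm m k) (tm m k.+1) w j 0))); last first.
  by move=> i _; rewrite [X in _ * X]mxE mulr_sumr.
rewrite exchange_big; apply: eq_bigr => j _; rewrite mulr_suml.
by apply: eq_bigr => i _; rewrite !mxE mulrA.
Qed.

Let U_wrt k : wrtm (gen (tm m k)) (U k).
Proof. by apply: wrtmZ; [exact: far_wrt|exact: wrtm_sgv (VW k)]. Qed.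

Arguments U_wrt : clear implicits.

Let U_le k w : enorm (U k w) <= 1.
Proof.
by rewrite enormZ ger0_norm// /ind; case: (far k w); rewrite ?mul1r ?mul0r ?enorm_sgv.
Qed.

Let noise_part_mean k : L1 (noise_part k) /\ Ex (noise_part k) = 0.
Proof.
have H j : L1 (fun w => (\sum_i U k w i 0 * sg k w i j) * incr j (tm m k) (tm m k.+1) w) /\
  Ex (fun w => (\sum_i U k w i 0 * sg k w i j) * incr j (tm m k) (tm m k.+1) w) = 0.
  have W : wrt (F (tm m k)) (fun w => \sum_i U k w i 0 * sg k w i j).
    by apply: wrt_sum => i; apply: wrtM; [exact: U_wrt|exact: ws].
  apply: (past_incr_mean hbeta) => //; first exact: tm_leS.
    exact: wrt_past W.
  apply: L2_L1; apply: L2_sum => i; apply: (L2_le _ _ (Ls k i j)).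
    by apply: (@Fmeas k); apply: wrtM; [exact: U_wrt|exact: ws].
  move=> w; rewrite normrM ler_piMl//; apply: le_trans (U_le k w); exact: ler_enorm_entry.
split; first by apply: L1_sum => j; case: (H j).
by rewrite /noise_part Ex_sum ?big1// => j *; case: (H j).
Qed.

Let near k := Ex (fun w => ind k w * enorm (V k w)).

Let L1_near k : L1 (fun w => ind k w * enorm (V k w)).
Proof.
have LV : L2 (fun w => enorm (V k w)) by apply: L2_enorm => //; exact: Fmeas (wrt_enorm (VW k)).
apply: L2_L1; apply: (L2_le _ _ LV).
  by apply: (@Fmeas k); apply: wrtM; [exact: far_wrt|exact: wrt_enorm (VW k)].
by move=> w; rewrite normrM ler_piMl// /ind; case: (far k w); rewrite ?normr1 ?normr0.
Qed.

Let L1_ind k : L1 (ind k).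
Proof.
apply: (L1_le _ _ (L1_cst P 1)).
  exact: Fmeas (far_wrt k).
by move=> w; rewrite /ind; case: (far k w); rewrite ?normr1 ?normr0.
Qed.

(* The concavity bound [ler_enormD_concave] at the current state; [c] spreads its
   denominator so that the quadratic term is again the square of a martingale step. *)
Let pointwise k w : ind k.+1 w * enorm (V k.+1 w) <=
  (1 + h * a) * (ind k w * enorm (V k w)) - h * margin * ind k w + noise_part k w
  + 2^-1 * enorm (c k w *: (h *: f k w) + (c k w *: sg k w) *m dbeta (tm m k) (tm m k.+1) w) ^+ 2.
Proof.
have h0 := step_gt0 hT m.
case: (boolP (far k w)) => fk; last first.
  rewrite -dot_noise /U dotZl /ind farS (negbTE fk)/= !mul0r.
  by rewrite !mulr0 subr0 !add0r mulr_ge0 ?sqr_ge0 ?invr_ge0.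
have V0 : 0 < enorm (V k w) by apply: lt_trans (far_last fk).
have VV : V k w != 0 by rewrite -enorm_eq0 gt_eqF.
apply: (@le_trans _ _ (enorm (V k.+1 w))).
  by rewrite ler_piMl ?enorm_ge0// /ind; case: (far _ _).
have -> : V k.+1 w = V k w + (h *: f k w + sg k w *m dbeta (tm m k) (tm m k.+1) w).
  by rewrite /V /= [RHS]addrAC !addrA.
set D := h *: f k w + _.
apply: le_trans (ler_enormD_concave D VV) _.
rewrite -dot_noise /U /ind fk scale1r.
have -> : c k w *: (h *: f k w) + (c k w *: sg k w) *m dbeta (tm m k) (tm m k.+1) w = c k w *: D.
  by rewrite [RHS]scalerDr -scalemxAl.
rewrite enormZ exprMn real_normK ?num_real// c_sqr /ind fk !mul1r.
have H := dot_sgv_drift_at (tm m k) (z := euler m k w).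
have {H} : dot (sgv (V k w)) (f k w) <= a * enorm (V k w) - margin.
  by apply: H; rewrite -subr_eq0.
have E : 2 * dot (V k w) D / (2 * enorm (V k w)) = h * dot (sgv (V k w)) (f k w)
   + dot (sgv (V k w)) (sg k w *m dbeta (tm m k) (tm m k.+1) w).
  rewrite -mulf_div divff ?mul1r ?pnatr_eq0// mulrC /sgv !dotZl.
  by rewrite /D [dot (V k w) (_ + _)]dotC dotDl dotZl !(dotC _ (V k w)); ring.
rewrite mulrDl E => /(ler_wpM2l (ltW h0)); rewrite invfM (_ : true%:R = 1 :> R)// mulr1; lra.
Qed.

(** Since [sigma] vanishes at the target, |sigma|^2 divided by the distance is at most L^2 times the
    distance: the second-order noise term joins the growth rate, half of the constant 8 giving 4.
    The squared drift divided by the distance is only bounded with the help of [delta], but it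
    carries the factor h^2. *)
Let near_step k : (k < 2 ^ m)%N -> near k.+1 <= (1 + h * (a + 4 * L ^+ 2)) * near k
  - h * (margin * Ex (ind k) - h * (drift_moment / (2 * delta))).
Proof.
move=> kN; have h0 := step_gt0 hT m.
have [N1 N2] := noise_part_mean k.
have wh : wrtm (gen (tm m k)) (fun w => h *: f k w) by apply: wrtmZ; [exact: wrt_cst|exact: wf].
have WS : wrtm (gen (tm m k)) (fun w => c k w *: (h *: f k w)).
  by apply: wrtmZ (c_wrt k) _; exact: wh.
have LS : L2m (fun w => c k w *: (h *: f k w)).
  by apply: L2m_c; [exact: wh|exact/L2mZ/Lf].
have WG : wrtm (gen (tm m k)) (fun w => c k w *: sg k w) by exact: wrtmZ (c_wrt k) (ws k).
have LG : L2m (fun w => c k w *: sg k w) by apply: L2m_c; [exact: ws|exact: Ls].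
have [Q1 Q2] := vector_step hbeta (tm_leS hT m k) WS LS WG LG.
set QQ := (fun w => _ + _) in Q1 Q2.
have H : near k.+1 <= (1 + h * a) * near k - h * margin * Ex (ind k) + 0 + 2^-1 * M2 QQ.
  rewrite -N2 /near /M2 -!ExZ//; [|exact: L2m_L1].
  have l1 := L1Z (1 + h * a) (L1_near k); have l2 := L1Z (h * margin) (L1_ind k).
  have l3 := L1Z 2^-1 (L2m_L1 Q1).
  rewrite -ExB// -ExD//; last exact: L1B.
  rewrite -ExD//; last by apply: L1D => //; exact: L1B.
  apply: Ex_le; [exact: L1_near|by apply: L1D => //; apply: L1D => //; exact: L1B|].
  by move=> w; exact: pointwise.
have H1 : M2 (fun w => c k w *: (h *: f k w)) <= h ^+ 2 * (delta^-1 * drift_moment).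
  apply: (@le_trans _ _ (h ^+ 2 * (delta^-1 * M2 (f k)))); last first.
    apply: ler_wpM2l; [exact: sqr_ge0|apply: ler_wpM2l; [by rewrite invr_ge0 ltW|]].
    exact: (euler_M2_drift hbeta S _ (ltnW kN)).
  rewrite /M2 -!ExZ; [|by first [exact: (L2m_L1 (Lf k))|exact/L1Z/(L2m_L1 (Lf k))]..].
  apply: Ex_le; [exact: L2m_L1|exact/L1Z/L1Z/(L2m_L1 (Lf k))|move=> w].
  rewrite !enormZ 2!exprMn !real_normK ?num_real// mulrCA.
  by apply: ler_wpM2l; [exact: sqr_ge0|apply: ler_wpM2r; [exact: sqr_ge0|exact: c_sqr_le]].
have H2 : M2 (fun w => c k w *: sg k w) <= L ^+ 2 * near k.
  rewrite /near /M2 -ExZ//; apply: Ex_le; [exact: L2m_L1|exact: L1Z|move=> w].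
  rewrite enormZ exprMn real_normK ?num_real// c_sqr /ind.
  case: (boolP (far k w)) => fk; last by rewrite !mul0r mulr0.
  have V0 : 0 < enorm (V k w) by apply: lt_trans (far_last fk).
  rewrite !mul1r mulrC ler_pdivrMr// -mulrA -expr2; exact: enorm_sigma_sqr.
move: Q2; rewrite tmS [_ + h]addrC addrK => Q2.
have H2' : 8 * h * M2 (fun w => c k w *: sg k w) <= 8 * h * (L ^+ 2 * near k).
  by apply: ler_wpM2l => //; rewrite mulr_ge0// ltW.
have -> : h * (margin * Ex (ind k) - h * (drift_moment / (2 * delta))) =
   h * margin * Ex (ind k) - 2^-1 * (h ^+ 2 * (delta^-1 * drift_moment)).
  by rewrite invfM; ring.
by lra.
Qed.

(** The probability of being still far decreases in [k], so every step gains at least what the last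
    one does. The accumulated gain cannot exceed the initial distance times the growth factor,
    because [near] remains nonnegative. *)
Lemma far_bound : 0 < margin ->
  T * (margin * Ex (fun w => (far (2 ^ m) w)%:R : R) - h * (drift_moment / (2 * delta))) <=
  expR ((a + 4 * L ^+ 2) * T) * enorm (x - y).
Proof.
change (fun w => (far (2 ^ m) w)%:R : R) with (ind (2 ^ m)).
move=> q0; have h0 := step_gt0 hT m; set C := a + 4 * L ^+ 2.
have C0 : 0 <= C by rewrite addr_ge0// mulr_ge0// sqr_ge0.
set v := margin * _ - _.
(* For positive [v] the growth factor 1 + h C may also be applied to the accumulated gain, which
   closes the induction; otherwise the left side is not positive. *)
case: (leP v 0) => v0.
  apply: (@le_trans _ _ 0); first by rewrite pmulr_rle0.
  by rewrite mulr_ge0 ?expR_ge0 ?enorm_ge0.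
have near0 k : 0 <= near k by apply: Ex_ge0 => w; rewrite mulr_ge0 ?enorm_ge0.
have mono k : (k <= 2 ^ m)%N -> Ex (ind (2 ^ m)) <= Ex (ind k).
  move=> kN; apply: Ex_le; [exact: L1_ind|exact: L1_ind|move=> w].
  rewrite ler_nat; suff : far (2 ^ m) w -> far k w by case: (far _ w); case: (far _ w) => // ->.
  move=> /allP H; apply/allP => j; rewrite mem_iota add0n => /andP[_ jk]; apply: H.
  by rewrite mem_iota add0n/=; exact: leq_trans jk _.
have ind_step k : (k <= 2 ^ m)%N -> near k + tm m k * v <= (1 + h * C) ^+ k * enorm (x - y).
  elim: k => [_|k ih kN].
    rewrite tm0 mul0r addr0 mul1r -[leRHS](Ex_cst P); apply: Ex_le => //; first exact: L1_cst.
    by move=> w; rewrite ler_piMl ?enorm_ge0// /ind; case: (far _ _).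
  have H := near_step kN; have ih' := ih (ltnW kN); have M := mono _ (ltnW kN).
  have vk : v <= margin * Ex (ind k) - h * (drift_moment / (2 * delta)) by rewrite lerD2r ler_pM2l.
  have hC : 0 <= h * C by rewrite mulr_ge0// ltW.
  have M1 := ler_wpM2l (ltW h0) vk.
  have M2' : (1 + h * C) * (near k + tm m k * v) <= (1 + h * C) * ((1 + h * C) ^+ k * enorm (x - y)).
    by apply: ler_wpM2l => //; rewrite addr_ge0.
  have M3 : 0 <= h * C * (tm m k * v).
    by rewrite mulr_ge0// mulr_ge0 ?tm_ge0// ltW.
  rewrite tmS exprS -mulrA; apply: le_trans M2'; move: H; rewrite -/C; lra.
have := ind_step _ (leqnn _); rewrite tm_last => H.
apply: (@le_trans _ _ ((1 + h * C) ^+ (2 ^ m) * enorm (x - y))).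
  by apply: le_trans H; rewrite lerDr near0.
apply: ler_wpM2r; first exact: enorm_ge0.
have -> : expR (C * T) = expR (h * C) ^+ (2 ^ m).
  by rewrite -expRM_natl mulrA [_ * h]mulrC -/(tm m (2 ^ m)) tm_last mulrC.
apply: lerXn2r; rewrite ?nnegrE ?expR_ge0 ?expR_ge1Dx//.
by rewrite addr_ge0// mulr_ge0// ltW.
Qed.

End hitting.

(** * Lipschitz functions as integrals of their derivatives *)

Section lipschitz_derivative.
Context {R : realType}.
Local Notation leb := (@lebesgue_measure R).

Lemma klipschitz_continuous (H : R -> R) K : 0 < K ->
  (forall s t, `|H s - H t| <= K * `|s - t|) -> continuous H.
Proof.
move=> K0 HK t; apply/cvgrPdist_le => e e0.
exists (e / K) => /=; first exact: divr_gt0.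
move=> s /= st; apply: le_trans (HK t s) _.
by rewrite mulrC -ler_pdivlMr// ltW.
Qed.

(** Both measures are infima over countable covers by half-open intervals, and on each interval the
    increment of [H] is at most [K] times the length. *)
Lemma stieltjes_dominated (H : cumulative R R) K : 0 < K ->
  (forall s t, `|H s - H t| <= K * `|s - t|) ->
  forall A, (lebesgue_stieltjes_measure H A <= K%:E * leb A)%E.
Proof.
move=> K0 HK A; rewrite /lebesgue_measure /lebesgue_stieltjes_measure /measure_extension.
rewrite -lee_pdivrMl//; apply: le_ereal_inf_tmp => _ [B cB <-].
have [mB AB] := cB.
rewrite lee_pdivrMl// -nneseriesZl//.
apply: (@le_trans _ _ (\sum_(k <oo) wlength H (B k))%E).
  by apply: ereal_inf_lbound; exists B.
apply: lee_nneseries => // k _.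
have [[r s] _ <-] := mB k; rewrite wlength_itv/= [wlength idfun _]wlength_itv/=.
rewrite !lte_fin; case: ifPn => rs; last by rewrite mule0.
rewrite -!EFinB -EFinM lee_fin; apply: le_trans (ler_norm _) _.
by have := HK s r; rewrite [`|s - r|]ger0_norm// subr_ge0 ltW.
Qed.

(** The Stieltjes measure of [H] restricted to ]0, T] is finite and absolutely continuous by
    domination; its Radon-Nikodym density integrates to the measure of ]0, t], which is the
    increment of [H]. *)
Lemma nondecreasing_lipschitz_density (H : R -> R) K T : 0 < K -> 0 < T ->
  {homo H : s t / s <= t} -> (forall s t, `|H s - H t| <= K * `|s - t|) ->
  exists f : R -> R, leb.-integrable setT (EFin \o f) /\
    forall t, 0 <= t <= T -> \int[leb]_(s in `]0, t]) f s = H t - H 0.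
Proof.
move=> K0 T0 ndH HK.
have rcH : right_continuous H.
  exact/right_continuousW/(klipschitz_continuous K0 HK).
pose Hc : cumulative R R := HB.pack H (isCumulative.Build R _ R H ndH rcH).
pose nu := lebesgue_stieltjes_measure Hc.
have nule A : (nu A <= K%:E * leb A)%E by exact: stieltjes_dominated.
have mI t : measurable (`]0, t] : set (measurableTypeR R)) by exact: measurable_itv.
have Ifin : (nu (`]0%R, T]%classic : set R) < +oo)%E.
  apply: le_lt_trans (nule _) _; rewrite lebesgue_measure_itv/= lte_fin T0 -EFinB -EFinM.
  exact: ltry.
pose nuT : {finite_measure set (measurableTypeR R) -> \bar R} := mfrestr (mI T) Ifin.
have dom : nuT `<< leb.
  apply/null_content_dominatesP => A mA A0; apply/eqP; rewrite eq_le measure_ge0 andbT.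
  rewrite /nuT/= /mfrestr/mrestr; apply: le_trans (nule _) _.
  have : (leb (A `&` `]0%R, T]) <= leb A)%E.
    by apply: le_measure; [rewrite inE; exact: measurableI|rewrite inE|exact: subIsetl].
  by rewrite A0 => A00; rewrite mule_ge0_le0// lee_fin ltW.
have [f [f0 ffin fint fE]] := radon_nikodym_sigma_finite dom.
exists (fine \o f); have EF : EFin \o (fine \o f) = f by apply/funext => s /=; rewrite fineK.
rewrite EF; split => // t /andP[t0 tT].
rewrite /Rintegral -[X in fine X](_ : (\int[leb]_(s in `]0%R, t]) f s)%E = _); last first.
  by apply: eq_integral => s _; rewrite fineK.
rewrite -fE//= /mfrestr/mrestr setIidl; last first.
  by move=> s; rewrite /= !in_itv/= => /andP[->/= /le_trans]; apply.
rewrite /lebesgue_stieltjes_measure /measure_extension measurable_mu_extE/=; last exact: is_ocitv.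
by rewrite wlength_itv/= lte_fin; move: t0; rewrite le_eqVlt => /predU1P[<-|->]//; rewrite ltxx subrr.
Qed.

(** Adding K t makes [G] nondecreasing, and Lebesgue differentiation of the integral identifies the
    density. The quotients are taken along t - 1/(k+1), since a control built from them may look
    only into the past. *)
Lemma lipschitz_derivative (G : R -> R) K T : 0 < K -> 0 < T ->
  (forall s t, `|G s - G t| <= K * `|s - t|) ->
  exists f : R -> R, [/\ leb.-integrable `]0, T] (EFin \o f),
    forall t, 0 <= t <= T -> \int[leb]_(s in `]0, t]) f s = G t - G 0 &
    {ae leb, forall t, 0 < t < T ->
      (fun k => (G t - G (t - k.+1%:R^-1)) * k.+1%:R) @ \oo --> f t}].
Proof.
move=> K0 T0 GK.
pose H t := G t + K * t.
have ndH : {homo H : s t / s <= t}.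
  move=> s t st; have := ler_norm (G s - G t); have := GK s t.
  rewrite [`|s - t|]ler0_norm ?subr_le0// /H; lra.
have HK s t : `|H s - H t| <= (K + K) * `|s - t|.
  rewrite /H opprD addrACA -mulrBr (le_trans (ler_normD _ _))// mulrDl lerD//.
  by rewrite normrM gtr0_norm.
have [f [fint fE]] := nondecreasing_lipschitz_density (addr_gt0 K0 K0) T0 ndH HK.
have mI t : measurable (`]0, t] : set (measurableTypeR R)) by exact: measurable_itv.
have Kint t : leb.-integrable `]0, t] (EFin \o cst K).
  have : (leb (`]0%R, t]%classic : set R) < +oo)%E.
    by rewrite lebesgue_measure_itv/=; case: ifP => _; rewrite ?ltry// -EFinB ltry.
  by move=> Ioo; apply: measurable_bounded_integrable => //; exists `|K|; split=> // M KM s _; exact: ltW.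
have fintS t : leb.-integrable `]0, t] (EFin \o f) by exact: integrableS fint.
exists (fun s => f s - K); split.
- by have := integrableB (mI T) (fintS T) (Kint T); apply: eq_integrable => //; exact: mI.
- move=> t tT; rewrite RintegralB// fE// Rintegral_cst//.
  have t0 := (andP tT).1.
  have E : fine (leb (`]0%R, t]%classic : set R)) = t.
    rewrite lebesgue_measure_itv/= lte_fin.
    by move: t0; rewrite le_eqVlt => /predU1P[<-|->]/=; rewrite ?ltxx ?subr0.
  rewrite [X in _ - _ * X](_ : _ = t); last exact: E.
  rewrite /H; lra.
have := FTC1 (f := f) (a := BRight 0) fintS (open_integrable_locally openT fint).
apply: filterS; first exact: (ae_filter_ringOfSetsType leb).
move=> t Ht /andP[t0 tT].
have [D DE] := Ht t0.
set F := fun y => _ in D DE.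
have FE y : 0 <= y <= T -> F y = H y - H 0 by exact: fE.
have Dcv : h^-1 *: ((F \o shift t) (h *: 1) - F t) @[h --> 0^'] --> f t.
  by rewrite -DE derive1E; exact: D.
have r0 : (fun k : nat => - k.+1%:R^-1 : R) @ \oo --> 0.
  by rewrite -oppr0; apply: cvgN; exact: cvg_harmonic.
have rn (k : nat) : - k.+1%:R^-1 != 0 :> R by rewrite oppr_eq0 invr_eq0 pnatr_eq0.
have := (cvgr_dnbhsP _ _ _).1 Dcv _ (conj rn r0).
move=> /cvgB /(_ (cvg_cst K)); apply: cvg_trans; apply: near_eq_cvg; near=> k.
have tk : k.+1%:R^-1 < t by near: k; exact: near_infty_natSinv_lt (PosNum t0).
have k0 : 0 < k.+1%:R^-1 :> R by rewrite invr_gt0.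
transitivity ((- k.+1%:R^-1)^-1 * (F (- k.+1%:R^-1 * 1 + t) - F t) - K); first by [].
rewrite mulr1 [- _ + t]addrC (FE t) ?(ltW t0) ?(ltW tT)// FE; last first.
  by rewrite subr_ge0 (ltW tk)/= (le_trans _ (ltW tT))// gerBl ltW.
rewrite /H invrN invrK.
have E : k.+1%:R^-1 * k.+1%:R = 1 :> R by rewrite mulVf.
have {E} : K * (k.+1%:R^-1 * k.+1%:R) = K by rewrite E mulr1.
have aux (r q g1 g2 g3 : R) : K * (r * q) = K ->
  - q * (g1 + K * (t - r) - (g3 + K * 0) - (g2 + K * t - (g3 + K * 0))) - K = (g2 - g1) * q.
  by move=> ?; lra.
exact: aux.
Unshelve. all: by end_near. Qed.
End lipschitz_derivative.

(** * Almost sure uniform convergence *)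

Section continuity.
Context {R : realType}.

Lemma max0_lipschitz (s t : R) : `|Num.max 0 t - Num.max 0 s| <= `|t - s|.
Proof.
case: (leP 0 t) => t0; case: (leP 0 s) => s0; rewrite ?subrr ?normr0//.
  by rewrite subr0 ger0_norm// (le_trans _ (ler_norm _))//; lra.
by rewrite sub0r normrN ger0_norm// distrC (le_trans _ (ler_norm _))//; lra.
Qed.

Lemma telescope_le (D : nat -> nat -> R) (c : R) i0 : (forall i, D i i = 0) ->
  (forall i j k, D i k <= D i j + D j k) ->
  (forall i, (i0 <= i)%N -> D i i.+1 <= c * 2 ^- i) -> 0 <= c ->
  forall i i', (i0 <= i)%N -> (i <= i')%N -> D i i' <= 2 * c * 2 ^- i.
Proof.
move=> D0 Dt D1 c0 i i' i0i ii'.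
(* The geometric sum is kept exact, as the induction on [i'] needs the subtracted term. *)
suff : D i i' <= 2 * c * (2 ^- i - 2 ^- i').
  by move/le_trans; apply; rewrite ler_wpM2l ?mulr_ge0// gerBl.
elim: i' ii' => [|i' ih]; first by rewrite leqn0 => /eqP ->; rewrite D0 subrr mulr0.
rewrite leq_eqVlt => /predU1P[<-|ii']; first by rewrite D0 subrr mulr0.
apply: le_trans (Dt i i' i'.+1) _.
have := ih ii'; have := D1 i' (leq_trans i0i ii').
have -> : 2 ^- i' = 2 * 2 ^- i'.+1 :> R by rewrite exprS invfM mulrA divff ?mul1r.
lra.
Qed.

Lemma continuous_max0 (f : R -> R) : {within `[0, +oo[, continuous f} ->
  continuous (fun t : R => f (Num.max 0 t)).
Proof.
move=> /subspace_continuousP fc t; apply/cvgrPdist_le => e e0.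
have t0 : `[0, +oo[%classic (Num.max 0 t) by rewrite /= in_itv/= andbT le_max lexx.
have /cvgrPdist_le/(_ e e0) := fc _ t0.
move=> [r /= r0 Hr]; exists r => //= s st; apply: Hr.
  apply: le_lt_trans st => /=.
  exact: max0_lipschitz.
by rewrite /= in_itv/= andbT le_max lexx.
Qed.

Variable T : R.
Hypothesis hT : 0 < T.

Lemma dyadic_le (g : R -> R) (e : R) r0 : continuous g ->
  (forall r k, (r0 <= r)%N -> (k <= 2 ^ r)%N -> g (tm T r k) <= e) ->
  forall t, 0 <= t <= T -> g t <= e.
Proof.
move=> gc ge t tT; rewrite leNgt; apply/negP => et.
have /cvgrPdist_lt/(_ _ (_ : 0 < g t - e)) := gc t; rewrite subr_gt0 => /(_ et) [r /= rp Hr].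
have /cvgrPdist_lt/(_ _ rp) [N _ HN] := step_cvg0 T.
pose l := maxn N r0.
have /= := HN l (leq_maxl _ _); rewrite sub0r normrN gtr0_norm ?step_gt0// => sl.
have [c cl /andP[ct tc]] := tm_cell l tT.
have := ge l c (leq_maxr _ _) (ltnW cl); rewrite leNgt => /negP; apply.
have /Hr : `|t - tm T l c| < r.
  by rewrite ger0_norm ?subr_ge0//; move: tc; rewrite tmS; lra.
by move=> /=; rewrite ltr_norml => /andP[_]; lra.
Qed.
End continuity.

Section regular_paths.
Context {R : realType} {dO : measure_display} {Omega : measurableType dO}.
Variables (n d : nat) (beta : 'I_d -> R -> Omega -> R).
Variable S : setting R n d.
Local Notation T := (horizon S).
Local Notation x := (start S).
Local Notation y := (target S).
Local Notation a := (boundA S).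
Let hT : 0 < T := horizon_gt0 S.
Local Notation tm := (tm T).
Local Notation step := (step T).
Local Notation euler := (euler beta S).
Local Notation mart := (mart beta S).
Local Notation drift := (drift beta S).
Local Notation interp := (interp beta S).
Local Notation drift_at := (drift_at S).
Local Notation drift_const := (drift_const S).

Variable phi : nat -> nat.

(** What the Borel-Cantelli argument can provide. Kolmogorov's inequality controls the martingale
    parts at all fine dyadic times, but the drift is no martingale: the full paths are controlled
    only at the finitely many points of the grid of level [i], and equicontinuity of the drifts has
    to fill the gaps. *)
Definition summable_gaps w : Prop :=
  (forall j, {within `[0, +oo[, continuous (fun t : R => beta j t w)}) /\
  exists i0, forall i, (i0 <= i)%N ->
    (forall p q r k, (phi i.+1 <= r)%N -> (k <= 2 ^ r)%N ->
       `|mart (phi i) p q (tm r k) w - mart (phi i.+1) p q (tm r k) w| <= 2 ^- i) /\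
    (forall k, (k <= 2 ^ i)%N ->
       enorm (interp (phi i) (tm i k) w - interp (phi i.+1) (tm i k) w) <= 2 ^- i).

Definition uniformly_cauchy w : Prop :=
  (forall j, {within `[0, +oo[, continuous (fun t : R => beta j t w)}) /\
  exists C i0, 0 <= C /\ forall i i' s t, (i0 <= i)%N -> (i <= i')%N ->
    0 <= s <= T -> 0 <= t <= T ->
    [/\ forall p q, `|mart (phi i) p q t w - mart (phi i') p q t w| <= C * 2 ^- i,
        enorm (drift (phi i) t w - drift (phi i') t w) <= C * 2 ^- i &
        enorm (drift (phi i) t w - drift (phi i) s w) <= C * `|t - s| ].

Lemma mart_continuous m p q w :
  (forall j, {within `[0, +oo[, continuous (fun t : R => beta j t w)}) ->
  continuous (fun t : R => mart m p q (Num.max 0 t) w).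
Proof.
move=> bc; rewrite /mart.
have mc k (t : R) : {for t, continuous (fun t : R => noise S (euler m k w) p q *
    incr beta q (Num.min (tm m k) (Num.max 0 t)) (Num.min (tm m k.+1) (Num.max 0 t)) w)}.
  have H l (u : R) : {for u, continuous (fun t : R => beta q (Num.min (tm m l) (Num.max 0 t)) w)}.
    have E : (fun t => beta q (Num.min (tm m l) (Num.max 0 t)) w) =
       (fun t => beta q (Num.max 0 t) w) \o (fun t => Num.min (tm m l) t).
      apply/funext => s /=; congr (beta q _ w).
      by rewrite max_minr (max_r (tm_ge0 hT m l)).
    rewrite E; apply: continuous_comp; last exact: continuous_max0 (bc q) _.
    by apply: continuous_min; [exact: cvg_cst|exact: cvg_id].
  by apply: cvgM; [exact: cvg_cst|apply: cvgB; exact: H].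
elim: (2 ^ m)%N => [|N ih].
  by under eq_fun do rewrite big_ord0; move=> t; exact: cvg_cst.
by under eq_fun do rewrite big_ord_recr; move=> t; apply: cvgD; [exact: ih|exact: mc].
Qed.

Arguments mart_continuous : clear implicits.

Let weight m k (t : R) := Num.min (tm m k.+1) t - Num.min (tm m k) t.

Lemma sum_weight m t : 0 <= t <= T -> \sum_(k < 2 ^ m) weight m k t = t.
Proof.
move=> /andP[t0 tT].
rewrite -(big_mkord xpredT (fun k => weight m k t)) telescope_sumr//.
by rewrite tm_last tm0 (min_r tT) (min_l t0) subr0.
Qed.

Lemma weight_le m k s t : s <= t -> weight m k s <= weight m k t.
Proof.
move=> st; have : tm m k <= tm m k.+1 by rewrite (tm_le hT).
by rewrite /weight => ?; case: (leP _ s) => ?; case: (leP _ t) => ?; case: (leP _ s) => ?; case: (leP _ t) => ?;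
  lra.
Qed.

(** The weights gained between [s] and [t] are nonnegative and add up to t - s, so the increment is
    t - s times an average of frozen drifts. *)
Lemma drift_lipschitz m w K : (forall k, (k < 2 ^ m)%N -> enorm (drift_at (tm m k) (euler m k w)) <= K) ->
  forall s t, 0 <= s <= T -> 0 <= t <= T ->
  enorm (drift m t w - drift m s w) <= K * `|t - s|.
Proof.
move=> HK s t; wlog st : s t / s <= t => [H sT tT|sT tT].
  by have [/H|/ltW /H] := leP s t; [apply|rewrite enormBC distrC; apply].
rewrite /drift -sumrB; apply: le_trans (ler_enorm_sum _ _ _) _.
have E : t - s = \sum_(k < 2 ^ m) (weight m k t - weight m k s).
  by rewrite sumrB !sum_weight.
rewrite ger0_norm ?subr_ge0// E mulr_sumr.
apply: ler_sum => k _; rewrite -scalerBl enormZ ger0_norm ?subr_ge0 ?weight_le//.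
by rewrite mulrC ler_wpM2r ?subr_ge0 ?weight_le// HK.
Qed.

Local Notation mcol m t w := (\col_p \sum_q mart m p q t w).

Lemma enorm_mcol m m' t w c : (forall p q, `|mart m p q t w - mart m' p q t w| <= c) ->
  enorm (mcol m t w - mcol m' t w) <= n%:R * (d%:R * c).
Proof.
move=> H; apply: le_trans (ler_enorm_sum_entry _) _.
rewrite -[n in n%:R]card_ord -sum1_card natr_sum mulr_suml; apply: ler_sum => p _.
rewrite mul1r !mxE -sumrB; apply: le_trans (ler_norm_sum _ _ _) _.
by rewrite -[d in d%:R]card_ord -sum1_card natr_sum mulr_suml; apply: ler_sum => q _; rewrite mul1r.
Qed.

(** A Gronwall argument on a single path: once its martingale part is bounded, the scheme is bounded
    independently of the level. This is the source of the common Lipschitz constant of the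
    drifts. *)
Lemma euler_path_bound m w M : (forall p q t, 0 <= t <= T -> `|mart m p q t w| <= M) ->
  forall k, (k < 2 ^ m)%N -> enorm (euler m k w - y) <=
    expR (a * T) * (enorm (x - y) + n%:R * (d%:R * M) + drift_const * T).
Proof.
move=> HM; set MM := n%:R * (d%:R * M).
(* A majorant of the distance that satisfies the one-step recursion; the distance itself does not,
   because the martingale part is bounded globally and not step by step. *)
pose E k := enorm (x - y) + MM + \sum_(l < k) step m * (a * enorm (euler m l w - y) + drift_const).
have h0 := step_gt0 hT m.
have tk k : (k < 2 ^ m)%N -> 0 <= tm m k <= T.
  by move=> kN; rewrite (tm_ge0 hT) (tm_leT hT)// ltnW.
have mc k : (k < 2 ^ m)%N -> enorm (mcol m (tm m k) w) <= MM.
  move=> kN; have := @enorm_mcol m m (tm m k) w M.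
  have -> : mcol m (tm m k) w = mcol m (tm m k) w - 0 by rewrite subr0.
  move=> _; apply: le_trans (ler_enorm_sum_entry _) _.
  rewrite /MM -[n in n%:R]card_ord -sum1_card natr_sum mulr_suml; apply: ler_sum => p _.
  rewrite mul1r !mxE subr0; apply: le_trans (ler_norm_sum _ _ _) _.
  rewrite -[d in d%:R]card_ord -sum1_card natr_sum mulr_suml; apply: ler_sum => q _.
  by rewrite mul1r HM ?tk.
have eE k : (k < 2 ^ m)%N -> enorm (euler m k w - y) <= E k.
  move=> kN; have tkk : tm m k <= tm m k <= tm m k.+1 by rewrite lexx (tm_le hT)/=.
  rewrite -(interp_grid beta S w (ltnW kN)) /interp (drift_cell beta w kN tkk) subrr scale0r addr0.
  rewrite (_ : x + _ + _ - y = (x - y) + mcol m (tm m k) w +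
    \sum_(l < k) step m *: drift_at (tm m l) (euler m l w)); last first.
    by rewrite addrAC [RHS]addrAC; congr +%R; rewrite addrAC.
  apply: le_trans (ler_enormD _ _) _; apply: lerD.
    by apply: le_trans (ler_enormD _ _) _; rewrite lerD2l mc.
  apply: le_trans (ler_enorm_sum _ _ _) _; apply: ler_sum => l _.
  by rewrite enormZ gtr0_norm// ler_pM2l// enorm_drift_at.
have a0 := boundA_ge0 S; have c00 := drift_const_ge0 S.
have E0 : 0 <= E 0%N.
  rewrite /E big_ord0 addr0 addr_ge0 ?enorm_ge0//.
  have N0 : (0 < 2 ^ m)%N by rewrite expn_gt0.
  exact: le_trans (enorm_ge0 _) (mc _ N0).
move=> k kN; apply: (le_trans (eE k kN)).
have := discrete_gronwall (a := E) (C := a) (h := step m) (e := drift_const) (N := 2 ^ m) a0 (ltW h0) c00 E0.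
move=> /(_ _ k (ltnW kN)) H; apply: le_trans (H _) _.
  move=> l lN; rewrite {1}/E big_ord_recr/= addrA -/(E l).
  have := ler_wpM2l a0 (eE l lN) => /(ler_wpM2l (ltW h0)); lra.
rewrite -/(tm m k); have /andP[k0 kT] := tk k kN.
rewrite {1}/E big_ord0 addr0; apply: ler_pM.
- exact: expR_ge0.
- by apply: addr_ge0; [move: E0; rewrite /E big_ord0 addr0|exact: mulr_ge0].
- by rewrite ler_expR ler_wpM2l.
- by rewrite lerD2l ler_wpM2l.
Qed.

Lemma mart_bounded m p q w :
  (forall j, {within `[0, +oo[, continuous (fun t : R => beta j t w)}) ->
  exists M, forall t, 0 <= t <= T -> `|mart m p q t w| <= M.
Proof.
move=> bc; have mc := mart_continuous m p q w bc.
have cc : {within `[0, T], continuous (fun t : R => `|mart m p q (Num.max 0 t) w|)}.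
  by apply: continuous_subspaceT => t; apply: (continuous_comp (mc t)); exact: norm_continuous.
have [c _ Hc] := EVT_max (ltW hT) cc.
exists (`|mart m p q (Num.max 0 c) w|) => t tT.
by have := Hc t; rewrite in_itv/= tT max_r ?(andP tT).1//; apply.
Qed.

(** Martingale parts converge uniformly by continuity and density of dyadic times. At grid points of
    level [i] the drift is the path minus its martingale part; elsewhere the distance to the grid is
    at most T / 2^i and the common Lipschitz constant [K] applies. *)
Lemma summable_gaps_cauchy w : summable_gaps w -> uniformly_cauchy w.
Proof.
move=> [bc [i0 H]]; split=> //.
have M1 p q t : 0 <= t <= T -> forall i, (i0 <= i)%N ->
    `|mart (phi i) p q t w - mart (phi i.+1) p q t w| <= 1 * 2 ^- i.
  move=> tT i ii; rewrite mul1r.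
  pose g := fun t : R => `|mart (phi i) p q (Num.max 0 t) w - mart (phi i.+1) p q (Num.max 0 t) w|.
  have gc : continuous g.
    move=> s; apply: (@continuous_comp _ _ _ (fun t : R =>
      mart (phi i) p q (Num.max 0 t) w - mart (phi i.+1) p q (Num.max 0 t) w)); last exact: norm_continuous.
    by apply: cvgB; exact: mart_continuous bc _.
  have := dyadic_le (T := T) hT gc (e := 2 ^- i) (r0 := phi i.+1) _ tT.
  rewrite /g (max_r (andP tT).1); apply => r k rr kr.
  by rewrite max_r ?(tm_ge0 hT)//; apply: (H i ii).1.
have M2 p q t i i' : 0 <= t <= T -> (i0 <= i)%N -> (i <= i')%N ->
    `|mart (phi i) p q t w - mart (phi i') p q t w| <= 2 * 2 ^- i.
  move=> tT ii ii'.
  have DD j : `|mart (phi j) p q t w - mart (phi j) p q t w| = 0 by rewrite subrr normr0.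
  have DT j k l : `|mart (phi j) p q t w - mart (phi l) p q t w| <=
    `|mart (phi j) p q t w - mart (phi k) p q t w| + `|mart (phi k) p q t w - mart (phi l) p q t w|.
    exact: ler_distD.
  have := (telescope_le (D := fun i i' =>
    `|mart (phi i) p q t w - mart (phi i') p q t w|) (c := 1) DD DT (M1 p q t tT) ler01 ii ii').
  by rewrite mulr1.
have [M HM] : exists M, forall i p q t, (i0 <= i)%N -> 0 <= t <= T -> `|mart (phi i) p q t w| <= M.
  pose M p q := sval (cid (mart_bounded (phi i0) p q bc)).
  have HM p q t : 0 <= t <= T -> `|mart (phi i0) p q t w| <= M p q.
    by rewrite /M; case: cid => M' /= HM'; exact: HM'.
  have T0 : (0 : R) <= 0 <= T by rewrite lexx ltW.
  have M0 p q : 0 <= M p q by apply: le_trans (HM p q 0 T0).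
  exists (\sum_p \sum_q M p q + 2 * 2 ^- i0) => i p q t ii tT.
  have := M2 p q t i0 i tT (leqnn _) ii; have := HM p q t tT.
  have : M p q <= \sum_p \sum_q M p q.
    rewrite (bigD1 p)//= (bigD1 q)//= -addrA lerDl addr_ge0// sumr_ge0// => *.
    by rewrite sumr_ge0.
  rewrite distrC => h1 h2 h3; rewrite -(subrK (mart (phi i0) p q t w) (mart (phi i) p q t w)).
  by apply: le_trans (ler_normD _ _) _; lra.
pose CE := expR (a * T) * (enorm (x - y) + n%:R * (d%:R * M) + drift_const * T).
pose K := a * CE + drift_const.
have HK i : (i0 <= i)%N -> forall s t, 0 <= s <= T -> 0 <= t <= T ->
    enorm (drift (phi i) t w - drift (phi i) s w) <= K * `|t - s|.
  move=> ii; apply: drift_lipschitz => k kN; apply: le_trans (enorm_drift_at _ _ _) _.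
  rewrite lerD2r ler_wpM2l ?boundA_ge0//; apply: euler_path_bound => // p q t tT; exact: HM.
have K0 : 0 <= K.
  have := HK i0 (leqnn _) 0 T; rewrite lexx (ltW hT) lexx subr0 gtr0_norm// => /(_ isT isT) h.
  by rewrite -(pmulr_lge0 _ hT); apply: le_trans (enorm_ge0 _) h.
pose c1 : R := 1 + n%:R * d%:R.
have c10 : 0 <= c1 by rewrite addr_ge0// mulr_ge0.
have D1 i k i' : (i0 <= i)%N -> (i <= i')%N -> (k <= 2 ^ i)%N ->
    enorm (drift (phi i) (tm i k) w - drift (phi i') (tm i k) w) <= 2 * c1 * 2 ^- i.
  move=> ii ii' ki.
  apply: (telescope_le (i0 := i) (D := fun j j' =>
    enorm (drift (phi j) (tm i k) w - drift (phi j') (tm i k) w))) => //.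
  - by move=> j; rewrite subrr enorm0.
  - move=> j l l'; apply: le_trans (ler_enormD _ _); by rewrite addrA subrK.
  move=> j ij.
  (* A grid point of level [i] belongs to every later grid, so all later gaps are controlled there
     and can be summed. *)
  have E : tm i k = tm j (k * 2 ^ (j - i)) by rewrite -(tm_refine T i (j - i)) subnKC.
  have kj : (k * 2 ^ (j - i) <= 2 ^ j)%N.
    have -> : (2 ^ j = 2 ^ i * 2 ^ (j - i))%N by rewrite -expnD subnKC.
    by rewrite leq_mul2r ki orbT.
  have ij0 := leq_trans ii ij.
  have := (H j ij0).2 _ kj; rewrite -E => h1.
  have tT : 0 <= tm i k <= T by rewrite (tm_ge0 hT) (tm_leT hT).
  have h2 := enorm_mcol (fun p q => M1 p q _ tT j ij0).
  have -> : drift (phi j) (tm i k) w - drift (phi j.+1) (tm i k) w =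
     (interp (phi j) (tm i k) w - interp (phi j.+1) (tm i k) w)
     - (mcol (phi j) (tm i k) w - mcol (phi j.+1) (tm i k) w).
    rewrite /interp; set u := drift _ _ _; set v := drift _ _ _.
    by rewrite !opprD !addrA; apply/colP => l; rewrite !mxE; ring.
  apply: le_trans (ler_enormB _ _) _; rewrite /c1; move: h2; rewrite mul1r mulrDl mul1r mulrA; lra.
exists (2 + K + (2 * (K * T) + 2 * c1)), i0.
have KT0 : 0 <= K * T by rewrite mulr_ge0// ltW.
split; first by lra.
move=> i i' s t ii ii' sT tT.
have e0 : 0 <= 2 ^- i :> R by rewrite invr_ge0 exprn_ge0.
split.
- move=> p q; apply: le_trans (M2 p q t i i' tT ii ii') _.
  by rewrite ler_wpM2r//; lra.
- have [k ki /andP[kt tk]] := tm_cell i tT.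
  have kT : 0 <= tm i k <= T by rewrite (tm_ge0 hT) (tm_leT hT)// ltnW.
  have h1 := D1 i k i' ii ii' (ltnW ki).
  have h2 := HK i ii _ _ kT tT; have h3 := HK i' (leq_trans ii ii') _ _ kT tT.
  have h4 : K * `|t - tm i k| <= K * T * 2 ^- i.
    rewrite -mulrA ler_wpM2l// ger0_norm ?subr_ge0//.
    by move: tk; rewrite tmS -/(step i) /step; lra.
  rewrite (_ : _ - _ = (drift (phi i) t w - drift (phi i) (tm i k) w)
    + (drift (phi i) (tm i k) w - drift (phi i') (tm i k) w)
    - (drift (phi i') t w - drift (phi i') (tm i k) w)); last first.
    by apply/colP => l; rewrite !mxE; ring.
  apply: le_trans (ler_enormB _ _) _.
  have := ler_enormD (drift (phi i) t w - drift (phi i) (tm i k) w) (drift (phi i) (tm i k) w - drift (phi i')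
    (tm i k) w).
  have : 0 <= (2 + K) * 2 ^- i by rewrite mulr_ge0//; lra.
  lra.
- apply: le_trans (HK i ii s t sT tT) _; rewrite ler_wpM2r//; lra.
Qed.

End regular_paths.

Section finite_unions.
Context {R : realType} {dO : measure_display} {Omega : measurableType dO}.
Variable P : probability Omega R.

Lemma measure_bigcup_seq_le (I : choiceType) (r : seq I) (A : I -> set Omega) (c : R) :
  (forall i, measurable (A i)) -> (forall i, i \in r -> (P (A i) <= c%:E)%E) ->
  measurable (\bigcup_(i in [set` r]) A i) /\
  (P (\bigcup_(i in [set` r]) A i) <= ((size r)%:R * c)%:E)%E.
Proof.
move=> mA; elim: r => [|i r ih] Ac; first by rewrite set_nil bigcup_set0 measure0 mul0r.
have [m1 P1] := ih (fun j jr => Ac j (mem_behead (s := i :: r) jr)).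
have -> : [set` i :: r] = i |` [set` r].
  apply/seteqP; split => j /=; first by rewrite inE => /predU1P[->|jr]; [left|right].
  by rewrite inE => -[->|->]; rewrite ?eqxx ?orbT.
rewrite bigcup_setU1; split; first exact: measurableU.
apply: le_trans (measureU2 _ (mA i) m1) _; rewrite /= -natr1 mulrDl mul1r addrC EFinD leeD//.
by apply: Ac; rewrite mem_head.
Qed.

Lemma markov_enorm n (Z : Omega -> 'cV[R]_n) (lambda : R) : 0 < lambda ->
  measurable_fun setT (fun w => enorm (Z w)) -> L2m P Z ->
  measurable [set w | lambda < enorm (Z w)] /\
  (P [set w | (lambda < enorm (Z w))%R] <= (M2 P Z / lambda ^+ 2)%:E)%E.
Proof.
move=> l0 mZ LZ.
have mA : measurable [set w | lambda < enorm (Z w)].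
  have -> : [set w | lambda < enorm (Z w)] = (fun w => enorm (Z w)) @^-1` `]lambda, +oo[.
    by apply/seteqP; split => w /=; rewrite in_itv/= andbT.
  by rewrite -[X in measurable X]setTI; exact: mZ.
split => //; rewrite -(fineK (fin_num_measure P _ mA)) lee_fin ler_pdivlMr ?exprn_gt0//.
rewrite -Ex_indic// mulrC -ExZ; last exact: L1_indic.
apply: Ex_le; [exact/L1Z/L1_indic|exact: L2m_L1|move=> w].
rewrite indicE; case: (boolP (w \in _)) => [|_]; last by rewrite mulr0 sqr_ge0.
by rewrite inE/= mulr1 => h; rewrite ler_pXn2r ?nnegrE ?enorm_ge0// ltW.
Qed.
End finite_unions.

(** * A subsequence that converges for almost every path *)

Section almost_sure.
Context {R : realType} {dO : measure_display} {Omega : measurableType dO}.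
Variables (P : probability Omega R) (n d : nat) (beta : 'I_d -> R -> Omega -> R).
Hypothesis hbeta : independent_brownian_motions P beta.
Variable S : setting R n d.
Local Notation T := (horizon S).
Let hT : 0 < T := horizon_gt0 S.
Local Notation tm := (tm T).
Local Notation mart := (mart beta S).
Local Notation interp := (interp beta S).

Lemma error_subsequence (eps : nat -> R) : (forall i, 0 < eps i) ->
  exists phi : nat -> nat, [/\ forall i, (phi i <= phi i.+1)%N, forall i, (i <= phi i)%N &
    forall i, noise_gap S (phi i) <= eps i /\ path_error S (phi i) <= eps i].
Proof.
move=> eps0.
have H i : exists N, forall m, (N <= m)%N -> noise_gap S m <= eps i /\ path_error S m <= eps i.
  have /cvgrPdist_le/(_ _ (eps0 i)) [N1 _ H1] := noise_gap_cvg0 S.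
  have /cvgrPdist_le/(_ _ (eps0 i)) [N2 _ H2] := path_error_cvg0 S.
  exists (maxn N1 N2) => m; rewrite geq_max => /andP[h1 h2].
  have := H1 m h1; have := H2 m h2; rewrite /= !sub0r !normrN => h3 h4.
  by split; apply: le_trans (ler_norm _) _.
have [N HN] := choice H.
(* Partial sums make the sequence nondecreasing, while the last summand makes it at least [i] and at
   least [N i]. *)
exists (fun i => \sum_(j < i.+1) (N j + j))%N; split.
- by move=> i; rewrite [leqRHS]big_ord_recr/= leq_addr.
- by move=> i; rewrite big_ord_recr/= addnA leq_addl.
- by move=> i; apply: HN; rewrite big_ord_recr/= addnCA leq_addr.
Qed.

Lemma continuity_null : exists N : set Omega, [/\ measurable N, P N = 0%E &
  forall w, ~ N w -> forall j, {within `[0, +oo[, continuous (fun t : R => beta j t w)}].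
Proof.
have H j : exists N, [/\ measurable N, P N = 0%E &
    ~` [set w | {within `[0, +oo[, continuous (fun t : R => beta j t w)}] `<=` N].
  by have [hb _] := hbeta; exact: (bm_continuous (hb j)).
have [N HN] := choice H.
have mN j : measurable (N j) by case: (HN j).
have [m1 m2] := @measure_bigcup_seq_le _ _ _ P _ (enum 'I_d) N 0 mN
  (fun j _ => ltac:(by case: (HN j) => _ -> _)).
exists (\bigcup_(j in [set` enum 'I_d]) N j); split => //.
  by apply/eqP; rewrite eq_le measure_ge0 andbT; apply: le_trans m2 _; rewrite mulr0.
move=> w Nw j; apply: contrapT => nc; apply: Nw; exists j; first by rewrite /= mem_enum.
by case: (HN j) => _ _; apply.
Qed.

(** Borel-Cantelli: along a fast subsequence the bad events have summable probabilities, so off a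
    null set only finitely many of them occur. Paths where a Brownian motion is discontinuous are
    put into the same null set. *)
Lemma exists_cauchy_subsequence : exists (phi : nat -> nat) (N : set Omega),
  [/\ forall i, (i <= phi i)%N, forall i, (phi i <= phi i.+1)%N,
   measurable N, P N = 0%E & forall w, ~ N w -> uniformly_cauchy beta S phi w].
Proof.
(* The number of bad events at stage [i], weighted: n d martingale entries with the constant 8 T,
   and 2^i + 1 grid points. Dividing by it and inserting the squared threshold, [eps i] makes the
   total probability at most 1 / 2^(i+1). *)
pose K i : R := n%:R * d%:R * (8 * T) + ((2 ^ i).+1)%:R.
have K0 i : 0 < K i by rewrite ltr_wpDl ?ltr0n// !mulr_ge0// ltW.
pose eps i : R := (2 ^ i.+1)%:R^-1 * (2 ^- i) ^+ 2 / K i.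
have e0 i : 0 < eps i.
  by rewrite divr_gt0// mulr_gt0 ?invr_gt0 ?ltr0n ?expn_gt0// exprn_gt0// invr_gt0 exprn_gt0.
have [phi [phi1 phi2 phi3]] := error_subsequence e0.
have [N0 [mN0 PN0 HN0]] := continuity_null.
have l0 i : 0 < 2 ^- i :> R by rewrite invr_gt0 exprn_gt0.
pose q i := (phi i.+1 - phi i)%N.
have phiq i : (phi i + q i)%N = phi i.+1 by rewrite subnKC.
pose E i (pq : 'I_n * 'I_d) := [set w | exists s k, (k <= 2 ^ (phi i + q i + s))%N /\
    2 ^- i < `|mart (phi i) pq.1 pq.2 (tm (phi i + q i + s) k) w
      - mart (phi i + q i) pq.1 pq.2 (tm (phi i + q i + s) k) w| ].
have mE i pq : measurable (E i pq) by case: (mart_sup hbeta S (phi i) (q i) pq.1 pq.2 (l0 i)).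
have PE i pq : (P (E i pq) <= (8 * T * (eps i / (2 ^- i) ^+ 2))%:E)%E.
  have [_ h] := mart_sup hbeta S (phi i) (q i) pq.1 pq.2 (l0 i).
  apply: (le_trans h); rewrite lee_fin (mulrA 8 T) -[leLHS]mulrA ler_pM2l ?mulr_gt0//.
  by rewrite ler_pM2r ?invr_gt0 ?exprn_gt0//; case: (phi3 i).
pose D i k := [set w | 2 ^- i < enorm (interp (phi i) (tm i (minn k (2 ^ i))) w
   - interp (phi i.+1) (tm i (minn k (2 ^ i))) w)].
have HD i k : measurable (D i k) /\ (P (D i k) <= (eps i / (2 ^- i) ^+ 2)%:E)%E.
  set t := tm i (minn k (2 ^ i)).
  have tT : 0 <= t <= T by rewrite (tm_ge0 hT) (tm_leT hT)// geq_minr.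
  have [w1 L1] := interp_wrt_L2 hbeta S (phi i) tT.
  have [w2 L2] := interp_wrt_L2 hbeta S (phi i.+1) tT.
  have mZ : measurable_fun setT (fun w => enorm (interp (phi i) t w - interp (phi i.+1) t w)).
    apply: (wrt_measurable _ (wrt_enorm (wrtmB w1 w2))).
    exact: augmented_filtration_measurable.
  have [h1 h2] := markov_enorm (l0 i) mZ (L2mB L1 L2).
  split => //; apply: (le_trans h2); rewrite lee_fin ler_pM2r ?invr_gt0 ?exprn_gt0//.
  have := interp_comparison hbeta S (phi i) (q i) tT; rewrite phiq => h; apply: (le_trans h).
  by case: (phi3 i).
have mD i k : measurable (D i k) by case: (HD i k).
pose B i := (\bigcup_(pq in [set` enum {: 'I_n * 'I_d}]) E i pq)
   `|` \bigcup_(k in [set` iota 0 (2 ^ i).+1]) D i k.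
have HB i : measurable (B i) /\ (P (B i) <= (1 / (2 ^ i.+1)%:R)%:E)%E.
  have [a1 a2] := measure_bigcup_seq_le (r := enum {: 'I_n * 'I_d}) (mE i) (fun pq _ => PE i pq).
  have [b1 b2] := measure_bigcup_seq_le (r := iota 0 (2 ^ i).+1) (mD i) (fun k _ => (HD i k).2).
  split; first exact: measurableU.
  apply: le_trans (measureU2 _ a1 b1) _; apply: le_trans (leeD a2 b2) _.
  rewrite -EFinD lee_fin -cardE card_prod !card_ord size_iota natrM mulrA -mulrDl -/(K i).
  have aux (u v k : R) : u != 0 -> v != 0 -> k != 0 -> k * (u^-1 * v / k / v) = 1 / u.
    by move=> u0 v0 k0; field; rewrite u0 v0 k0.
  by rewrite /eps aux// ?expf_neq0 ?gt_eqF ?ltr0n ?expn_gt0.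
have mB i : measurable (B i) by case: (HB i).
have PB0 : P (lim_sup_set B) = 0%E.
  apply: lim_sup_set_cvg0 => //.
  apply: le_lt_trans (ltry 1); apply: le_trans (epsilon_trick0 xpredT ler01).
  by apply: lee_nneseries => // i _; case: (HB i).
exists phi, (N0 `|` lim_sup_set B).
have mL : measurable (lim_sup_set B).
  by apply: bigcapT_measurable => i; apply: bigcup_measurable => j _; exact: mB.
split => //.
- exact: measurableU.
- by rewrite measureU0.
move=> w /not_orP[Nw Lw]; apply: summable_gaps_cauchy; split; first exact: HN0.
move: Lw; rewrite /lim_sup_set /bigcap/= => /existsNP[i0 /not_implyP[_ Hi0]].
exists i0 => i ii; have nB : ~ B i w by move=> Bi; apply: Hi0; exists i.
move/not_orP: nB => [nE nD]; split.
  move=> p q' r k rr kr; rewrite leNgt; apply/negP => h; apply: nE; exists (p, q').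
    by rewrite /= mem_enum.
  exists (r - phi i.+1)%N, k; rewrite phiq subnKC//.
move=> k ki; rewrite leNgt; apply/negP => h; apply: nD; exists k.
  have : k \in iota 0 (2 ^ i).+1 by rewrite mem_iota add0n ltnS.
  by [].
by rewrite /D /= (minn_idPl ki).
Qed.

End almost_sure.

Section geometric_rates.
Context {R : realType}.

Lemma pow2N_cvg0 (C : R) : (fun i : nat => C * 2 ^- i) @ \oo --> 0.
Proof.
rewrite -(mulr0 C); apply: cvgM; first exact: cvg_cst.
under eq_fun do rewrite -exprVn.
by apply: cvg_expr; rewrite ger0_norm// invf_lt1// ltr1n.
Qed.

Lemma pow2N_le (C e : R) : 0 <= C -> 0 < e ->
  exists i0, forall i, (i0 <= i)%N -> C * 2 ^- i <= e.
Proof.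
move=> C0 e0; have /cvgrPdist_le/(_ _ e0) [i0 _ H] := pow2N_cvg0 C.
exists i0 => i /H; rewrite /= sub0r normrN ger0_norm// mulr_ge0// invr_ge0 exprn_ge0//.
Qed.

Lemma le_pow2N (u v C : R) i0 : 0 <= C ->
  (forall i, (i0 <= i)%N -> u <= v + C * 2 ^- i) -> u <= v.
Proof.
move=> C0 H; apply/ler_addgt0Pr => e e0.
have [i1 Hi1] := pow2N_le C0 e0.
by apply: le_trans (H (maxn i0 i1) (leq_maxl _ _)) _; rewrite lerD2l Hi1// leq_maxr.
Qed.

Lemma geometric_cauchy (u : nat -> R) (C : R) i0 : 0 <= C ->
  (forall i i', (i0 <= i)%N -> (i <= i')%N -> `|u i - u i'| <= C * 2 ^- i) ->
  u @ \oo --> limn u /\ forall i, (i0 <= i)%N -> `|u i - limn u| <= C * 2 ^- i.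
Proof.
move=> C0 H.
have cu : cvgn u.
  apply/cauchy_cvgP/cauchy_exP => e e0.
  have i0e : 0 < e / 2 by rewrite divr_gt0.
  have [i1 Hi1] := pow2N_le C0 i0e.
  exists (u (maxn i0 i1)); exists (maxn i0 i1) => //= i' ii'.
  apply: le_lt_trans (H _ _ (leq_maxl _ _) ii') _.
  by apply: le_lt_trans (Hi1 _ (leq_maxr _ _)) _; rewrite ltr_pdivrMr// ltr_pMr// ltr1n.
split => // i ii; rewrite distrC.
apply/ler_addgt0Pr => e e0; have /cvgrPdist_le/(_ _ e0) [i1 _ H1] := cu.
have := H1 (maxn i i1) (leq_maxr _ _); have := H i (maxn i i1) ii (leq_maxl _ _).
rewrite /= => h1 h2; have := ler_distD (u (maxn i i1)) (limn u) (u i).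
by rewrite [`|u (maxn _ _) - u i|]distrC; lra.
Qed.

Lemma continuous_sum (I : Type) (r : seq I) (f : I -> R -> R) :
  (forall i, continuous (f i)) -> continuous (fun t => \sum_(i <- r) f i t).
Proof.
move=> fc; elim: r => [|i r ih] t.
  by under eq_fun do rewrite big_nil; exact: cvg_cst.
by under eq_fun do rewrite big_cons; apply: cvgD; [exact: fc|exact: ih].
Qed.

End geometric_rates.

Section fatou.
Context {R : realType} {dO : measure_display} {Omega : measurableType dO}.
Variable P : probability Omega R.
Local Notation Ex f := (Rintegral P setT f).

Lemma Ex_fatou (f : nat -> Omega -> R) (g : Omega -> R) (N : set Omega) (c : R) :
  (forall k, L1 P (f k)) -> (forall k w, 0 <= f k w) -> measurable_fun setT g ->
  (forall w, 0 <= g w) -> measurable N -> P N = 0%E ->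
  (forall w, ~ N w -> f ^~ w @ \oo --> g w) -> (forall k, Ex (f k) <= c) ->
  L1 P g /\ Ex g <= c.
Proof.
move=> L f0 mg g0 mN PN fg fc.
have mf k : measurable_fun setT (f k) by exact: L1_measurable.
(* Changing the sequence on the null set turns almost sure into pointwise convergence without
   altering integrals. *)
pose h k w := if w \in N then g w else f k w.
have mh k : measurable_fun setT (h k).
  apply: measurable_fun_ifT => //; apply: (measurable_fun_bool true).
  rewrite setTI (_ : _ @^-1` _ = N)//.
  by apply/seteqP; split => w /=; [exact: set_mem|exact: mem_set].
have H : (\int[P]_w (g w)%:E <= c%:E)%E.
  have E : (fun w => (g w)%:E) = fun w => limn_einf (fun k => (h k w)%:E).
    apply/funext => w; apply/esym; apply: (cvg_limn_einf_sup _).1.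
    apply: cvg_EFin; first by near=> k.
    rewrite /h; case: (boolP (w \in N)) => wN; first exact: cvg_cst.
    by apply: fg => Nw; move: wN; rewrite mem_set.
  rewrite E; apply: le_trans (fatou P measurableT (f := fun k w => (h k w)%:E) _ _) _.
  - by move=> k; exact/measurable_EFinP.
  - by move=> k w _; rewrite lee_fin /h; case: ifP.
  rewrite limn_einf_lim; apply: lime_le; first exact: is_cvg_einfs.
  near=> k; apply: (@le_trans _ _ (\int[P]_w (h k w)%:E)%E).
    by apply: ereal_inf_lbound; exists k => /=.
  rewrite (ge0_ae_eq_integral (g := EFin \o f k)) ?ExE ?lee_fin//.
  - exact/measurable_EFinP.
  - exact/measurable_EFinP.
  - by move=> w _; rewrite lee_fin /h; case: ifP.
  - by move=> w _ /=; rewrite lee_fin.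
  exists N; split => // w /= nh; apply: contrapT => Nw; apply: nh => _.
  by rewrite /h memNset.
exact: L1_ge0 mg g0 H.
Unshelve. all: by end_near. Qed.
End fatou.

Lemma enorm_lipschitz {R : realType} n (u v : 'cV[R]_n) : `|enorm u - enorm v| <= enorm (u - v).
Proof.
rewrite ler_norml; have := ler_enormD (u - v) v; have := ler_enormD (v - u) u.
by rewrite !subrK (enormBC v u); lra.
Qed.

(** * The limit process *)

Section clip.
Context {R : realType}.
Variable T : R.

(** Freezing time outside [0, T] extends coefficients and processes to the whole line, so that
    continuity and Lipschitz bounds can be stated globally. *)
Definition clip (t : R) : R := Num.max 0 (Num.min t T).

Lemma clipK t : 0 <= t <= T -> clip t = t.
Proof. by move=> /andP[t0 tT]; rewrite /clip (min_l tT) (max_r t0). Qed.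

Lemma clip_mono s t : s <= t -> 0 <= t -> clip s <= t.
Proof. by move=> st t0; rewrite /clip ge_max t0 ge_min st. Qed.

Lemma clip_lipschitz s t : `|clip s - clip t| <= `|s - t|.
Proof.
apply: le_trans (max0_lipschitz _ _) _.
wlog st : s t / s <= t => [H|].
  by have [/H//|/ltW /H] := leP s t; rewrite distrC [`|t - s|]distrC.
rewrite distrC [leRHS]distrC (ger0_norm (_ : 0 <= t - s)) ?subr_ge0//.
by rewrite ger0_norm; case: (leP s T) => ?; case: (leP t T) => ?; lra.
Qed.

Lemma clip_in t : 0 < T -> 0 <= clip t <= T.
Proof. by move=> hT; rewrite /clip le_max lexx/= ge_max (ltW hT) ge_min lexx orbT. Qed.
End clip.

Section limit.
Context {R : realType} {dO : measure_display} {Omega : measurableType dO}.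
Variables (P : probability Omega R) (n d : nat) (beta : 'I_d -> R -> Omega -> R).
Variable S : setting R n d.
Local Notation T := (horizon S).
Local Notation x := (start S).
Let hT : 0 < T := horizon_gt0 S.
Local Notation clip := (clip T).
Local Notation clip_lipschitz := (clip_lipschitz T).
Local Notation mart := (mart beta S).
Local Notation drift := (drift beta S).
Local Notation interp := (interp beta S).
Local Notation F := (augmented_filtration P beta).
Local Notation gen := (filtration_gen P beta).
Local Notation Ex f := (Rintegral P setT f).

Variables (phi : nat -> nat) (N : set Omega).

(** Setting the processes to 0 on the exceptional set makes the limit exist with continuous paths
    for every [w]. Adaptedness survives because the augmented filtration contains the null sets from
    time 0 on. *)
Definition martN i p q t w : R := if w \in N then 0 else mart (phi i) p q (clip t) w.
Definition driftN i t w : 'cV[R]_n := if w \in N then 0 else drift (phi i) (clip t) w.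
Definition interpN i t w : 'cV[R]_n := x + driftN i t w + \col_p \sum_q martN i p q t w.
Definition limM p q t w : R := limn (fun i => martN i p q t w).
Definition limD t w : 'cV[R]_n := \col_l limn (fun i => driftN i t w l 0).
Definition limX t w : 'cV[R]_n := x + limD t w + \col_p \sum_q limM p q t w.

Hypothesis cauchy_off : forall w, ~ N w -> uniformly_cauchy beta S phi w.

Let cauchyN w : exists C i0, 0 <= C /\ forall i i' s t, (i0 <= i)%N -> (i <= i')%N ->
  [/\ forall p q, `|martN i p q t w - martN i' p q t w| <= C * 2 ^- i,
      enorm (driftN i t w - driftN i' t w) <= C * 2 ^- i &
      enorm (driftN i t w - driftN i s w) <= C * `|t - s| ].
Proof.
have [wN|wN] := boolP (w \in N).
  exists 0, 0%N; split => // i i' s t _ _; rewrite /martN /driftN wN !subrr enorm0 !mul0r.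
  by split => // *; rewrite normr0.
have /cauchy_off [_ [C [i0 [C0 H]]]] : ~ N w by move=> /mem_set; exact/negP.
exists C, i0; split => // i i' s t ii ii'.
rewrite /martN /driftN (negbTE wN).
have [h1 h2 h3] := H i i' _ _ ii ii' (clip_in s hT) (clip_in t hT).
by split => //; apply: le_trans h3 _; rewrite ler_wpM2l// clip_lipschitz.
Qed.

Lemma limit_rate w : exists C i0, [/\ 0 <= C,
  (forall i p q t, (i0 <= i)%N -> `|martN i p q t w - limM p q t w| <= C * 2 ^- i),
  (forall i t, (i0 <= i)%N -> enorm (driftN i t w - limD t w) <= C * 2 ^- i),
  (forall i t, (i0 <= i)%N -> enorm (interpN i t w - limX t w) <= C * 2 ^- i) &
  (forall s t, enorm (limD t w - limD s w) <= C * `|t - s|) ].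
Proof.
have [C [i0 [C0 H]]] := cauchyN w.
have hM i p q t : (i0 <= i)%N -> `|martN i p q t w - limM p q t w| <= C * 2 ^- i.
  move=> ii; have [|_] := geometric_cauchy (u := fun i => martN i p q t w) (i0 := i0) C0; last exact.
  by move=> k k' kk kk'; have [h _ _] := H k k' t t kk kk'; exact: h.
have hDl i l t : (i0 <= i)%N -> `|driftN i t w l 0 - limD t w l 0| <= C * 2 ^- i.
  move=> ii; rewrite mxE.
  have [|_] := geometric_cauchy (u := fun i => driftN i t w l 0) (i0 := i0) C0; last exact.
  move=> k k' kk kk'; have [_ h _] := H k k' t t kk kk'; apply: le_trans h.
  have := ler_enorm_entry (driftN k t w - driftN k' t w) l 0.
  by rewrite !mxE.
have hD i t : (i0 <= i)%N -> enorm (driftN i t w - limD t w) <= n%:R * C * 2 ^- i.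
  move=> ii; apply: le_trans (ler_enorm_sum_entry _) _.
  rewrite -mulrA -[n in n%:R]card_ord -sum1_card natr_sum mulr_suml; apply: ler_sum => l _.
  have -> : (driftN i t w - limD t w) l 0 = driftN i t w l 0 - limD t w l 0.
    by rewrite [LHS]mxE; congr +%R; rewrite mxE.
  by rewrite mul1r hDl.
have nC : 0 <= n%:R * C by rewrite mulr_ge0.
have dnC : 0 <= n%:R * (d%:R * C) by rewrite !mulr_ge0.
exists (n%:R * C + n%:R * (d%:R * C) + C), i0; split.
- by rewrite !addr_ge0.
- move=> i p q t ii; apply: le_trans (hM i p q t ii) _.
  by rewrite ler_wpM2r ?invr_ge0 ?exprn_ge0// lerDr addr_ge0.
- move=> i t ii; apply: le_trans (hD i t ii) _.
  by rewrite ler_wpM2r ?invr_ge0 ?exprn_ge0// -addrA lerDl addr_ge0.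
- move=> i t ii; rewrite /interpN /limX.
  rewrite (_ : _ - _ = (driftN i t w - limD t w) +
     (\col_p \sum_q martN i p q t w - \col_p \sum_q limM p q t w)); last first.
    by rewrite addB3 subrr add0r.
  apply: le_trans (ler_enormD _ _) _.
  have h2 : enorm (\col_p \sum_q martN i p q t w - \col_p \sum_q limM p q t w) <= n%:R * (d%:R * C) * 2 ^- i.
    apply: le_trans (ler_enorm_sum_entry _) _.
    rewrite -mulrA -[n in n%:R]card_ord -sum1_card natr_sum mulr_suml; apply: ler_sum => p _.
    rewrite mul1r !mxE -sumrB; apply: le_trans (ler_norm_sum _ _ _) _.
    rewrite -mulrA -[d in d%:R]card_ord -sum1_card natr_sum mulr_suml; apply: ler_sum => q _.
    by rewrite mul1r hM.
  apply: le_trans (lerD (hD i t ii) h2) _.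
  by rewrite -mulrDl ler_wpM2r ?invr_ge0 ?exprn_ge0// lerDl.
- move=> s t; apply: (@le_trans _ _ (C * `|t - s|)); last first.
    by rewrite ler_wpM2r// lerDr addr_ge0.
  apply: (@le_pow2N _ _ _ (2 * (n%:R * C)) i0); first by rewrite mulr_ge0.
  move=> i ii; have [_ _ h3] := H i i s t ii (leqnn _).
  rewrite (_ : _ - _ = (driftN i t w - driftN i s w) - (driftN i t w - limD t w) + (driftN i s w - limD s w));
    last first.
    by apply/colP => l; rewrite ![in RHS]mxE ![in LHS]mxE; ring.
  apply: le_trans (ler_enormD _ _) _.
  apply: le_trans (lerD (le_trans (ler_enormB _ _) (lerD h3 (hD i t ii))) (hD i s ii)) _.
  have -> : 2 * (n%:R * C) * 2 ^- i = n%:R * C * 2 ^- i + n%:R * C * 2 ^- i.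
    by rewrite -mulrA mulr_natl mulr2n.
  by rewrite addrA.
Qed.

Lemma limM_cvg p q t w : (fun i => martN i p q t w) @ \oo --> limM p q t w.
Proof.
have [C [i0 [C0 H]]] := cauchyN w.
have [|//] := geometric_cauchy (u := fun i => martN i p q t w) (i0 := i0) C0.
by move=> k k' kk kk'; have [h _ _] := H k k' t t kk kk'; exact: h.
Qed.

Lemma limD_cvg l t w : (fun i => driftN i t w l 0) @ \oo --> limD t w l 0.
Proof.
have [C [i0 [C0 H]]] := cauchyN w.
rewrite mxE; have [|//] := geometric_cauchy (u := fun i => driftN i t w l 0) (i0 := i0) C0.
move=> k k' kk kk'; have [_ h _] := H k k' t t kk kk'; apply: le_trans h.
by have := ler_enorm_entry (driftN k t w - driftN k' t w) l 0; rewrite !mxE.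
Qed.

Lemma limM_continuous p q w : continuous (fun t => limM p q t w).
Proof.
move=> t; apply/cvgrPdist_le => e e0.
have [C [i0 [C0 HM _ _ _]]] := limit_rate w.
have e3 : 0 < e / 3 by rewrite divr_gt0.
have [i1 Hi1] := pow2N_le C0 e3.
pose i := maxn i0 i1.
have mc : continuous (fun t => martN i p q t w).
  rewrite /martN; have [wN|wN] := boolP (w \in N); first by move=> ?; exact: cvg_cst.
  have /cauchy_off [bc _] : ~ N w by move=> /mem_set; exact/negP.
  move=> s; apply: (@continuous_comp _ _ _ (fun t => Num.min t T) (fun t : R => mart (phi i) p q (Num.max 0 t) w)).
    by apply: (@continuous_min _ _ (fun t => t) (fun=> T)); [exact: cvg_id|exact: cvg_cst].
  exact: mart_continuous bc _.
have /cvgrPdist_le/(_ _ e3) := mc t; apply: filterS => s hs.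
have := HM i p q t (leq_maxl _ _); have := HM i p q s (leq_maxl _ _).
have := Hi1 i (leq_maxr _ _); move: hs.
move: (martN i p q t w) (martN i p q s w) (limM p q t w) (limM p q s w) (C * 2 ^- i) => u v u' v' r.
rewrite !ler_norml; lra.
Qed.

Lemma limX_entry l t w : limX t w l 0 = x l 0 + limD t w l 0 + \sum_q limM l q t w.
Proof. by rewrite !mxE. Qed.

Lemma limD_continuous l w : continuous (fun t => limD t w l 0).
Proof.
have [C [_ [C0 _ _ _ H]]] := limit_rate w.
apply: (@klipschitz_continuous _ _ (C + 1)); first by rewrite ltr_wpDl.
move=> s t; apply: (@le_trans _ _ (C * `|s - t|)); last by rewrite ler_wpM2r// lerDl.
by apply: le_trans (H t s); have := ler_enorm_entry (limD s w - limD t w) l 0; rewrite !mxE.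
Qed.

Lemma limX_continuous l w : continuous (fun t => limX t w l 0).
Proof.
have -> : (fun t => limX t w l 0) = fun t => x l 0 + limD t w l 0 + \sum_q limM l q t w.
  by apply/funext => t; rewrite limX_entry.
move=> t; apply: cvgD; first by apply: cvgD; [exact: cvg_cst|exact: limD_continuous].
have H := continuous_sum (r := index_enum 'I_d) (f := fun q s => limM l q s w) (fun q => @limM_continuous l q w).
exact: H t.
Qed.

Hypothesis hbeta : independent_brownian_motions P beta.
Hypotheses (mN : measurable N) (PN : P N = 0%E).

Let filtN t : <<s gen t>> N.
Proof. by apply: sub_sigma_algebra; right. Qed.

Lemma limM_wrt p q t : wrt (F (clip t)) (limM p q t).
Proof.
apply: (wrt_lim (Yn := fun i => martN i p q t)); last by move=> w; exact: limM_cvg.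
move=> i; apply: wrt_if; [exact: filtN|exact: wrt_cst|].
by have [] := mart_wrt hbeta S (phi i) p q (andP (clip_in t hT)).1.
Qed.

Lemma drift_wrt m t : 0 <= t <= T -> wrtm (gen t) (drift m t).
Proof.
move=> tT; have [w1 _] := interp_wrt_L2 hbeta S m tT.
have E l : (fun w => interp m t w l 0 - x l 0 - \sum_q mart m l q t w) =1 (fun w => drift m t w l 0).
  by move=> w; rewrite !mxE; ring.
move=> l k; rewrite ord1; apply: eq_wrt (E l) _.
apply: wrtB; first by apply: wrtB; [exact: w1|exact: wrt_cst].
by apply: wrt_sum => q; have [] := mart_wrt hbeta S m l q (andP tT).1.
Qed.

Lemma limD_wrt t : wrtm (gen (clip t)) (limD t).
Proof.
move=> l k; rewrite ord1.
apply: (wrt_lim (Yn := fun i w => driftN i t w l 0)); last by move=> w; exact: limD_cvg.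
move=> i.
have E : (fun w => if w \in N then 0 else drift (phi i) (clip t) w l 0) =1 (fun w => driftN i t w l 0).
  by move=> w; rewrite /driftN; case: ifP => //; rewrite mxE.
apply: eq_wrt E _.
by apply: wrt_if; [exact: filtN|exact: wrt_cst|exact: (@drift_wrt _ _ (clip_in t hT) l 0)].
Qed.

Lemma limX_wrt t : wrtm (gen (clip t)) (limX t).
Proof.
apply: wrtmD; first by apply: wrtmD; [exact: wrtm_cst|exact: limD_wrt].
move=> l k.
have E : (fun w => \sum_q limM l q t w) =1 (fun w => (\col_p \sum_q limM p q t w) l k).
  by move=> w; rewrite mxE.
apply: eq_wrt E _.
by apply: wrt_sum => q; exact: limM_wrt.
Qed.

Let martN_off i p q t w : ~ N w -> martN i p q t w = mart (phi i) p q (clip t) w.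
Proof. by move=> Nw; rewrite /martN memNset. Qed.

Let interpN_off i t w : ~ N w -> interpN i t w = interp (phi i) (clip t) w.
Proof. by move=> Nw; rewrite /interpN /interp /driftN /martN memNset. Qed.

Hypothesis phi_nd : forall i, (phi i <= phi i.+1)%N.

Let phi_mono i k : (phi i <= phi (k + i))%N.
Proof. by elim: k => // k ih; apply: leq_trans ih (phi_nd _). Qed.

(** In [mart_comparison] the finer level tends to infinity; the bound depends only on the coarser
    one, and Fatou's lemma preserves it. *)
Lemma limM_error i p q t : 0 <= t <= T ->
  L2 P (fun w => mart (phi i) p q t w - limM p q t w) /\
  Ex (fun w => (mart (phi i) p q t w - limM p q t w) ^+ 2) <= 8 * (T * noise_gap S (phi i)).
Proof.
move=> tT.
have mJ : measurable_fun setT (limM p q t).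
  apply: (wrt_measurable _ (@limM_wrt p q t)); exact: augmented_filtration_measurable.
have [_ LM] := mart_wrt hbeta S (phi i) p q (andP tT).1.
have mZ : measurable_fun setT (fun w => mart (phi i) p q t w - limM p q t w).
  exact: measurable_funB (L2_measurable LM) mJ.
have H k := mart_comparison hbeta (S := S) (phi i) (phi (k + i) - phi i) p q tT.
have cv w : ~ N w -> (fun k => (mart (phi i) p q t w - mart (phi i + (phi (k + i) - phi i)) p q t w) ^+ 2) @ \oo
    --> (mart (phi i) p q t w - limM p q t w) ^+ 2.
  move=> Nw; have := @limM_cvg p q t w.
  rewrite -(cvg_shiftn i) => cM.
  have {}cM : (fun k => mart (phi (k + i)) p q t w) @ \oo --> limM p q t w.
    apply: cvg_trans cM; apply: near_eq_cvg; near=> k.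
    by rewrite /= martN_off// clipK.
  have E k : (phi i + (phi (k + i) - phi i))%N = phi (k + i) by rewrite subnKC.
  under eq_fun do rewrite E expr2; rewrite expr2.
  by apply: cvgM; apply: cvgB => //; exact: cvg_cst.
have [h1 h2] := Ex_fatou (fun k => L2_sqr (H k).1) (fun k w => sqr_ge0 _)
  (measurable_funX 2 mZ) (fun w => sqr_ge0 _) mN PN cv (fun k => (H k).2).
by split => //; split.
Unshelve. all: by end_near. Qed.

Lemma limX_error i t : 0 <= t <= T ->
  L2m P (fun w => interp (phi i) t w - limX t w) /\
  M2 P (fun w => interp (phi i) t w - limX t w) <= path_error S (phi i).
Proof.
move=> tT.
have wX : wrtm (gen t) (limX t) by have := @limX_wrt t; rewrite clipK.
have [wI LI] := interp_wrt_L2 hbeta S (phi i) tT.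
have mZ : measurable_fun setT (fun w => enorm (interp (phi i) t w - limX t w)).
  apply: (wrt_measurable _ (wrt_enorm (wrtmB wI wX))).
  exact: augmented_filtration_measurable.
have LD k : L2m P (fun w => interp (phi i) t w - interp (phi i + (phi (k + i) - phi i)) t w).
  by apply: (L2mB LI); have [] := interp_wrt_L2 hbeta S (phi i + (phi (k + i) - phi i)) tT.
have H k := interp_comparison hbeta S (phi i) (phi (k + i) - phi i) tT.
have cv w : ~ N w -> (fun k => enorm (interp (phi i) t w - interp (phi i + (phi (k + i) - phi i)) t w) ^+ 2) @ \oo
   --> enorm (interp (phi i) t w - limX t w) ^+ 2.
  move=> Nw; rewrite expr2; under eq_fun do rewrite expr2.
  suff : (fun k => enorm (interp (phi i) t w - interp (phi i + (phi (k + i) - phi i)) t w)) @ \oo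
     --> enorm (interp (phi i) t w - limX t w) by move=> h; exact: cvgM.
  have [C [i0 [C0 _ _ HX _]]] := limit_rate w.
  apply/cvgrPdist_le => e e0; have [i1 Hi1] := pow2N_le C0 e0.
  exists (maxn i0 i1) => // k /=; rewrite geq_max => /andP[k0 k1].
  have E : (phi i + (phi (k + i) - phi i))%N = phi (k + i) by rewrite subnKC.
  rewrite E; apply: le_trans (Hi1 (k + i)%N (leq_trans k1 (leq_addr _ _))).
  apply: le_trans (HX (k + i)%N t (leq_trans k0 (leq_addr _ _))).
  rewrite interpN_off// clipK//; apply: le_trans (enorm_lipschitz _ _) _.
  by rewrite opprB addrC addrA subrK.
have [h1 h2] := Ex_fatou (fun k => L2m_L1 (LD k)) (fun k w => sqr_ge0 _)
  (measurable_funX 2 mZ) (fun w => sqr_ge0 _) mN PN cv H.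
split => // p k; rewrite ord1.
apply: (@L2_le _ _ _ _ _ (fun w => enorm (interp (phi i) t w - limX t w))) => //.
  apply: (wrt_measurable _ (wrtmB wI wX p 0)).
  exact: augmented_filtration_measurable.
by move=> w; rewrite [leRHS]ger0_norm ?enorm_ge0//; exact: ler_enorm_entry.
Qed.

End limit.

Lemma dot_suml {R : realType} n (I : Type) (r : seq I) (f : I -> 'cV[R]_n) (z : 'cV[R]_n) :
  dot (\sum_(i <- r) f i) z = \sum_(i <- r) dot (f i) z.
Proof.
elim: r => [|i r ih]; last by rewrite !big_cons dotDl ih.
by rewrite !big_nil -(scale0r (0 : 'cV[R]_n)) dotZl mul0r.
Qed.

Lemma cvg_sum0 {R : realType} (I : Type) (r : seq I) (f : I -> nat -> R) :
  (forall i, f i @ \oo --> 0) -> (fun k => \sum_(i <- r) f i k) @ \oo --> 0.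
Proof.
move=> fc; elim: r => [|i r ih].
  by under eq_fun do rewrite big_nil; exact: cvg_cst.
under eq_fun do rewrite big_cons; have := cvgD (fc i) ih; rewrite addr0; exact.
Qed.

(** * The control carried by the limit *)

Section feedback.
Context {R : realType} {dO : measure_display} {Omega : measurableType dO}.
Variables (n d : nat) (beta : 'I_d -> R -> Omega -> R).
Variable S : setting R n d.
Local Notation T := (horizon S).
Local Notation A := (matA S).
Local Notation B := (matB S).
Local Notation y := (target S).
Local Notation rho := (gain S).
Local Notation a := (boundA S).
Local Notation b := (boundB S).
Let hT : 0 < T := horizon_gt0 S.
Local Notation tm := (tm T).
Local Notation step := (step T).
Local Notation euler := (euler beta S).
Local Notation drift := (drift beta S).
Local Notation interp := (interp beta S).
Local Notation drift_at := (drift_at S).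
Local Notation sign_control := (sign_control S).
Variables (phi : nat -> nat) (N : set Omega).
Hypothesis cauchy_off : forall w, ~ N w -> uniformly_cauchy beta S phi w.
Hypothesis phi_ge : forall i, (i <= phi i)%N.
Local Notation X := (limX beta S phi N).
Local Notation G := (limD beta S phi N).

Lemma limX_near w t e : 0 < e ->
  exists2 r, 0 < r & forall s, `|t - s| < r -> enorm (X s w - X t w) <= e.
Proof.
move=> e0.
have gc : continuous (fun s => \sum_l `|X s w l 0 - X t w l 0|).
  apply: continuous_sum => l s; apply: (continuous_comp (f := fun s => X s w l 0 - X t w l 0));
    last exact: norm_continuous.
  by apply: cvgB; [exact: (@limX_continuous _ _ _ _ _ _ _ _ _ cauchy_off l w)|exact: cvg_cst].
have /cvgrPdist_le/(_ e e0) [r r0 Hr] := gc t.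
exists r => // s ts; apply: le_trans (ler_enorm_sum_entry _) _.
have := Hr s ts; rewrite big1 => [|l _]; last by rewrite subrr normr0.
rewrite sub0r normrN => /(le_trans (ler_norm _)); apply: le_trans.
by apply: ler_sum => l _; rewrite !mxE.
Qed.

(** Cells of a high level that meet the interval from t - r to t start close to [t]; continuity of
    the coefficients and of the limit path, with uniform convergence of the scheme, makes everything
    frozen there close to its value at [t]. *)
Lemma near_cells w t e : ~ N w -> 0 <= t <= T -> 0 < e ->
  exists2 r, 0 < r & exists i0, forall i k, (i0 <= i)%N -> (k < 2 ^ phi i)%N ->
    tm (phi i) k < t -> t - r < tm (phi i) k.+1 ->
    [/\ enorm (A (tm (phi i) k) - A t) <= e, enorm (B (tm (phi i) k) - B t) <= e &
        enorm (euler (phi i) k w - X t w) <= e].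
Proof.
move=> Nw tT e0.
have e2 : 0 < e / 2 by rewrite divr_gt0.
have /cvgrPdist_le/(_ e e0) [m0 _ Hm0] := modulus_cvg0 S.
have [r1 r10 Hr1] := limX_near w t e2.
have [C [i1 [C0 _ _ HX _]]] := limit_rate cauchy_off w.
have [i2 Hi2] := pow2N_le C0 e2.
(* Half the admissible distance: a cell shorter than [r] that reaches beyond t - r starts after t -
   2 r. *)
pose r := Num.min (step m0) r1 / 2.
have r0 : 0 < r by rewrite divr_gt0// lt_min (step_gt0 hT).
have /cvgrPdist_lt/(_ r r0) [i3 _ Hi3] := step_cvg0 T.
exists r => //; exists (maxn i1 (maxn i2 i3)) => i k.
rewrite !geq_max => /and3P[ii1 ii2 ii3] kN kt tk.
have sr : step (phi i) < r.
  have := Hi3 (phi i) (leq_trans ii3 (phi_ge i)).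
  by rewrite /= sub0r normrN gtr0_norm// (step_gt0 hT).
have ts : `|t - tm (phi i) k| < r + r.
  by rewrite ger0_norm ?subr_ge0 1?ltW//; move: tk; rewrite tmS; lra.
have rr : r + r = Num.min (step m0) r1 by rewrite /r -splitr.
have tm0 : `|tm (phi i) k - t| <= step m0.
  by rewrite distrC; apply: ltW; apply: lt_le_trans ts _; rewrite rr ge_min lexx.
have om : modulus S m0 <= e.
  by have := Hm0 m0 (leqnn _); rewrite /= sub0r normrN; apply: le_trans; exact: ler_norm.
split.
- exact: le_trans (matA_modulus tm0) om.
- exact: le_trans (matB_modulus tm0) om.
have kT : 0 <= tm (phi i) k <= T by rewrite (tm_ge0 hT) (tm_leT hT)// ltnW.
rewrite [leRHS]splitr.
apply: le_trans (ler_enorm_dist _ (X (tm (phi i) k) w) _) _; apply: lerD; last first.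
  by apply: Hr1; apply: lt_le_trans ts _; rewrite rr ge_min lexx orbT.
apply: le_trans (Hi2 i ii2); apply: le_trans (HX i (tm (phi i) k) ii1).
rewrite /interpN /driftN /martN memNset// clipK//.
by rewrite -(interp_grid beta S w (ltnW kN)).
Qed.

Local Notation iB t := (invmx (B t)).
Local Notation gap t w := ((B t)^T *m (X t w - y)).

Lemma matB_unit t : B t \in unitmx.
Proof. exact: psd_unitmx (coercivity_gt0 S) (matB_coercive S t). Qed.

Lemma sign_control_gap t z : dot (sign_control t z) ((B t)^T *m (z - y)) = - rho * enorm ((B t)^T *m (z - y)).
Proof. by rewrite dotZl dot_sgv. Qed.

Local Notation weight m k t := (Num.min (tm m k.+1) t - Num.min (tm m k) t).

(* The difference quotient of the drift averages [B *m u - A *m X] along the scheme, so the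
   control it determines is nearly an average of feedback values at states close to [X t w];
   the two inequalities of the sign feedback are stable under such averages. *)
Lemma near_controls w t e : ~ N w -> 0 < t <= T -> 0 < e ->
  exists2 r, 0 < r & forall s, 0 <= s -> t - r < s -> s < t ->
    let V := iB t *m ((t - s)^-1 *: (G t w - G s w) + A t *m X t w) in
    enorm V <= rho + e /\ dot V (gap t w) <= - rho * enorm (gap t w) + e.
Proof.
move=> Nw /andP[t0 tT] e0; have tTT : 0 <= t <= T by rewrite ltW.
have rho0 := gain_gt0 S; have a0 := boundA_ge0 S; have b0 := boundB_ge0 S.
set z := gap t w; set Xt := X t w.
pose K1 := enorm (iB t) * (rho + (enorm Xt + 1) + a).
pose K2 := enorm (Xt - y) + 1 + b.
have K10 : 0 <= K1 by rewrite mulr_ge0 ?enorm_ge0// !addr_ge0 ?enorm_ge0// ltW.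
have K20 : 0 <= K2 by rewrite !addr_ge0 ?enorm_ge0.
pose K3 := K1 * (1 + enorm z) + 2 * rho * K2 + 1.
have K30 : 0 < K3.
  by rewrite ltr_wpDl// addr_ge0// ?mulr_ge0 ?addr_ge0 ?enorm_ge0// ltW.
pose h := Num.min 1 (e / K3).
have h0 : 0 < h by rewrite lt_min ltr01 divr_gt0.
have h1 : h <= 1 by rewrite ge_min lexx.
have hK : K3 * h <= e by rewrite mulrC -ler_pdivlMr// ge_min lexx orbT.
have [r r0 [i0 Hr]] := near_cells Nw tTT h0.
exists r => // s s0 rs st V.
have ts0 : 0 < t - s by rewrite subr_gt0.
have sT : 0 <= s <= T by rewrite s0 ltW// (lt_le_trans st).
pose Vi i := iB t *m ((t - s)^-1 *: (drift (phi i) t w - drift (phi i) s w) + A t *m Xt).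
(* The share of cell [k] in the interval from [s] to [t]: nonnegative weights of sum 1, zero unless
   the cell meets the interval. *)
pose p i k := (t - s)^-1 * (weight (phi i) k t - weight (phi i) k s).
have p0 i k : 0 <= p i k by rewrite mulr_ge0 ?invr_ge0 ?(ltW ts0)// subr_ge0 weight_le// ltW.
have psum i : \sum_(k < 2 ^ phi i) p i k = 1.
  by rewrite -mulr_sumr sumrB !sum_weight// mulVf// gt_eqF.
pose U i k := sign_control (tm (phi i) k) (euler (phi i) k w).
pose E i k := iB t *m ((B (tm (phi i) k) - B t) *m U i k + (A t *m Xt - A (tm (phi i) k) *m euler (phi i) k w)).
have ViE i : Vi i = \sum_(k < 2 ^ phi i) p i k *: (U i k + E i k).
  have UE k : U i k + E i k = iB t *m (drift_at (tm (phi i) k) (euler (phi i) k w) + A t *m Xt).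
    rewrite /E /drift_at -/(U i k) -{1}(mulKmx (matB_unit t) (U i k)) -mulmxDr.
    congr (_ *m _); rewrite mulmxBl addrA [B t *m _ + _]addrC subrK addrA.
    by rewrite addrAC -addrA [RHS]addrC !addrA [RHS]addrC addrA.
  under eq_bigr do rewrite UE scalemxAr; rewrite -mulmx_sumr; congr (_ *m _).
  under eq_bigr do rewrite scalerDr; rewrite big_split -scaler_suml psum scale1r; congr +%R.
  rewrite /drift -sumrB scaler_sumr; apply: eq_bigr => k _.
  by rewrite -scalerBl scalerA.
have active i k : (i0 <= i)%N -> (k < 2 ^ phi i)%N -> p i k != 0 ->
    enorm (E i k) <= K1 * h /\ enorm (U i k) <= rho /\
    dot (U i k) z <= - rho * enorm z + 2 * rho * (K2 * h).
  move=> ii kN pk.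
  have [kt tk] : tm (phi i) k < t /\ s < tm (phi i) k.+1.
    have : tm (phi i) k <= tm (phi i) k.+1 by rewrite (tm_le hT).
    move=> kk; have {}pk : weight (phi i) k t - weight (phi i) k s != 0.
      by apply: contra_neq pk => w0; rewrite /p w0 mulr0.
    have [kt|tk] := ltP (tm (phi i) k) t; last first.
      have sk := le_trans (ltW st) tk.
      by move: pk; rewrite (min_r (le_trans tk kk)) (min_r tk) (min_r (le_trans sk kk)) (min_r sk) !subrr eqxx.
    have [sk|ks] := ltP s (tm (phi i) k.+1); first by [].
    have kt' := le_trans ks (ltW st).
    by move: pk; rewrite (min_l kt') (min_l (le_trans kk kt')) (min_l ks) (min_l (le_trans kk ks)) subrr eqxx.
  have [hA hB hX] := Hr i k ii kN kt (lt_trans rs tk).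
  set tk' := tm (phi i) k in kt hA hB *; set Xk := euler (phi i) k w in hX *.
  have Ub : enorm (U i k) <= rho by exact: enorm_sign_control.
  have Xk1 : enorm Xk <= enorm Xt + 1.
    by rewrite -(subrK Xt Xk); apply: le_trans (ler_enormD _ _) _; rewrite addrC lerD2l (le_trans hX).
  have Xky : enorm (Xk - y) <= enorm (Xt - y) + 1.
    have -> : Xk - y = (Xk - Xt) + (Xt - y) by rewrite addrA subrK.
    by apply: le_trans (ler_enormD _ _) _; rewrite addrC lerD2l (le_trans hX).
  split; [|split=> //].
    apply: le_trans (ler_enorm_mul _ _) _; rewrite /K1 -mulrA; apply: ler_wpM2l; first exact: enorm_ge0.
    apply: le_trans (ler_enormD _ _) _; rewrite !mulrDl -addrA; apply: lerD.
      apply: le_trans (ler_enorm_mul _ _) _; rewrite mulrC.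
      by apply: ler_pM; rewrite ?enorm_ge0.
    have -> : A t *m Xt - A tk' *m Xk = - ((A tk' - A t) *m Xk) - A t *m (Xk - Xt).
      rewrite mulmxBl mulmxBr; move: (A t *m Xt) (A tk' *m Xk) (A t *m Xk) => u v v'.
      by apply/colP => l; rewrite !mxE; ring.
    apply: le_trans (ler_enormB _ _) _; rewrite enormN -mulrDl; apply: lerD.
      apply: le_trans (ler_enorm_mul _ _) _; rewrite mulrC.
      by apply: ler_pM; rewrite ?enorm_ge0.
    apply: le_trans (ler_enorm_mul _ _) _.
    by apply: ler_pM; rewrite ?enorm_ge0 ?matA_le.
  pose zk := (B tk')^T *m (Xk - y).
  have zkz : enorm (zk - z) <= K2 * h.
    have -> : zk - z = (B tk' - B t)^T *m (Xk - y) + (B t)^T *m (Xk - Xt).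
      have trB : (B tk' - B t)^T = (B tk')^T - (B t)^T by exact: linearB.
      rewrite /zk /z trB !(mulmxBl, mulmxBr).
      move: ((B tk')^T *m Xk) ((B tk')^T *m y) ((B t)^T *m Xk) ((B t)^T *m y) ((B t)^T *m Xt) => v1 v2 v3 v4 v5.
      by apply/colP => l; rewrite !mxE; ring.
    apply: le_trans (ler_enormD _ _) _; rewrite mulrDl; apply: lerD.
      apply: le_trans (ler_enorm_mul _ _) _; rewrite enorm_tr mulrC.
      by apply: ler_pM; rewrite ?enorm_ge0.
    apply: le_trans (ler_enorm_mul _ _) _; rewrite enorm_tr.
    by apply: ler_pM; rewrite ?enorm_ge0 ?matB_le.
  have -> : z = zk - (zk - z) by rewrite opprB addrC subrK.
  rewrite dotC dotBl dotC sign_control_gap -/zk.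
  have h3 := normr_dot_le (zk - z) (U i k); have h4 := ler_enormD z (zk - z).
  rewrite [z + _]addrC subrK in h4.
  have -> : zk - (zk - z) = z by rewrite opprB addrC subrK.
  have h5 : enorm (zk - z) * enorm (U i k) <= K2 * h * rho by apply: ler_pM; rewrite ?enorm_ge0.
  move: h3; rewrite ler_norml => /andP[h3 _].
  have h6 : rho * enorm z <= rho * (enorm zk + K2 * h).
    rewrite ler_pM2l//; apply: le_trans (_ : enorm (zk - (zk - z)) <= _).
      by rewrite opprB addrC subrK.
    by apply: le_trans (ler_enormB _ _) _; rewrite lerD2l.
  lra.
have bounds i : (i0 <= i)%N -> enorm (Vi i) <= rho + e /\ dot (Vi i) z <= - rho * enorm z + e.
  move=> ii; rewrite ViE; split.
    apply: le_trans (ler_enorm_sum _ _ _) _; rewrite -[leRHS]mul1r -(psum i) mulr_suml.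
    apply: ler_sum => k _; rewrite enormZ ger0_norm//.
    have [->|pk] := eqVneq (p i k) 0; first by rewrite !mul0r.
    apply: ler_wpM2l => //; apply: le_trans (ler_enormD _ _) _.
    have [h2 [h3 _]] := active i k ii (ltn_ord k) pk; apply: lerD => //.
    apply: (le_trans h2); apply: le_trans hK; rewrite ler_pM2r// /K3.
    have : 0 <= K1 * enorm z by rewrite mulr_ge0 ?enorm_ge0.
    have : 0 <= 2 * rho * K2 by rewrite !mulr_ge0// ltW.
    by clear; lra.
  have -> : dot (\sum_(k < 2 ^ phi i) p i k *: (U i k + E i k)) z = \sum_(k < 2 ^ phi i) p i k * dot (U i k +
    E i k) z.
    by rewrite dot_suml; apply: eq_bigr => k _; rewrite dotZl.
  rewrite -[leRHS]mul1r -(psum i) mulr_suml; apply: ler_sum => k _.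
  have [->|pk] := eqVneq (p i k) 0; first by rewrite !mul0r.
  apply: ler_wpM2l => //; rewrite dotDl.
  have [h2 [_ h3]] := active i k ii (ltn_ord k) pk.
  have h4 := le_trans (ler_norm _) (normr_dot_le (E i k) z).
  have h5 : enorm (E i k) * enorm z <= K1 * h * enorm z by rewrite ler_wpM2r ?enorm_ge0.
  have h6 : 0 <= K1 * h by rewrite mulr_ge0// ltW.
  move: hK; rewrite /K3; lra.
have [C [i1 [C0 _ HD _ _]]] := limit_rate cauchy_off w.
have close i : (i1 <= i)%N -> enorm (V - Vi i) <= enorm (iB t) * (t - s)^-1 * 2 * C * 2 ^- i.
  move=> ii; have Dt := HD i t ii; have Ds := HD i s ii.
  move: Dt Ds; rewrite /driftN memNset// !clipK// => Dt Ds.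
  rewrite /V /Vi -mulmxBr opprD addrACA subrr addr0 -scalerBr.
  apply: le_trans (ler_enorm_mul _ _) _; rewrite -!mulrA; apply: ler_wpM2l; first exact: enorm_ge0.
  rewrite enormZ ger0_norm ?invr_ge0 ?(ltW ts0)//; apply: ler_wpM2l; first by rewrite invr_ge0 ltW.
  have -> : G t w - G s w - (drift (phi i) t w - drift (phi i) s w) =
     (drift (phi i) s w - G s w) - (drift (phi i) t w - G t w).
    by apply/colP => l; rewrite !mxE; ring.
  apply: le_trans (ler_enormB _ _) _.
  have -> : 2 * (C * 2 ^- i) = C * 2 ^- i + C * 2 ^- i by rewrite mulr_natl mulr2n.
  exact: (lerD Ds Dt).
have CC0 : 0 <= enorm (iB t) * (t - s)^-1 * 2 * C.
  by rewrite !mulr_ge0 ?enorm_ge0 ?invr_ge0// ltW.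
split.
  apply: (le_pow2N (i0 := maxn i0 i1) CC0) => i; rewrite geq_max => /andP[ii0 ii1].
  rewrite -(subrK (Vi i) V) addrC; apply: le_trans (ler_enormD _ _) _.
  by apply: lerD; [case: (bounds i ii0)|exact: close].
apply: (@le_pow2N _ _ _ (enorm (iB t) * (t - s)^-1 * 2 * C * enorm z) (maxn i0 i1)).
  by rewrite mulr_ge0 ?enorm_ge0.
move=> i; rewrite geq_max => /andP[ii0 ii1].
rewrite -(subrK (Vi i) V) addrC dotDl; apply: lerD; first by case: (bounds i ii0).
apply: le_trans (le_trans (ler_norm _) (normr_dot_le _ _)) _.
rewrite -mulrA [enorm z * _]mulrC mulrA ler_wpM2r ?enorm_ge0//; exact: close.
Qed.

Definition left_quotient k t w : 'cV[R]_n := k.+1%:R *: (G t w - G (t - k.+1%:R^-1) w).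
(** The left derivative wherever it exists. The quotients are bounded on each path, so the upper
    limit is real and measurable without any exceptional set, and it uses the path up to time [t]
    only. *)
Definition drift_slope t w : 'cV[R]_n := \col_l limn_sup (fun k => left_quotient k t w l 0).

(* Wherever the drift has the left derivative [g], the only control compatible
   with the equation is [iB *m (g + A *m X)]; it is kept when it satisfies the
   two inequalities that characterise the feedback law. *)
Definition feedback (Bt iBt At : 'M[R]_n) (Xt g : 'cV[R]_n) : 'cV[R]_n :=
  let c := iBt *m (g + At *m Xt) in
  let z := Bt^T *m (Xt - y) in
  if (enorm c <= rho) && (dot c z + rho * enorm z <= 0) then c else - rho *: sgv z.

Definition control t w : 'cV[R]_n := feedback (B t) (iB t) (A t) (X t w) (drift_slope t w).

(** Either the candidate passes the test or the fallback selects [sgv], which satisfies the same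
    inequalities. Nothing is assumed about [g], so the sign law holds at every time and for every
    [w]. *)
Lemma feedback_bounds Bt iBt At Xt g (z := Bt^T *m (Xt - y)) :
  enorm (feedback Bt iBt At Xt g) <= rho /\ dot (feedback Bt iBt At Xt g) z <= - rho * enorm z.
Proof.
have rho0 := gain_gt0 S; rewrite /feedback -/z; case: ifPn => [/andP[-> h]|_].
  by split => //; move: h; lra.
split; last by rewrite dotZl dot_sgv.
by rewrite enormZ normrN gtr0_norm// ler_piMr ?(ltW rho0)// enorm_sgv.
Qed.

(** Taking s = t - 1/(k+1) in [near_controls] and then letting [e] tend to 0, both inequalities pass
    to the candidate. The test in [feedback] therefore succeeds, and multiplication by [B t] returns
    the equation. *)
Lemma control_state w t : ~ N w -> 0 < t <= T ->
  (forall l, cvgn (fun k => left_quotient k t w l 0)) ->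
  B t *m control t w = drift_slope t w + A t *m X t w.
Proof.
move=> Nw tT qc; have /andP[t0 _] := tT; have rho0 := gain_gt0 S.
set c := iB t *m (drift_slope t w + A t *m X t w); set z := gap t w.
suff [h1 h2] : enorm c <= rho /\ dot c z <= - rho * enorm z.
  rewrite /control /feedback -/z -/c h1 (_ : _ <= 0); last by move: h2; lra.
  by rewrite /= mulKVmx// matB_unit.
have z0 := enorm_ge0 z.
have main e : 0 < e -> enorm c <= rho + e + e /\ dot c z <= - rho * enorm z + e + e * enorm z.
  move=> e0; have [r r0 Hr] := near_controls Nw tT e0.
  pose I := enorm (iB t) + 1; have I0 : 0 < I by rewrite ltr_wpDl ?enorm_ge0.
  have eI : 0 < e / I by rewrite divr_gt0.
  have dc : (fun k => \sum_l `|left_quotient k t w l 0 - drift_slope t w l 0|) @ \oo --> 0.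
    apply: cvg_sum0 => l; rewrite mxE cvg_limn_supE//; apply/norm_cvg0P.
    rewrite -[X in _ --> X](subrr (limn (fun k => left_quotient k t w l 0))).
    by apply: cvgB; [exact: qc|exact: cvg_cst].
  have /cvgrPdist_le/(_ _ eI) [k1 _ Hk1] := dc.
  have m0 : 0 < Num.min r t by rewrite lt_min r0.
  have [k2 _ Hk2] := near_infty_natSinv_lt (PosNum m0).
  pose k := maxn k1 k2; have kr := Hk2 k (leq_maxr _ _).
  move: kr; rewrite /= lt_min => /andP[kr kt].
  have k0 : 0 < k.+1%:R^-1 :> R by rewrite invr_gt0.
  have s0 : 0 <= t - k.+1%:R^-1 by rewrite subr_ge0 ltW.
  have rs : t - r < t - k.+1%:R^-1 by rewrite ltrD2l ltrN2.
  have st : t - k.+1%:R^-1 < t by rewrite gtrBl.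
  have tk : t - (t - k.+1%:R^-1) = k.+1%:R^-1 by rewrite opprB addrC subrK.
  have := Hr _ s0 rs st; rewrite /= tk invrK -/(left_quotient k t w).
  set V := iB t *m _; rewrite -/z => -[V1 V2].
  have cV : enorm (c - V) <= e.
    rewrite /c /V -mulmxBr opprD addrACA subrr addr0.
    apply: le_trans (ler_enorm_mul _ _) _.
    have h : enorm (drift_slope t w - left_quotient k t w) <= e / I.
      rewrite enormBC; apply: le_trans (ler_enorm_sum_entry _) _.
      have := Hk1 k (leq_maxl _ _); rewrite sub0r normrN => /(le_trans (ler_norm _)).
      apply: le_trans; apply: ler_sum => l _.
      by rewrite [in leLHS]mxE [in leLHS](mxE _ (- _)).
    apply: (@le_trans _ _ (I * (e / I))); last by rewrite mulrC divfK// gt_eqF.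
    by apply: ler_pM; rewrite ?enorm_ge0// lerDl.
  have cE : c = V + (c - V) by rewrite addrC subrK.
  split; rewrite cE; first by apply: le_trans (ler_enormD _ _) _; exact: lerD.
  rewrite dotDl; apply: lerD => //.
  apply: le_trans (le_trans (ler_norm _) (normr_dot_le _ _)) _.
  by rewrite ler_wpM2r.
split; apply/ler_addgt0Pr => e e0.
  have e2 : 0 < e / 2 by rewrite divr_gt0.
  by have [h _] := main _ e2; apply: le_trans h _; rewrite -addrA -splitr.
have e2 : 0 < e / (1 + enorm z) by rewrite divr_gt0// ltr_pwDl.
have [_ h] := main _ e2; apply: (le_trans h); rewrite -addrA lerD2l -[X in X + _]mulr1 -mulrDr.
by rewrite divfK// gt_eqF// ltr_pwDl.
Qed.

End feedback.

Lemma sign_inclusion {R : realType} n (rho : R) (v z : 'cV[R]_n) : 0 < rho ->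
  enorm v <= rho -> dot v z <= - rho * enorm z ->
  [set - rho *: theta | theta in sign_map z] v.
Proof.
move=> rho0 h1 h2; rewrite /sign_map; have [z0|z0] := eqVneq z 0.
  exists (- rho^-1 *: v); last by rewrite scalerA mulrNN divff ?scale1r// gt_eqF.
  by rewrite /= enormZ normrN gtr0_norm ?invr_gt0// mulrC ler_pdivrMr// mul1r.
exists ((enorm z)^-1 *: z) => //.
have z1 : 0 < enorm z by rewrite lt_def enorm_ge0 enorm_eq0 z0.
(* Equality case of the Cauchy-Schwarz inequality. *)
suff : enorm (v + rho *: ((enorm z)^-1 *: z)) = 0.
  by move/eqP; rewrite enorm_eq0 addr_eq0 scaleNr => /eqP ->.
apply/eqP; rewrite -sqrf_eq0 eq_le sqr_ge0 andbT enormD_sqr dotC !dotZl (dotC z v).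
rewrite !enormZ [`|(enorm z)^-1|]gtr0_norm ?invr_gt0// mulVf ?gt_eqF// mulr1 gtr0_norm//.
have h3 : enorm v ^+ 2 <= rho ^+ 2 by rewrite ler_pXn2r ?nnegrE ?enorm_ge0// ltW.
have h4 : rho * ((enorm z)^-1 * dot v z) <= - rho ^+ 2.
  rewrite expr2 -mulrN ler_pM2l// mulrC ler_pdivrMr//.
by lra.
Qed.

(** * Measurability of the control *)

Section control_measurability.
Context {R : realType} {dT : measure_display} {T0 : measurableType dT}.
Variables (n d : nat) (S : setting R n d) (C : set (set T0)).

Lemma wrt_le_set (f g : T0 -> R) : wrt <<s C>> f -> wrt <<s C>> g ->
  <<s C>> [set p | f p <= g p].
Proof.
move=> wf wg; have := wrtB wf wg => /(_ `]-oo, 0]%classic (measurable_itv _)).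
congr (<<s C>> _); apply/seteqP; split => p /=; rewrite in_itv/= subr_le0//.
Qed.

Lemma wrt_prod (I : Type) (r : seq I) (f : I -> T0 -> R) : (forall i, wrt <<s C>> (f i)) ->
  wrt <<s C>> (fun p => \prod_(i <- r) f i p).
Proof.
move=> wf; elim: r => [|i r ih].
  by under eq_fun do rewrite big_nil; exact: wrt_cst.
by under eq_fun do rewrite big_cons; exact: wrtM.
Qed.

Lemma wrt_det m (M : T0 -> 'M[R]_m) : wrtm C M -> wrt <<s C>> (fun p => \det (M p)).
Proof.
move=> wM; apply: wrt_sum => s; apply: wrtM; first exact: wrt_cst.
by apply: wrt_prod => i; exact: wM.
Qed.

(** Cramer's rule: the inverse is built from determinants, which are polynomials in the entries, and
    one division. *)
Lemma wrtm_invmx m (M : T0 -> 'M[R]_m) : (forall p, M p \in unitmx) -> wrtm C M ->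
  wrtm C (fun p => invmx (M p)).
Proof.
move=> uM wM.
have -> : (fun p => invmx (M p)) = (fun p => (\det (M p))^-1 *: \adj (M p)).
  by apply/funext => p; rewrite /invmx uM.
apply: wrtmZ; first exact: wrt_comp measurable_inv (wrt_det wM).
move=> i j; apply: (@eq_wrt _ _ _ _ (fun p => (-1) ^+ (j + i) * \det (row' j (col' i (M p))))).
  by move=> p; rewrite mxE.
apply: wrtM; first exact: wrt_cst.
by apply: wrt_det => k l; apply: eq_wrt (wM (lift j k) (lift i l)) => p; rewrite !mxE.
Qed.

Lemma feedback_wrt (Bf iBf Af : T0 -> 'M[R]_n) (Xf gf : T0 -> 'cV[R]_n) :
  wrtm C Bf -> wrtm C iBf -> wrtm C Af -> wrtm C Xf -> wrtm C gf ->
  wrtm C (fun p => feedback S (Bf p) (iBf p) (Af p) (Xf p) (gf p)).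
Proof.
move=> wB wiB wA wX wg.
pose c p := iBf p *m (gf p + Af p *m Xf p).
pose z p := (Bf p)^T *m (Xf p - target S).
have wc : wrtm C c by apply: wrtm_mul => //; apply: wrtmD => //; exact: wrtm_mul.
have wz : wrtm C z.
  apply: wrtm_mul; last by apply: wrtmB => //; exact: wrtm_cst.
  by move=> i j; apply: eq_wrt (wB j i) => p; rewrite mxE.
have wcz : wrt <<s C>> (fun p => dot (c p) (z p) + gain S * enorm (z p)).
  apply: wrtD; last by apply: wrtM; [exact: wrt_cst|exact: wrt_enorm].
  by apply: wrt_sum => i; apply: wrtM; [exact: wc|exact: wz].
pose Q := [set p | enorm (c p) <= gain S] `&` [set p | dot (c p) (z p) + gain S * enorm (z p) <= 0].
have CQ : <<s C>> Q.
  have H1 := wrt_le_set (wrt_enorm wc) (@wrt_cst _ _ _ C (gain S)).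
  have H2 := wrt_le_set wcz (@wrt_cst _ _ _ C 0).
  exact: (@measurableI _ (g_sigma_algebraType C) _ _ H1 H2).
have wn : wrtm C (fun p => - gain S *: sgv (z p)) by apply: wrtmZ; [exact: wrt_cst|exact: wrtm_sgv].
move=> i j.
have E : (fun p => if p \in Q then c p i j else (- gain S *: sgv (z p)) i j) =1
   (fun p => feedback S (Bf p) (iBf p) (Af p) (Xf p) (gf p) i j).
  move=> p; rewrite /feedback -/(c p) -/(z p) (_ : (p \in Q) = (enorm (c p) <= gain S) && (dot (c p) (z p) +
    gain S * enorm (z p) <= 0)).
    by case: ifP.
  by apply/idP/idP => [/set_mem[/= -> ->]//|/andP[h1 h2]]; apply: mem_set.
exact: eq_wrt E (wrt_if CQ (wc i j) (wn i j)).
Qed.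
End control_measurability.

Section joint.
Context {R : realType} {dO : measure_display} {Omega : measurableType dO}.

(* Freezing time at the dyadic floor gives measurable functions that converge pointwise. *)
Lemma joint_measurable (Y : R -> Omega -> R) : (forall t, measurable_fun setT (Y t)) ->
  (forall w, continuous (Y ^~ w)) ->
  measurable_fun setT (fun p : R * Omega => Y p.1 p.2).
Proof.
move=> mY cY.
pose g (m : nat) (s : R) : R := (Num.floor (s * 2 ^+ m))%:~R * 2 ^- m.
pose Ym m (p : R * Omega) := Y (g m p.1) p.2.
apply: (@measurable_fun_cvg _ _ _ _ Ym).
  move=> m _ U mU; rewrite setTI.
  have -> : Ym m @^-1` U = \bigcup_(z : int)
     ([set s : R | Num.floor (s * 2 ^+ m) = z] `*` (Y (z%:~R * 2 ^- m) @^-1` U)).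
    apply/seteqP; split => [[s w] /= H|[s w] [z _ [/= sz H]]]; first by exists (Num.floor (s * 2 ^+ m)).
    by rewrite /Ym /g /= sz.
  apply: countable_bigcupT_measurable => [|z]; first exact: countableP.
  apply: measurableX; last first.
    by rewrite -[X in measurable X]setTI; exact: mY.
  have m2 : 0 < 2 ^+ m :> R by rewrite exprn_gt0.
  rewrite (_ : [set s | _] = `[z%:~R / 2 ^+ m, (z + 1)%:~R / 2 ^+ m[%classic).
    exact: measurable_itv.
  apply/seteqP; split => s /=; rewrite in_itv/= ler_pdivrMr// ltr_pdivlMr//.
    by move=> <-; have := floor_itv (s * 2 ^+ m).
  by move/floor_def.
move=> p _; apply/cvgrPdist_le => e e0.
have /cvgrPdist_le/(_ e e0) [r /= r0 Hr] := cY p.2 p.1.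
have [m0 Hm0] := pow2N_le (ler01 : (0 : R) <= 1) (divr_gt0 r0 (ltr0n _ 2)).
exists m0 => // m mm; apply: Hr; rewrite /= /g.
have m2 : 0 < 2 ^+ m :> R by rewrite exprn_gt0.
have /andP[h1 h2] := floor_itv (p.1 * 2 ^+ m).
have E : p.1 = p.1 * 2 ^+ m * 2 ^- m by rewrite mulfK// gt_eqF.
rewrite {1}E -mulrBl ger0_norm; last by rewrite mulr_ge0 ?invr_ge0 ?(ltW m2)// subr_ge0.
apply: le_lt_trans (_ : 1 * 2 ^- m < r).
  rewrite ler_pM2r ?invr_gt0// lerBlDl addrC; move: h2; rewrite intrD => /ltW.
  by rewrite addrC.
by apply: le_lt_trans (Hm0 m mm) _; rewrite ltr_pdivrMr// ltr_pMr// ltr1n.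
Qed.

Lemma wrt_limn_sup (C : set (set Omega)) (h : nat -> Omega -> R) :
  (forall k, wrt <<s C>> (h k)) -> (forall w, exists M, forall k, `|h k w| <= M) ->
  wrt <<s C>> (fun w => limn_sup (fun k => h k w)).
Proof.
move=> wh bh; apply/wrtP; apply: (@measurable_fun_limn_sup _ (g_sigma_algebraType C)).
- by move=> w _; have [M HM] := bh w; exists M => _ [k _ <-]; exact: le_trans (ler_norm _) (HM k).
- move=> w _; have [M HM] := bh w; exists (- M) => _ [k _ <-].
  by have := HM k; rewrite ler_norml => /andP[].
- by move=> k; exact/wrtP.
Qed.
End joint.

(** With the full sigma-algebra as generator, the calculus developed for the filtration also proves
    joint measurability in time and [w]. *)
Lemma wrt_all {R : realType} {d : measure_display} {T0 : measurableType d} (f : T0 -> R) :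
  measurable_fun setT f <-> wrt <<s @measurable d T0>> f.
Proof.
split=> [mf U mU|wf].
  by apply: sub_sigma_algebra; rewrite -[X in measurable X]setTI; exact: mf.
apply: wrt_measurable wf; apply: smallest_sub; first exact: sigma_algebra_measurable.
by [].
Qed.

Section control_process.
Context {R : realType} {dO : measure_display} {Omega : measurableType dO}.
Variables (P : probability Omega R) (n d : nat) (beta : 'I_d -> R -> Omega -> R).
Variable S : setting R n d.
Local Notation T := (horizon S).
Let hT : 0 < T := horizon_gt0 S.
Local Notation gen := (filtration_gen P beta).
Variables (phi : nat -> nat) (N : set Omega).
Hypothesis cauchy_off : forall w, ~ N w -> uniformly_cauchy beta S phi w.
Hypothesis hbeta : independent_brownian_motions P beta.
Hypotheses (mN : measurable N) (PN : P N = 0%E).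
Local Notation X := (limX beta S phi N).
Local Notation G := (limD beta S phi N).
Local Notation lq := (left_quotient beta S phi N).
Local Notation drift_slope := (drift_slope beta S phi N).
Local Notation control := (control beta S phi N).

Lemma modulus_continuous (M : R -> 'M[R]_n) i j :
  (forall m s t, `|s - t| <= step T m -> enorm (M s - M t) <= modulus S m) ->
  continuous (fun t => M t i j).
Proof.
move=> HM t; apply/cvgrPdist_le => e e0.
have /cvgrPdist_le/(_ e e0) [m _ Hm] := modulus_cvg0 S.
exists (step T m) => /=; first exact: step_gt0.
move=> s /= ts; have := Hm m (leqnn _); rewrite /= sub0r normrN => /(le_trans (ler_norm _)).
apply: le_trans; apply: le_trans (HM m t s (ltW ts)).
by have := ler_enorm_entry (M t - M s) i j; rewrite !mxE.
Qed.

Lemma left_quotient_bounded w : exists M, forall k t l, `|lq k t w l 0| <= M.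
Proof.
have [C [_ [C0 _ _ _ HL]]] := limit_rate cauchy_off w; exists C => k t l.
rewrite mxE normrM ger0_norm//.
have k0 : (0 : R) < k.+1%:R by [].
apply: (@le_trans _ _ (k.+1%:R * enorm (G t w - G (t - k.+1%:R^-1) w))).
  by rewrite ler_pM2l//; exact: ler_enorm_entry.
rewrite mulrC -ler_pdivlMr//; apply: le_trans (HL _ _) _.
by rewrite opprB addrC subrK ger0_norm.
Qed.

(** The quotients evaluate the drift at times up to [t]; a negative time t - 1/(k+1) is clipped to
    0, which is still at most [t]. *)
Lemma control_wrt t : 0 <= t -> wrtm (gen t) (control t).
Proof.
move=> t0.
have wG s : s <= t -> wrtm (gen t) (G s).
  by move=> st; apply: wrtm_le (clip_mono T st t0) _;
    exact: (@limD_wrt _ _ _ _ _ _ _ _ _ _ cauchy_off hbeta mN PN).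
apply: feedback_wrt; try exact: wrtm_cst.
  by apply: wrtm_le (clip_mono T (lexx t) t0) _; exact: (@limX_wrt _ _ _ _ _ _ _ _ _ _ cauchy_off hbeta mN PN).
move=> l k; have [M HM] := choice left_quotient_bounded.
have W : wrt <<s gen t>> (fun w => limn_sup (fun k => lq k t w l 0)).
  apply: wrt_limn_sup => [i|w]; last by exists (M w) => i; exact: HM.
  have ti : t - i.+1%:R^-1 <= t by rewrite gerBl.
  have E : (fun w => i.+1%:R * (G t w l 0 - G (t - i.+1%:R^-1) w l 0)) =1 (fun w => lq i t w l 0).
    by move=> w; rewrite [RHS]mxE; congr (_ * _); rewrite [RHS]mxE; congr +%R; rewrite [RHS]mxE.
  apply: eq_wrt E _; apply: wrtM; first exact: wrt_cst.
  by apply: wrtB; [exact: wG (lexx t) l 0|exact: wG ti l 0].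
by apply: eq_wrt W => w; rewrite mxE.
Qed.

Lemma limX_joint l : measurable_fun setT (fun p : R * Omega => X p.1 p.2 l 0).
Proof.
apply: (joint_measurable (Y := fun t w => X t w l 0)) => [t|w];
  last exact: (@limX_continuous _ _ _ _ _ _ _ _ _ cauchy_off l w).
apply: (wrt_measurable _ (@limX_wrt _ _ _ _ _ _ _ _ _ _ cauchy_off hbeta mN PN t l 0)).
exact: augmented_filtration_measurable.
Qed.

Lemma limD_joint c l : measurable_fun setT (fun p : R * Omega => G (p.1 - c) p.2 l 0).
Proof.
apply: (joint_measurable (Y := fun t w => G (t - c) w l 0)) => [t|w].
  apply: (wrt_measurable _ (@limD_wrt _ _ _ _ _ _ _ _ _ _ cauchy_off hbeta mN PN (t - c) l 0)).
  exact: augmented_filtration_measurable.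
move=> t; apply: (@continuous_comp _ _ _ (fun t => t - c) (fun t => G t w l 0)).
  by apply: cvgB; [exact: cvg_id|exact: cvg_cst].
exact: (@limD_continuous _ _ _ _ _ _ _ _ _ cauchy_off l w).
Qed.

Lemma control_joint l : measurable_fun setT (fun p : R * Omega => control p.1 p.2 l 0).
Proof.
apply/wrt_all.
have wmat (M : R -> 'M[R]_n) : (forall m s t, `|s - t| <= step T m -> enorm (M s - M t) <= modulus S m) ->
    wrtm measurable (fun p : R * Omega => M p.1).
  move=> HM i j; apply/wrt_all; apply: (@measurableT_comp _ _ _ _ _ _ (fun t => M t i j)) => //.
  by apply: continuous_measurable_fun; exact: modulus_continuous HM.
have wB := wmat _ (@matB_modulus _ _ _ S); have wA := wmat _ (@matA_modulus _ _ _ S).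
suff : wrtm measurable (fun p : R * Omega => control p.1 p.2) by exact.
apply: feedback_wrt => //.
- by apply: wrtm_invmx => // p; exact: matB_unit.
- by move=> i j; rewrite ord1; apply/wrt_all; exact: limX_joint.
move=> i k; have [M HM] := choice left_quotient_bounded.
have W : wrt <<s measurable>> (fun p : R * Omega => limn_sup (fun k => lq k p.1 p.2 i 0)).
  apply: wrt_limn_sup => [m|p]; last by exists (M p.2) => m; exact: HM.
  have E : (fun p : R * Omega => m.+1%:R * (G (p.1 - 0) p.2 i 0 - G (p.1 - m.+1%:R^-1) p.2 i 0)) =1 (fun p =>
    lq m p.1 p.2 i 0).
    by move=> p; rewrite subr0 [RHS]mxE; congr (_ * _); rewrite [RHS]mxE; congr +%R; rewrite [RHS]mxE.
  apply: eq_wrt E _; apply: wrtM; first exact: wrt_cst.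
  by apply: wrtB; apply/wrt_all; exact: limD_joint.
by apply: eq_wrt W => p; rewrite mxE.
Qed.

End control_process.

(** * Ito integrals *)

Section integral_bounds.
Context {R : realType} {dO : measure_display} {Omega : measurableType dO}.
Variable P : probability Omega R.
Local Notation leb := (@lebesgue_measure R).
Local Notation Ex f := (Rintegral P setT f).

(** Tonelli's theorem after dropping the endpoint 0. The bound is asked for [s > 0] only, because a
    simple process vanishes at time 0 and approximates nothing there. *)
Lemma double_integral_le (g : R * Omega -> R) (t c : R) : 0 <= t -> 0 <= c ->
  measurable_fun setT g ->
  (forall s, 0 < s <= t -> (\int[P]_w (g (s, w) ^+ 2)%:E <= c%:E)%E) ->
  (\int[P]_w \int[leb]_(s in `[0%R, t]) (g (s, w) ^+ 2)%:E <= (c * t)%:E)%E.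
Proof.
move=> t0 c0 mg gc.
pose I : set (measurableTypeR R) := `]0, t]%classic.
have mI : measurable I by exact: measurable_itv.
pose f (z : Omega * measurableTypeR R) : \bar R := (g (z.2, z.1) ^+ 2 * \1_I z.2)%:E.
have mg' : measurable_fun setT (fun z : Omega * measurableTypeR R => g (z.2, z.1)).
  apply: (measurableT_comp mg).
  by apply: measurable_fun_pair; [exact: measurable_snd|exact: measurable_fst].
have mf : measurable_fun setT f.
  apply/measurable_EFinP; apply: measurable_funM; first exact: measurable_funX.
  apply: (measurableT_comp (f := \1_I : measurableTypeR R -> R)); last exact: measurable_snd.
  exact: measurable_indic.
have f0 z : (0 <= f z)%E.
  by rewrite lee_fin mulr_ge0 ?sqr_ge0// indicE.
rewrite (_ : (\int[P]_w _)%E = \int[P]_w \int[leb]_s f (w, s))%E; last first.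
  apply: eq_integral => w _; rewrite -integral_itv_obnd_cbnd; last first.
    apply/measurable_EFinP/measurable_funTS/measurable_funX.
    by apply: (measurableT_comp mg); exact: measurable_pair2.
  rewrite integral_mkcond; apply: eq_integral => s _; rewrite /f patchE indicE /=.
  by rewrite -/I; case: ifP => _; rewrite ?mulr1 ?mulr0.
rewrite (@fubini_tonelli _ _ _ _ _ P leb f)//.
apply: (@le_trans _ _ (\int[leb]_s (c * \1_I s)%:E)%E).
  apply: ge0_le_integral => //.
  - by move=> s _; apply: integral_ge0 => w _.
  - exact: measurable_fun_fubini_tonelli_G.
  - by apply/measurable_EFinP; apply: measurable_funM => //; exact: measurable_indic.
  move=> s _; rewrite /f /= indicE; case: (boolP (s \in I)) => sI.
    rewrite mulr1; under eq_integral do rewrite mulr1.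
    by apply: gc; move: sI; rewrite inE /I/= in_itv.
  by rewrite mulr0; under eq_integral do rewrite mulr0; rewrite integral0.
rewrite (_ : (fun s => _) = fun s => (c%:E * (\1_I s)%:E)%E); last by apply/funext.
rewrite ge0_integralZl//; last exact/measurable_EFinP/measurable_indic.
rewrite integral_indic// setIT; have := lebesgue_measure_itv (`]0, t] : interval R).
rewrite /= lte_fin => ->; case: ifP => _; last by rewrite mule0 lee_fin mulr_ge0.
by rewrite sube0 -EFinM.
Qed.

Definition truncate (L v : R) : R := Num.max (- L) (Num.min v L).

Lemma truncate_norm L v : 0 <= L -> `|truncate L v| <= L.
Proof.
by move=> L0; rewrite /truncate ler_norml le_max lexx/= ge_max ge_min lexx orbT andbT; lra.
Qed.

Lemma truncate_id L v : `|v| <= L -> truncate L v = v.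
Proof. by rewrite ler_norml => /andP[h1 h2]; rewrite /truncate (min_l h2) (max_r h1). Qed.

Lemma truncate_dist L v : 0 <= L -> `|v - truncate L v| <= `|v|.
Proof.
move=> L0; rewrite /truncate; case: (leP v L) => h1.
  case: (leP (- L) v) => h2; first by rewrite subrr normr0.
  by rewrite !ler0_norm; lra.
by rewrite max_r ?ger0_norm; lra.
Qed.

Lemma measurable_truncate L : measurable_fun setT (truncate L).
Proof. by apply: measurable_maxr => //; exact: measurable_minr. Qed.

(* Fatou's lemma bounds the integral of [zeta ^+ 2] by the limit of those of
   [zeta ^+ 2 - (zeta - truncate k zeta) ^+ 2], so the defect cannot stay above [e]. *)
Lemma truncate_approx (zeta : Omega -> R) e : L2 P zeta -> 0 < e ->
  exists2 L, 0 <= L & L2 P (fun w => truncate L (zeta w) - zeta w) /\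
    Ex (fun w => (truncate L (zeta w) - zeta w) ^+ 2) <= e.
Proof.
move=> Lz e0; have mz := L2_measurable Lz.
have LT L : 0 <= L -> L2 P (fun w => truncate L (zeta w) - zeta w).
  move=> L0; apply: (L2_le _ _ Lz); last by move=> w; rewrite distrC truncate_dist.
  by apply: measurable_funB => //; apply: measurableT_comp mz; exact: measurable_truncate.
apply: contrapT => H.
have He (k : nat) : e <= Ex (fun w => (truncate k%:R (zeta w) - zeta w) ^+ 2).
  rewrite leNgt; apply/negP => h; apply: H; exists k%:R => //.
  by split; [exact: LT|exact: ltW].
pose f (k : nat) w := zeta w ^+ 2 - (truncate k%:R (zeta w) - zeta w) ^+ 2.
have L1f k : L1 P (f k) by apply: L1B; apply: L2_sqr => //; exact: LT.
have f0 k w : 0 <= f k w.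
  rewrite subr_ge0 -real_normK ?num_real// -[leRHS]real_normK ?num_real//.
  by rewrite ler_pXn2r ?nnegrE// distrC truncate_dist.
have cv w : ~ (set0 : set Omega) w -> f ^~ w @ \oo --> zeta w ^+ 2.
  move=> _; apply: cvg_near_cst; near=> k; rewrite /f truncate_id ?subrr ?expr0n ?subr0//.
  by near: k; exact: nbhs_infty_ger.
have fc k : Ex (f k) <= Ex (fun w => zeta w ^+ 2) - e.
  by rewrite /f ExB ?lerB//; [exact: L2_sqr|exact: L2_sqr (LT _ _)].
have [_] := Ex_fatou L1f f0 (measurable_funX 2 mz) (fun w => sqr_ge0 _) measurable0 (measure0 P) cv fc.
lra.
Unshelve. all: by end_near. Qed.
End integral_bounds.

Section ito.
Context {R : realType} {dO : measure_display} {Omega : measurableType dO}.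
Variables (P : probability Omega R) (n d : nat) (beta : 'I_d -> R -> Omega -> R).
Variable S : setting R n d.
Local Notation T := (horizon S).
Local Notation sigma := (noise S).
Local Notation L := (lipC S).
Let hT : 0 < T := horizon_gt0 S.
Local Notation tm := (tm T).
Local Notation step := (step T).
Local Notation euler := (euler beta S).
Local Notation mart := (mart beta S).
Local Notation interp := (interp beta S).
Local Notation incr := (incr beta).
Local Notation F := (augmented_filtration P beta).
Local Notation gen := (filtration_gen P beta).
Local Notation Ex f := (Rintegral P setT f).
Variables (phi : nat -> nat) (N : set Omega).
Hypothesis cauchy_off : forall w, ~ N w -> uniformly_cauchy beta S phi w.
Hypothesis hbeta : independent_brownian_motions P beta.
Hypotheses (mN : measurable N) (PN : P N = 0%E).
Hypothesis phi_nd : forall i, (phi i <= phi i.+1)%N.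
Hypothesis phi_ge : forall i, (i <= phi i)%N.
Local Notation X := (limX beta S phi N).

Lemma tm_cell_strict m t : 0 < t <= T ->
  exists2 c, (c < 2 ^ m)%N & tm m c < t <= tm m c.+1.
Proof.
move=> /andP[t0 tT].
have ex : exists k, (k < 2 ^ m)%N && (t <= tm m k.+1).
  by exists (2 ^ m).-1; rewrite prednK ?expn_gt0// leqnn tm_last tT.
case: (ex_minnP ex) => c /andP[c1 c2] cmin; exists c => //; rewrite c2 andbT.
case: c c1 c2 cmin => [|c] c1 c2 cmin; first by rewrite tm0.
rewrite ltNge; apply/negP => tc.
by have := cmin c; rewrite (ltnW c1) tc ltnn => /(_ isT).
Qed.

Lemma cvg_phi (u : nat -> R) : u @ \oo --> 0 -> (fun i => u (phi i)) @ \oo --> 0.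
Proof.
move=> u0; apply/cvgrPdist_le => e e0; have /cvgrPdist_le/(_ e e0) [i0 _ H] := u0.
by exists i0 => // i ii; apply: H; exact: leq_trans ii (phi_ge i).
Qed.

Variables (p : 'I_n) (q : 'I_d).

Let zeta i k w := sigma (euler (phi i) k w) p q.
Let zeta_wrt i k : wrt (F (tm (phi i) k)) (zeta i k) := wrtm_sigma S (euler_wrt hbeta S (phi i) k) p q.
Let zeta_L2 i k : L2 P (zeta i k) := L2m_sigma hbeta S (euler_wrt hbeta S (phi i) k) (euler_L2 hbeta S
  (phi i) k) p q.
Arguments zeta_wrt : clear implicits.
Arguments zeta_L2 : clear implicits.

(** Simple processes must take bounded values, while [sigma] at an Euler state is only square
    integrable; each coefficient is truncated at its own level, with an error that tends to 0 in
    [i]. *)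
Let level i k : exists M, 0 <= M /\ L2 P (fun w => truncate M (zeta i k w) - zeta i k w) /\
    Ex (fun w => (truncate M (zeta i k w) - zeta i k w) ^+ 2) <= 2 ^- i.
Proof.
have e0 : 0 < 2 ^- i :> R by rewrite invr_gt0 exprn_gt0.
by have [M M0 H] := truncate_approx (zeta_L2 i k) e0; exists M.
Qed.

Let M i k := sval (cid (level i k)).
Let val i k w := truncate (M i k) (zeta i k w).
Let val_spec i k : 0 <= M i k /\ L2 P (fun w => val i k w - zeta i k w) /\
    Ex (fun w => (val i k w - zeta i k w) ^+ 2) <= 2 ^- i.
Proof. exact: (svalP (cid (level i k))). Qed.

Let val_wrt i k : wrt (F (tm (phi i) k)) (val i k).
Proof. exact: wrt_comp (measurable_truncate (M i k)) (zeta_wrt i k). Qed.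
Arguments val_wrt : clear implicits.

Let val_bounded i k : exists K, forall w, `|val i k w| <= K.
Proof. by exists (M i k) => w; apply: truncate_norm; case: (val_spec i k). Qed.

Definition approximant i : simple_process F :=
  @SimpleProcess _ _ _ F (2 ^ phi i) (tm (phi i)) (val i) (tm_ge0 hT (phi i) 0)
    (fun k => (andP (tm_leS hT (phi i) k)).2) (val_wrt i) (val_bounded i).

Let eval_cell i c s w : (c < 2 ^ phi i)%N -> tm (phi i) c < s <= tm (phi i) c.+1 ->
  sp_eval (approximant i) s w = val i c w.
Proof.
move=> cN /andP[cs sc]; rewrite /sp_eval /= (bigD1 (Ordinal cN))//= big1 ?addr0.
  by rewrite indicE mem_set ?mulr1//= in_itv/= cs.
move=> k kc; rewrite indicE memNset ?mulr0//= in_itv/= => /andP[h1 h2].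
move: kc; rewrite -val_eqE/= neq_ltn => /orP[kc|ck].
  have := lt_le_trans cs h2; rewrite ltNge (tm_le hT) => /negP; apply; exact: kc.
by have := lt_le_trans h1 sc; rewrite ltNge (tm_le hT) ck.
Qed.

Let X_wrt s : wrtm (gen (clip T s)) (X s) := @limX_wrt _ _ _ _ _ _ _ _ _ _ cauchy_off hbeta mN PN s.
Arguments X_wrt : clear implicits.

(** Truncation, freezing of the state within a cell, and distance from the scheme to the limit; 3 is
    the constant for the square of a sum of three terms. *)
Let rate i := 3 * (2 ^- i + L ^+ 2 * (step (phi i) * increment_rate S) + L ^+ 2 * path_error S (phi i)).

Let rate_ge0 i : 0 <= rate i.
Proof.
have := sqr_ge0 L; have := increment_rate_ge0 S; have := step_gt0 hT (phi i).
have T0 : 0 <= (0 : R) <= T by rewrite lexx ltW.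
have [_] := limX_error cauchy_off hbeta mN PN phi_nd i T0; have := M2_ge0 P (fun w => interp (phi i) 0 w - X 0 w).
move=> h1 h2 h3 h4 h5; have h6 := le_trans h1 h2.
apply: mulr_ge0 => //; apply: addr_ge0; last exact: mulr_ge0.
apply: addr_ge0; first by rewrite invr_ge0 exprn_ge0.
by apply: mulr_ge0 => //; apply: mulr_ge0 => //; exact: ltW.
Qed.

Let rate_cvg0 : rate @ \oo --> 0.
Proof.
have h1 : (fun i : nat => 2 ^- i : R) @ \oo --> 0.
  by have := @pow2N_cvg0 R 1; under eq_fun do rewrite mul1r.
have h2 : (fun i : nat => L ^+ 2 * (step (phi i) * increment_rate S)) @ \oo --> 0.
  rewrite -(mulr0 (L ^+ 2)) -(mul0r (increment_rate S)); apply: cvgM; first exact: cvg_cst.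
  by apply: cvgM; [exact: cvg_phi (step_cvg0 T)|exact: cvg_cst].
have h3 : (fun i : nat => L ^+ 2 * path_error S (phi i)) @ \oo --> 0.
  by rewrite -(mulr0 (L ^+ 2)); apply: cvgM; [exact: cvg_cst|exact: cvg_phi (path_error_cvg0 S)].
by have := cvgM (cvg_cst (3 : R)) (cvgD (cvgD h1 h2) h3); rewrite !addr0 mulr0; exact.
Qed.

Let noise_error i s : 0 < s <= T ->
  L2 P (fun w => sp_eval (approximant i) s w - sigma (X s w) p q) /\
  Ex (fun w => (sp_eval (approximant i) s w - sigma (X s w) p q) ^+ 2) <= rate i.
Proof.
move=> sT'; have sT : 0 <= s <= T by case/andP: sT' => /ltW ->.
have [c cN cs] := tm_cell_strict (phi i) sT'.
have E w := eval_cell w cN cs.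
have [_ [V1 V2]] := val_spec i c.
have [wI LI] := interp_wrt_L2 hbeta S (phi i) sT.
have [LX HX] := limX_error cauchy_off hbeta mN PN phi_nd i sT.
have wX : wrtm (gen s) (X s) by have := X_wrt s; rewrite clipK.
pose f2 w := zeta i c w - sigma (interp (phi i) s w) p q.
pose f3 w := sigma (interp (phi i) s w) p q - sigma (X s w) p q.
have mI : measurable_fun setT (fun w => sigma (interp (phi i) s w) p q).
  apply: (wrt_measurable _ (wrtm_sigma S wI p q)); exact: augmented_filtration_measurable.
have mX : measurable_fun setT (fun w => sigma (X s w) p q).
  apply: (wrt_measurable _ (wrtm_sigma S wX p q)); exact: augmented_filtration_measurable.
have mz := L2_measurable (zeta_L2 i c).
have dom Z Z' : L2m P (fun w => Z w - Z' w : 'cV[R]_n) ->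
  measurable_fun setT (fun w => sigma (Z w) p q - sigma (Z' w) p q) ->
   L2 P (fun w => sigma (Z w) p q - sigma (Z' w) p q) /\
   Ex (fun w => (sigma (Z w) p q - sigma (Z' w) p q) ^+ 2) <= L ^+ 2 * M2 P (fun w => Z w - Z' w).
  move=> LZ mZ.
  have hb w : `|sigma (Z w) p q - sigma (Z' w) p q| <= L * enorm (Z w - Z' w).
    exact: (lipschitz_entry (@noise_lip _ _ _ S)).
  have LL : L2 P (fun w => sigma (Z w) p q - sigma (Z' w) p q).
    by apply: (L2_dominated (c0 := 0) (c1 := L) mZ LZ) => w; rewrite add0r.
  split => //; rewrite /M2 -ExZ; last exact: L2m_L1.
  apply: Ex_le; [exact: L2_sqr|exact/L1Z/L2m_L1|move=> w].
  rewrite -real_normK ?num_real// -exprMn ler_pXn2r ?nnegrE// mulr_ge0 ?enorm_ge0//.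
  exact: lipC_ge0.
have [L2' H2] : L2 P f2 /\ Ex (fun w => f2 w ^+ 2) <= L ^+ 2 * (step (phi i) * increment_rate S).
  have LE : L2m P (fun w => euler (phi i) c w - interp (phi i) s w) by exact: L2mB (euler_L2 hbeta S _ _) LI.
  have [h1 h2] := dom _ _ LE (measurable_funB mz mI).
  split => //; apply: (le_trans h2); apply: ler_wpM2l; first exact: sqr_ge0.
  case/andP: cs => cs sc.
  have h := interp_increment_M2 hbeta S cN (lexx _) (ltW cs) sc.
  rewrite [leLHS](_ : _ = M2 P (fun w => interp (phi i) s w - interp (phi i) (tm (phi i) c) w)).
    apply: (le_trans h); apply: ler_wpM2r; first exact: increment_rate_ge0.
    by move: sc; rewrite tmS lerBlDl.
  by apply: eq_Ex => w; rewrite enormBC interp_grid// ltnW.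
have [L3 H3] : L2 P f3 /\ Ex (fun w => f3 w ^+ 2) <= L ^+ 2 * path_error S (phi i).
  have [h1 h2] := dom _ _ LX (measurable_funB mI mX).
  by split => //; apply: (le_trans h2); apply: ler_wpM2l; first exact: sqr_ge0.
pose f1 w := val i c w - zeta i c w.
have Ef w : sp_eval (approximant i) s w - sigma (X s w) p q = f1 w + f2 w + f3 w.
  by rewrite E /f1 /f2 /f3; ring.
have LF : L2 P (fun w => f1 w + f2 w + f3 w) by apply: L2D => //; exact: L2D.
split; first by apply: eq_L2 LF => w; rewrite Ef.
rewrite (@eq_Ex _ _ _ P _ (fun w => (f1 w + f2 w + f3 w) ^+ 2)); last by move=> w; rewrite Ef.
have l1 := L2_sqr V1; have l2 := L2_sqr L2'; have l3 := L2_sqr L3.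
apply: (@le_trans _ _ (Ex (fun w => 3 * (f1 w ^+ 2 + f2 w ^+ 2 + f3 w ^+ 2)))).
  apply: Ex_le; [exact: L2_sqr|by apply: L1Z; apply: L1D => //; exact: L1D|move=> w].
  move: (f1 w) (f2 w) (f3 w) => u1 u2 u3.
  have := sqr_ge0 (u1 - u2); have := sqr_ge0 (u1 - u3); have := sqr_ge0 (u2 - u3).
  by rewrite !expr2; lra.
rewrite ExZ; last by apply: L1D => //; exact: L1D.
rewrite ExD//; last exact: L1D.
rewrite ExD//; apply: ler_wpM2l => //; apply: lerD => //; exact: lerD.
Qed.

(** The truncated Euler coefficients serve as the approximating simple processes. [noise_error],
    integrated over time, gives convergence of the integrands. *)
Lemma limM_ito t : 0 <= t <= T ->
  is_ito_integral P F (beta q) (fun s w => sigma (X s w) p q) t (limM beta S phi N p q t).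
Proof.
move=> tT; have /andP[t0 tT'] := tT.
split.
  apply: (wrt_measurable _ (@limM_wrt _ _ _ _ _ _ _ _ _ _ cauchy_off hbeta mN PN p q t)).
  exact: augmented_filtration_measurable.
exists approximant; split.
  have H i : (0 <= \int[P]_w \int[lebesgue_measure]_(s in `[0%R, t])
      ((sp_eval (approximant i) s w - sigma (X s w) p q) ^+ 2)%:E <= (rate i * t)%:E)%E.
    apply/andP; split; first by apply: integral_ge0 => w _; apply: integral_ge0 => s _; rewrite lee_fin sqr_ge0.
    apply: (@double_integral_le _ _ _ P (fun z : R * Omega =>
      sp_eval (approximant i) z.1 z.2 - sigma (X z.1 z.2) p q)) => //.
      apply: measurable_funB.
        rewrite /sp_eval; apply: measurable_sum => k; apply: measurable_funM.
          apply: (measurableT_comp (f := val i k)); last exact: measurable_snd.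
          apply: (wrt_measurable _ (val_wrt i k)); exact: augmented_filtration_measurable.
        apply: (measurableT_comp (f := \1_(`]tm (phi i) k, tm (phi i) k.+1]) : R -> R));
          last exact: measurable_fst.
        exact: measurable_indic.
      have wX : wrtm measurable (fun z : R * Omega => X z.1 z.2).
        move=> l k; rewrite ord1; apply/wrt_all; exact: (limX_joint cauchy_off hbeta mN PN).
      have wsX : wrtm measurable (fun z : R * Omega => sigma (X z.1 z.2)).
        by move: wX; apply: wrtm_lipschitz; exact: noise_lip.
      by apply/wrt_all; exact: (wsX p q).
    move=> s /andP[s0 st]; have sT : 0 < s <= T by rewrite s0 (le_trans st).
    have [h1 h2] := noise_error i sT; rewrite ExE ?lee_fin//; exact: L2_sqr.
  apply: (@squeeze_cvge _ _ _ _ (cst 0%E) _ (fun i => (rate i * t)%:E)).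
  - by near=> i; exact: H.
  - exact: cvg_cst.
  - rewrite (_ : 0%E = (0 * t)%:E); last by rewrite mul0r.
    by apply: cvg_EFin; [near=> i|apply: cvgM; [exact: rate_cvg0|exact: cvg_cst]].
(* The integrals differ from the limit in two ways: [D] is the effect of truncation, small by the
   isometry bound, and the martingale part of the scheme differs from its limit by [limM_error]. *)
pose D i w := sp_integral (approximant i) (beta q) t w - mart (phi i) p q t w.
have DE i w : D i w = \sum_(k < 2 ^ phi i) (val i k w - zeta i k w) *
   incr q (Num.min (tm (phi i) k) t) (Num.min (tm (phi i) k.+1) t) w.
  rewrite /D /sp_integral /mart /= -sumrB; apply: eq_bigr => k _.
  by rewrite mulrBl.
have HD i : L2 P (D i) /\ Ex (fun w => D i w ^+ 2) <= 8 * (T * 2 ^- i).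
  have [_ h2 h3] := sum_isometry_min hbeta q (K := 2 ^ phi i) (zeta := fun k w => val i k w - zeta i k w)
    (tm_leS hT (phi i)) t0 (fun k => wrtB (val_wrt i k) (zeta_wrt i k)) (fun k _ => (val_spec i k).2.1).
  split; first by apply: eq_L2 h2 => w; rewrite DE.
  rewrite (@eq_Ex _ _ _ P _ _ (fun w => congr1 (fun z => z ^+ 2) (DE i w))).
  apply: (le_trans h3); rewrite ler_wpM2l// -[leRHS](sum_gridM _ (phi i)).
  apply: ler_sum => k _; have kk := (andP (tm_leS hT (phi i) k)).2.
  apply: ler_pM; [| |by case: (leP (tm _ k.+1) t) => h4; case: (leP (tm _ k) t) => h5;
    lra|by case: (val_spec i k) => _ []].
  - by rewrite subr_ge0 le_min !ge_min kk lexx orbT.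
  - by apply: Ex_ge0 => w; exact: sqr_ge0.
have HM i := limM_error cauchy_off hbeta mN PN phi_nd i p q tT.
pose Z i w := sp_integral (approximant i) (beta q) t w - limM beta S phi N p q t w.
have ZE i w : Z i w = D i w + (mart (phi i) p q t w - limM beta S phi N p q t w).
  by rewrite /Z /D addrA subrK.
have LZ i : L2 P (Z i).
  apply: (@eq_L2 _ _ _ P (fun w => D i w + (mart (phi i) p q t w - limM beta S phi N p q t w))).
    by move=> w; rewrite ZE.
  by apply: L2D; [case: (HD i)|case: (HM i)].
apply: (Ex_sqr_cvg0P (r := fun i => 2 * (8 * (T * 2 ^- i)) + 2 * (8 * (T * noise_gap S (phi i)))) LZ).
  move=> i; have [d1 d2] := HD i; have [m1 m2] := HM i.
  pose Mi w := mart (phi i) p q t w - limM beta S phi N p q t w.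
  apply: (@le_trans _ _ (Ex (fun w => 2 * D i w ^+ 2 + 2 * Mi w ^+ 2))).
    apply: Ex_le; [exact: L2_sqr|by apply: L1D; apply: L1Z; exact: L2_sqr|move=> w].
    rewrite ZE -/(Mi w); have := sqr_ge0 (D i w - Mi w).
    by move: (D i w) (Mi w) => u v; rewrite !expr2; lra.
  rewrite ExD; [|exact/L1Z/L2_sqr..]; rewrite !ExZ; [|exact: L2_sqr..].
  by apply: lerD; apply: ler_wpM2l.
rewrite -(addr0 0); apply: cvgD.
  rewrite -[X in _ --> X](mulr0 2); apply: cvgM; first exact: cvg_cst.
  rewrite -[X in _ --> X](mulr0 8); apply: cvgM; [exact: cvg_cst|exact: pow2N_cvg0].
rewrite -[X in _ --> X](mulr0 2); apply: cvgM; first exact: cvg_cst.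
rewrite -[X in _ --> X](mulr0 8); apply: cvgM; first exact: cvg_cst.
rewrite -[X in _ --> X](mulr0 T); apply: cvgM; [exact: cvg_cst|exact: cvg_phi (noise_gap_cvg0 S)].
Unshelve. all: by end_near. Qed.

End ito.

(** * The equation and the hitting probability of the limit *)

Section drift_identity.
Context {R : realType} {dO : measure_display} {Omega : measurableType dO}.
Variables (P : probability Omega R) (n d : nat) (beta : 'I_d -> R -> Omega -> R).
Variable S : setting R n d.
Local Notation T := (horizon S).
Local Notation A := (matA S).
Local Notation B := (matB S).
Local Notation x := (start S).
Let hT : 0 < T := horizon_gt0 S.
Local Notation leb := lebesgue_measure.
Variables (phi : nat -> nat) (N : set Omega).
Hypothesis cauchy_off : forall w, ~ N w -> uniformly_cauchy beta S phi w.
Hypothesis hbeta : independent_brownian_motions P beta.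
Hypotheses (mN : measurable N) (PN : P N = 0%E).
Hypothesis phi_ge : forall i, (i <= phi i)%N.
Local Notation X := (limX beta S phi N).
Local Notation G := (limD beta S phi N).
Local Notation lq := (left_quotient beta S phi N).
Local Notation drift_slope := (drift_slope beta S phi N).
Local Notation control := (control beta S phi N).

Lemma limD_start w l : G 0 w l 0 = 0.
Proof.
rewrite mxE (_ : (fun _ => _) = fun=> 0) ?lim_cst//; apply/funext => i.
rewrite /driftN; case: ifP => _; first by rewrite mxE.
rewrite clipK ?lexx ?(ltW hT)// /drift big1 ?mxE// => k _.
by rewrite !min_r ?tm_ge0// subrr scale0r.
Qed.

Lemma matAX_continuous w l : continuous (fun s => (A s *m X s w) l 0).
Proof.
have -> : (fun s => (A s *m X s w) l 0) = fun s => \sum_k A s l k * X s w k 0.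
  by apply/funext => s; rewrite mxE.
apply: continuous_sum => k s; apply: cvgM.
  by apply: (@modulus_continuous _ _ _ _ A l k); exact: matA_modulus.
exact: (@limX_continuous _ _ _ _ _ _ _ _ _ cauchy_off k w).
Qed.

Lemma matBcontrol_measurable w l : measurable_fun setT (fun s => (B s *m control s w) l 0).
Proof.
have -> : (fun s => (B s *m control s w) l 0) = fun s => \sum_k B s l k * control s w k 0.
  by apply/funext => s; rewrite mxE.
apply: measurable_sum => k; apply: measurable_funM.
  apply: continuous_measurable_fun; apply: (@modulus_continuous _ _ _ _ B l k); exact: matB_modulus.
have H := @control_joint _ _ _ _ _ _ _ _ _ _ cauchy_off hbeta mN PN k.
exact: measurable_fun_pair1 w H.
Qed.

Lemma matBcontrol_integrable w t l :
  leb.-integrable `]0, t] (EFin \o fun s => (B s *m control s w) l 0).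
Proof.
apply: measurable_bounded_integrable.
- exact: measurable_itv.
- change (leb (`]0%R, t]%classic : set R) < +oo)%E; rewrite lebesgue_measure_itv/=.
  by case: ifP => _; rewrite ?ltry.
- by apply: measurable_funTS; exact: matBcontrol_measurable.
exists (boundB S * gain S); split; first exact: num_real.
move=> M HM s _; apply: le_trans (ltW HM); apply: le_trans (ler_enorm_entry _ _ _) _.
apply: le_trans (ler_enorm_mul _ _) _; apply: ler_pM; rewrite ?enorm_ge0 ?matB_le//.
by have [] := feedback_bounds S (B s) (invmx (B s)) (A s) (X s w) (drift_slope s w).
Qed.

(** On a fixed path the limit drift is Lipschitz, hence the integral of a density to which the left
    quotients converge almost everywhere. At such times [control_state] identifies [B *m u] with the
    density plus [A *m X]. *)
Lemma drift_identity w t l : ~ N w -> 0 <= t <= T ->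
  X t w l 0 + \int[leb]_(s in `[0, t]) (A s *m X s w) l 0 =
  x l 0 + \sum_q limM beta S phi N l q t w + \int[leb]_(s in `[0, t]) (B s *m control s w) l 0.
Proof.
move=> Nw tT; have /andP[t0 tT'] := tT.
have [C [_ [C0 _ _ _ HL]]] := limit_rate cauchy_off w.
have C1 : 0 < C + 1 by rewrite ltr_wpDl.
have GL k s s' : `|G s w k 0 - G s' w k 0| <= (C + 1) * `|s - s'|.
  apply: (@le_trans _ _ (C * `|s - s'|)); last by rewrite ler_wpM2r// lerDl.
  by apply: le_trans (HL s' s); have := ler_enorm_entry (G s w - G s' w) k 0; rewrite !mxE.
have [f Hf] := choice (fun k => lipschitz_derivative C1 hT (GL k)).
have [fint fE _] := Hf l.
have mt : measurable (`]0, t]%classic : set (measurableTypeR R)) by exact: measurable_itv.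
have AXi : leb.-integrable `[0, t] (EFin \o fun s => (A s *m X s w) l 0).
  apply: continuous_compact_integrable; first exact: segment_compact.
  by apply: continuous_subspaceT; exact: matAX_continuous.
have AXo : leb.-integrable `]0, t] (EFin \o fun s => (A s *m X s w) l 0).
  by apply: integrableS AXi => //; apply: subset_itvr; rewrite bnd_simp.
have fi : leb.-integrable `]0, t] (EFin \o f l).
  by apply: integrableS fint => //; apply: subset_itvl; rewrite bnd_simp.
have -> : \int[leb]_(s in `[0, t]) (B s *m control s w) l 0 =
          \int[leb]_(s in `]0, t]) (f l s + (A s *m X s w) l 0).
  rewrite -Rintegral_itv_obnd_cbnd; last exact: matBcontrol_integrable.
  rewrite /Rintegral; congr fine; apply: ae_eq_integral => //.
  - by apply/measurable_EFinP; apply: measurable_funTS; exact: matBcontrol_measurable.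
  - apply/measurable_EFinP; apply: measurable_funD.
      by apply/measurable_EFinP; exact: measurable_int fi.
    by apply/measurable_EFinP; exact: measurable_int AXo.
  have H1 : {ae leb, forall s : R, forall k, 0 < s < T ->
      (fun j => (G s w k 0 - G (s - j.+1%:R^-1) w k 0) * j.+1%:R) @ \oo --> f k s}.
    apply: (@filter_forall _ _ _ _ (ae_filter_ringOfSetsType leb)) => k.
    by have [_ _] := Hf k.
  (* Convergence of the quotients is available strictly inside ]0, T[, whereas the integral may
     reach [T]. *)
  have H2 : {ae leb, forall s : R, s != T}.
    exists [set T]; split => //; first exact: lebesgue_measure_set1.
    by move=> s /=; apply: contra_notP => /eqP.
  move: H1 H2; apply: (@filterS2 _ _ (ae_filter_ringOfSetsType leb)) => s H1 sT.
  rewrite /= in_itv/= => /andP[s0 st].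
  have sT' : s < T by rewrite lt_neqAle sT (le_trans st).
  have Q k : (fun j => lq j s w k 0) @ \oo --> f k s.
    have := H1 k; rewrite s0 sT' => /(_ isT); apply: cvg_trans.
    rewrite (_ : (fun j => lq j s w k 0) = (fun j => (G s w k 0 - G (s - j.+1%:R^-1) w k 0) * j.+1%:R))//.
    by apply/funext => j; rewrite mxE mulrC; congr (_ * _); rewrite mxE; congr +%R; rewrite mxE.
  congr EFin; rewrite (@control_state _ _ _ _ _ _ _ _ _ cauchy_off phi_ge) ?s0 ?(ltW sT')//; last first.
    by move=> k; apply/cvg_ex; exists (f k s); exact: Q.
  rewrite mxE; congr +%R; rewrite mxE cvg_limn_supE; first exact/cvg_lim.
  by apply/cvg_ex; exists (f l s); exact: Q.
rewrite RintegralD// fE// limD_start subr0 limX_entry.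
rewrite -Rintegral_itv_obnd_cbnd; last exact: AXo.
by rewrite addrACA -!addrA; congr +%R; rewrite [RHS]addrCA.
Qed.
End drift_identity.
Section hitting_limit.
Context {R : realType} {dO : measure_display} {Omega : measurableType dO}.
Variables (P : probability Omega R) (n d : nat) (beta : 'I_d -> R -> Omega -> R).
Variable S : setting R n d.
Local Notation T := (horizon S).
Local Notation y := (target S).
Let hT : 0 < T := horizon_gt0 S.
Local Notation gen := (filtration_gen P beta).
Local Notation Ex f := (Rintegral P setT f).
Variables (phi : nat -> nat) (N : set Omega).
Hypothesis cauchy_off : forall w, ~ N w -> uniformly_cauchy beta S phi w.
Hypothesis hbeta : independent_brownian_motions P beta.
Hypotheses (mN : measurable N) (PN : P N = 0%E).
Hypothesis phi_ge : forall i, (i <= phi i)%N.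
Local Notation X := (limX beta S phi N).
Local Notation tm := (tm T).
Local Notation step := (step T).

Lemma distance_continuous w : continuous (fun t => enorm (X t w - y)).
Proof.
move=> t; apply/cvgrPdist_le => e e0.
have [r r0 Hr] := limX_near cauchy_off w t e0.
exists r => // s /Hr; apply: le_trans.
by rewrite distrC; apply: le_trans (enorm_lipschitz _ _) _; rewrite opprB addrA addrNK enormBC.
Qed.

(** Only countably many times are inspected, which makes the event measurable. By compactness and
    continuity the union over [j] is exactly the event of not hitting. *)
Definition away j : set Omega :=
  [set w | forall m k, (k <= 2 ^ m)%N -> j.+1%:R^-1 <= enorm (X (tm m k) w - y)].

Lemma away_measurable j : measurable (away j).
Proof.
have -> : away j = \bigcap_m \bigcap_(k in [set k | (k <= 2 ^ m)%N])
    ((fun w => enorm (X (tm m k) w - y)) @^-1` `[j.+1%:R^-1, +oo[).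
  apply/seteqP; split => w /= H.
    by move=> m _ k /= km; rewrite in_itv/= andbT; exact: H.
  by move=> m k km; have := H m I k km; rewrite /= in_itv/= andbT.
apply: bigcap_measurable => [|m _]; first by exists 0%N.
apply: bigcap_measurable => [|k _]; first by exists 0%N.
rewrite -[X in measurable X]setTI.
have W : wrtm (gen (clip T (tm m k))) (fun w => X (tm m k) w - y).
  by apply: wrtmB; [exact: (@limX_wrt _ _ _ _ _ _ _ _ _ _ cauchy_off hbeta mN PN)|exact: wrtm_cst].
have W' := wrt_enorm W.
have := wrt_measurable (@augmented_filtration_measurable _ _ _ _ _ _ hbeta (clip T (tm m k))) W'.
by apply => //; exact: measurable_itv.
Qed.

Lemma away_nondecreasing : {homo away : i j / (i <= j)%N >-> (i <= j)%O}.
Proof.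
move=> i j ij; apply/subsetPset => w H m k km; apply: le_trans (H m k km).
by rewrite lef_pV2 ?posrE// ler_nat.
Qed.

Lemma not_hit w : ~ (exists t, 0 <= t <= T /\ enorm (X t w - y) = 0) <-> (\bigcup_j away j) w.
Proof.
have dc := @distance_continuous w; split.
  move=> H; have [c] := EVT_min (ltW hT) (continuous_subspaceT dc).
  rewrite in_itv/= => cT cmin.
  have c0 : 0 < enorm (X c w - y).
    by rewrite lt_def enorm_ge0 andbT; apply/negP => /eqP c0; apply: H; exists c.
  have [j _ Hj] := (cvgrPdist_le _ _).1 (@cvg_harmonic R) _ c0.
  exists j; first exact: I.
  move=> m k km; apply: (@le_trans _ _ (enorm (X c w - y))); last first.
    by apply: cmin; rewrite in_itv/= tm_ge0//= tm_leT.
  by have := Hj j (leqnn _); rewrite /= sub0r normrN ger0_norm.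
move=> [j _ H] [t [tT t0]].
have : - enorm (X t w - y) <= - j.+1%:R^-1.
  apply: (@dyadic_le _ _ hT (fun t => - enorm (X t w - y)) _ 0%N _ _ _ tT).
    by move=> s; apply: cvgN; exact: dc.
  by move=> m k _ km; rewrite lerN2; exact: H.
by rewrite t0 oppr0 oppr_ge0 leNgt invr_gt0 ltr0Sn.
Qed.

(** Once the scheme is uniformly within a quarter of 1/(j+1) of the limit, its distance to the
    target stays above one half of 1/(j+1). *)
Lemma away_far j w : ~ N w -> away j w ->
  exists i0, forall i, (i0 <= i)%N -> far beta S (phi i) (2 * j.+1%:R)^-1 (2 ^ phi i) w.
Proof.
move=> Nw H; have [C [i1 [C0 _ _ HX _]]] := limit_rate cauchy_off w.
have d0 : 0 < (4 * j.+1%:R)^-1 :> R by rewrite invr_gt0 mulr_gt0.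
have [i2 Hi2] := pow2N_le C0 d0.
exists (maxn i1 i2) => i; rewrite geq_max => /andP[ii1 ii2].
apply/allP => k; rewrite mem_iota add0n ltnS /= => km.
have kT : 0 <= tm (phi i) k <= T by rewrite tm_ge0//= tm_leT.
have := HX i (tm (phi i) k) ii1.
rewrite /interpN /driftN /martN memNset// clipK//.
rewrite -/(interp beta S (phi i) (tm (phi i) k) w) interp_grid// => h1.
have := le_trans h1 (Hi2 i ii2).
move: (euler _ _ _ _ _) => V h2.
have h3 := H (phi i) k km.
have h4 := enorm_lipschitz (V - y) (X (tm (phi i) k) w - y).
have h5 : enorm (V - y - (X (tm (phi i) k) w - y)) = enorm (V - X (tm (phi i) k) w).
  by congr enorm; rewrite opprB addrA addrNK.
move: h2 h3 h4 d0; rewrite h5 !invfM ler_norml.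
have j0 : (0 : R) < j.+1%:R^-1 by rewrite invr_gt0.
move: (enorm (V - _)) (enorm (V - y)) (enorm (X _ w - y)) (j.+1%:R^-1) j0 => e1 e2 e3 e4.
lra.
Qed.

(** The radius [dl] is tied to [j] and stays fixed while the level grows, so the error of
    [far_bound], proportional to the step and to 1 / dl, disappears. *)
Lemma away_bound j : 0 < margin S ->
  fine (P (away j)) <= expR ((boundA S + 4 * lipC S ^+ 2) * T) * enorm (start S - y) / (T * margin S).
Proof.
move=> q0; set E0 := _ * enorm _; set q := margin S.
have mA := away_measurable j.
have d0 : 0 < (2 * j.+1%:R)^-1 :> R by rewrite invr_gt0 mulr_gt0.
pose dl : R := (2 * j.+1%:R)^-1; pose K : R := drift_moment S / (2 * dl) / q.
have bound i : Ex (fun w => (far beta S (phi i) dl (2 ^ phi i) w)%:R : R) <= E0 / (T * q) + step (phi i) * K.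
  have := far_bound hbeta (phi i) d0 q0; rewrite -/E0 -/q -/dl.
  have Tq : 0 < T * q by rewrite mulr_gt0.
  move: (Rintegral _ _ _) => e h.
  have -> : E0 / (T * q) + step (phi i) * K = (E0 + T * (step (phi i) * (drift_moment S / (2 * dl)))) / (T * q).
    by rewrite /K; field; rewrite !gt_eqF.
  by rewrite ler_pdivlMr// mulrCA [e * q]mulrC -lerBlDr -mulrBr.
have mfar i : measurable_fun setT (fun w => (far beta S (phi i) dl (2 ^ phi i) w)%:R : R).
  apply: wrt_measurable (@far_wrt _ _ _ _ _ _ _ hbeta S (phi i) dl (2 ^ phi i)%N).
  exact: augmented_filtration_measurable.
(* The indicators of [far] alone need not converge; after this multiplication they are eventually
   equal to that of [away j] off the null set, as Fatou's lemma requires. *)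
pose f i w : R := \1_(away j) w * (far beta S (phi i) dl (2 ^ phi i) w)%:R.
have mf i : measurable_fun setT (f i).
  by apply: measurable_funM => //; exact: measurable_indic.
have L1far i : L1 P (fun w => (far beta S (phi i) dl (2 ^ phi i) w)%:R : R).
  by apply: (L1_le (mfar i) _ (L1_cst P 1)) => w; case: (far _ _ _ _ _ _); rewrite ?normr1 ?normr0.
have f_le i w : 0 <= f i w <= (far beta S (phi i) dl (2 ^ phi i) w)%:R.
  by rewrite /f indicE; case: (w \in _); rewrite ?mul1r ?mul0r ?lexx ?ler0n.
have L1f i : L1 P (f i).
  by apply: (L1_le (mf i) _ (L1far i)) => w; have /andP[? ?] := f_le i w; rewrite ger0_norm.
rewrite -Ex_indic//; apply/ler_addgt0Pr => e e0.
have K0 : 0 < `|K| + 1 by rewrite ltr_wpDl.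
have [i0 _ Hi0] := (cvgrPdist_le _ _).1 (step_cvg0 T) _ (divr_gt0 e0 K0).
suff [_] : L1 P (\1_(away j) : Omega -> R) /\ Ex (\1_(away j) : Omega -> R) <= E0 / (T * q) + e by [].
apply: (@Ex_fatou _ _ _ P (fun i => f (i0 + i)%N) _ N) => //.
- by move=> i w; have /andP[] := f_le (i0 + i)%N w.
- move=> w Nw; have [Dw|Dw] := pselect (away j w); last first.
    rewrite /f indicE memNset//; under eq_fun do rewrite mul0r.
    exact: cvg_cst.
  have [i1 Hi1] := away_far Nw Dw.
  apply: cvg_near_cst; exists i1 => // i /= ii.
  by rewrite /f indicE mem_set// mul1r Hi1// (leq_trans ii) ?leq_addl.
- move=> i; apply: (@le_trans _ _ (Ex (fun w => (far beta S (phi (i0 + i)) dl (2 ^ phi (i0 + i)) w)%:R : R))).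
    by apply: Ex_le => // w; have /andP[] := f_le (i0 + i)%N w.
  apply: le_trans (bound _) _; rewrite lerD2l.
  have := Hi0 (phi (i0 + i)%N) (leq_trans (leq_addr _ _) (phi_ge _)).
  rewrite /= sub0r normrN gtr0_norm ?step_gt0// => h.
  apply: (@le_trans _ _ (step (phi (i0 + i)%N) * (`|K| + 1))).
    by rewrite ler_pM2l ?step_gt0//; apply: le_trans (ler_norm _) _; rewrite lerDl.
  by rewrite -ler_pdivlMr.
Qed.

Lemma hitting_probability : 0 < margin S ->
  let hit := [set w | exists t, 0 <= t <= T /\ enorm (X t w - y) = 0] in
  measurable hit /\
  ((1 - expR ((boundA S + 4 * lipC S ^+ 2) * T) * enorm (start S - y) / (T * margin S))%:E <= P hit)%E.
Proof.
move=> q0 hit; set c := _ / _.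
have mU : measurable (\bigcup_j away j) by apply: bigcup_measurable => j _; exact: away_measurable.
have hE : hit = ~` \bigcup_j away j.
  apply/seteqP; split => w; first by move=> hw /not_hit.
  by move=> /= H; apply: contrapT => /not_hit.
rewrite hE; split; first exact: measurableC.
rewrite probability_setC// -(fineK (fin_num_measure P _ mU)) -EFinB lee_fin lerD2l lerN2.
have := nondecreasing_cvg_mu (mu := P) away_measurable mU away_nondecreasing.
move=> cv; rewrite -lee_fin (fineK (fin_num_measure P _ mU)).
apply: (cvge_le _ cv); near=> j.
by rewrite /= -(fineK (fin_num_measure P _ (away_measurable j))) lee_fin; exact: away_bound.
Unshelve. all: by end_near.
Qed.
End hitting_limit.

(** * The closed loop *)

Lemma sum_sqr_le {R : realType} (I : Type) (r : seq I) (f : I -> R) : (forall i, 0 <= f i) ->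
  \sum_(i <- r) f i ^+ 2 <= (\sum_(i <- r) f i) ^+ 2.
Proof.
move=> f0; suff [] : 0 <= \sum_(i <- r) f i /\ \sum_(i <- r) f i ^+ 2 <= (\sum_(i <- r) f i) ^+ 2 by [].
elim: r => [|i r [ih0 ih]]; first by rewrite !big_nil expr0n.
rewrite !big_cons addr_ge0//; split => //; rewrite sqrrD.
by have := mulr_ge0 (f0 i) ih0; lra.
Qed.

Lemma ler_enorm_sum_entries {R : realType} m n (M : 'M[R]_(m, n)) :
  enorm M <= \sum_i \sum_j `|M i j|.
Proof.
have s0 i : 0 <= \sum_j `|M i j| by apply: sumr_ge0.
have S0 : 0 <= \sum_i \sum_j `|M i j| by apply: sumr_ge0.
rewrite -(@ler_pXn2r _ 2)// ?nnegrE ?enorm_ge0// enorm_sqr.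
apply: le_trans (sum_sqr_le _ s0); apply: ler_sum => i _.
rewrite (eq_bigr (fun j => `|M i j| ^+ 2)) => [|j _]; last by rewrite real_normK ?num_real.
exact: sum_sqr_le.
Qed.

Lemma enorm_mxvec {R : realType} m n (M : 'M[R]_(m, n)) : enorm (mxvec M)^T = enorm M.
Proof.
have -> : enorm M = Num.sqrt (\sum_k mxvec M 0 k ^+ 2).
  rewrite /enorm pair_bigA (reindex _ (curry_mxvec_bij _ _)) /=.
  by congr Num.sqrt; apply: eq_bigr => -[i j] _; rewrite mxvecE.
by congr Num.sqrt; apply: eq_bigr => k _; rewrite big_ord1 mxE.
Qed.

(** Flattening a matrix to a vector preserves the norm and carries over the triangle inequality. *)
Lemma ler_enorm_distM {R : realType} m n (L M N : 'M[R]_(m, n)) :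
  enorm (L - N) <= enorm (L - M) + enorm (M - N).
Proof. by rewrite -(enorm_mxvec (L - N)) -(enorm_mxvec (L - M)) -(enorm_mxvec (M - N)) !linearB/=;
  exact: ler_enorm_dist. Qed.

(** * Bounds and a modulus of continuity for the coefficients *)

Section coefficients.
Context {R : realType}.
Variable T : R.
Hypothesis hT : 0 < T.
Local Notation clip := (clip T).
Local Notation step := (step T).

Section modulus.
Variables (n : nat) (M : R -> 'M[R]_n).
Hypothesis hM : {within `[0, +oo[, continuous M}.

Lemma clip_entry_continuous i j : continuous (fun t => M (clip t) i j).
Proof.
have H : {within `[0, +oo[, continuous (fun t => M t i j)}.
  apply/subspace_continuousP => t t0; have /subspace_continuousP/(_ t t0) H := hM.
  exact: (@cvg_comp _ _ _ _ _ _ _ _ H (@coord_continuous R n n i j (M t))).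
move=> t; apply: (@continuous_comp _ _ _ (fun t => Num.min t T) (fun t => M (Num.max 0 t) i j)).
  by apply: (@continuous_min _ _ (fun t => t) (fun=> T)); [exact: cvg_id|exact: cvg_cst].
exact: (@continuous_max0 _ _ H).
Qed.

Lemma clip_near t e : 0 < e -> \forall s \near t, enorm (M (clip s) - M (clip t)) <= e.
Proof.
move=> e0.
have gc : continuous (fun s => \sum_i \sum_j `|M (clip s) i j - M (clip t) i j|).
  apply: continuous_sum => i; apply: continuous_sum => j s.
  apply: (continuous_comp (f := fun s => M (clip s) i j - M (clip t) i j)); last exact: norm_continuous.
  by apply: cvgB; [exact: clip_entry_continuous|exact: cvg_cst].
have /cvgrPdist_le/(_ _ e0) := gc t.
apply: filterS => s.
rewrite [X in X - _]big1; last by move=> i _; rewrite big1// => j _; rewrite subrr normr0.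
rewrite sub0r normrN ger0_norm; last by apply: sumr_ge0 => i _; apply: sumr_ge0.
apply: le_trans; apply: le_trans (ler_enorm_sum_entries _) _.
by apply: ler_sum => i _; apply: ler_sum => j _; rewrite !mxE.
Qed.

Lemma clip_bounded : exists a, forall t, enorm (M (clip t)) <= a.
Proof.
have gc : continuous (fun s => \sum_i \sum_j `|M (clip s) i j|).
  apply: continuous_sum => i; apply: continuous_sum => j s.
  apply: (continuous_comp (f := fun s => M (clip s) i j)); last exact: norm_continuous.
  exact: clip_entry_continuous.
have [c _ Hc] := EVT_max (ltW hT) (continuous_subspaceT gc).
exists (\sum_i \sum_j `|M (clip c) i j|) => t.
have -> : clip t = clip (clip t) by rewrite (clipK (clip_in t hT)).
apply: le_trans (ler_enorm_sum_entries _) _; apply: Hc.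
by rewrite in_itv/=; exact: clip_in.
Qed.

(** Heine's theorem on [0, T]: continuity at each point gives a neighbourhood and a level that work
    together, and compactness provides one level for the whole interval. *)
Lemma clip_uniform e : 0 < e -> \forall m \near \oo,
  forall s t, `|s - t| <= step m -> enorm (M (clip s) - M (clip t)) <= e.
Proof.
move=> e0; have e2 : 0 < e / 2 by rewrite divr_gt0.
pose ok m s := forall t, `|s - t| <= step m -> enorm (M (clip s) - M (clip t)) <= e.
have H := (compact_near_coveringP `[0, T]%classic).1 (@segment_compact _ _ _) nat \oo ok _ _.
have K : \forall m \near \oo, `[0, T]%classic `<=` ok m.
  apply: H => s0 _.
  have /nbhs_ballP[r r0 Hr] := clip_near s0 e2.
  have r2 : 0 < r / 2 by rewrite divr_gt0.
  exists ([set s | `|s0 - s| < r / 2], [set m | step m < r / 2]) => /=.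
    split; first by exists (r / 2).
    have /cvgrPdist_lt/(_ _ r2) := step_cvg0 T.
    by apply: filterS => m; rewrite /= sub0r normrN ger0_norm// ltW// step_gt0.
  move=> [s m] /= [ss mr] t st.
  have h1 : enorm (M (clip s) - M (clip s0)) <= e / 2.
    by apply: Hr; apply: lt_trans ss _; rewrite ltr_pdivrMr// ltr_pMr// ltr1n.
  have h2 : enorm (M (clip t) - M (clip s0)) <= e / 2.
    apply: Hr => /=; apply: le_lt_trans (ler_distD s _ _) _.
    by rewrite [ltRHS]splitr ltrD// (le_lt_trans st).
  apply: le_trans (ler_enorm_distM _ (M (clip s0)) _) _.
  rewrite [leRHS]splitr; apply: lerD h1 _.
  by rewrite -enormN opprB.
move: K; apply: filterS => m K s t st.
have -> : clip s = clip (clip s) by rewrite (clipK (clip_in s hT)).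
have -> : clip t = clip (clip t) by rewrite (clipK (clip_in t hT)).
apply: K; first by rewrite /= in_itv/=; exact: clip_in.
by apply: le_trans st; exact: clip_lipschitz.
Qed.

Lemma clip_modulus : exists mod : nat -> R, [/\ forall m, 0 <= mod m, mod @ \oo --> 0 &
  forall m s t, `|s - t| <= step m -> enorm (M (clip s) - M (clip t)) <= mod m].
Proof.
have [a Ha] := clip_bounded.
pose E m := [set enorm (M (clip p.1) - M (clip p.2)) | p in [set p : R * R | `|p.1 - p.2| <= step m]].
have E0 m : E m 0.
  by exists (0, 0) => /=; rewrite ?subrr ?enorm0// normr0 ltW// step_gt0.
have Eub m : has_sup (E m).
  split; first by exists 0; exact: E0.
  exists (a + (a + a)) => _ [[s t] /= _ <-].
  apply: le_trans (ler_enorm_distM _ 0 _) _.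
  rewrite subr0 sub0r enormN; have := Ha s; have := Ha t; have := enorm_ge0 (M (clip s)); lra.
have up m s t : `|s - t| <= step m -> enorm (M (clip s) - M (clip t)) <= sup (E m).
  by move=> st; apply: sup_upper_bound => //; exists (s, t).
have ge0 m : 0 <= sup (E m) by apply: sup_upper_bound.
exists (fun m => sup (E m)); split => //.
apply/cvgrPdist_le => e e0; have := clip_uniform e0; apply: filterS => m H.
rewrite sub0r normrN ger0_norm//; apply: ge_sup; first by exists 0; exact: E0.
by move=> _ [[s t] /= st <-]; exact: H.
Qed.
End modulus.
End coefficients.

Section closed_loop.
Context {R : realType} {dO : measure_display} {Omega : measurableType dO}.
Variables (P : probability Omega R) (n d : nat) (beta : 'I_d -> R -> Omega -> R).
Hypothesis hbeta : independent_brownian_motions P beta.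
Variable S : setting R n d.
Local Notation T := (horizon S).
Local Notation y := (target S).
Let hT : 0 < T := horizon_gt0 S.

(** All candidate times lie in [0, T] and the infimum of the empty set is +oo, so the inequality
    only expresses that some candidate exists. *)
Lemma hitting_time_le (X : R -> Omega -> 'cV[R]_n) w :
  (hitting_time T X y w <= T%:E)%E <-> exists t, 0 <= t <= T /\ enorm (X t w - y) = 0.
Proof.
split=> [h|[t [tT t0]]].
  apply: contrapT => H; move: h; rewrite /hitting_time (_ : [set _ | _ in _] = set0).
    by rewrite ereal_inf0 leye_eq.
  by apply/seteqP; split => // r [t ht _]; apply: H; exists t.
apply: (@le_trans _ _ t%:E); first by apply: ereal_inf_lbound; exists t.
by rewrite lee_fin; have /andP[] := tT.
Qed.

Lemma closed_loop (A B : R -> 'M[R]_n) :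
  (forall t, 0 <= t <= T -> matA S t = A t) -> (forall t, 0 <= t <= T -> matB S t = B t) ->
  exists u X : R -> Omega -> 'cV[R]_n,
    [/\ adapted (augmented_filtration P beta) `]0, T[ u, Linfty_control P T u,
        sde_solution P beta T A B (noise S) u (start S) X,
        0 < margin S ->
        ((1 - expR ((boundA S + 4 * lipC S ^+ 2) * T) * enorm (start S - y) / (T * margin S))%:E
           <= P [set w | (hitting_time T X y w <= T%:E)%E])%E &
        {ae P, forall w, forall t, 0 < t < T ->
          [set - gain S *: theta | theta in sign_map ((B t)^T *m (X t w - y))] (u t w)}].
Proof.
move=> eA eB; have [phi [N [phi_ge phi_nd mN PN cauchy_off]]] := exists_cauchy_subsequence hbeta S.
pose u := control beta S phi N; pose X := limX beta S phi N.
have ub t w := feedback_bounds S (matB S t) (invmx (matB S t)) (matA S t) (X t w) (drift_slope beta S phi N t w).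
exists u, X; split.
- move=> t; rewrite /= in_itv/= => /andP[t0 _] i.
  exact: (@control_wrt _ _ _ _ _ _ _ _ _ _ cauchy_off hbeta mN PN t (ltW t0) i 0).
- split; first by move=> i; apply: measurable_funTS;
  exact: (@control_joint _ _ _ _ _ _ _ _ _ _ cauchy_off hbeta mN PN).
  by exists (gain S); apply: aeW => -[t w] _; have [] := ub t w.
- split.
  + move=> w; apply: continuous_subspaceT => t U [Q Qn QU].
    (* A neighbourhood of a matrix contains a product of neighbourhoods of its finitely many
       entries, so continuity of the entries is enough. *)
    have H : \forall s \near t, forall i j, Q i j (X s w i j).
      apply: (@filter_forall _ _ _ _ (nbhs_filter t)) => i.
      apply: (@filter_forall _ _ _ _ (nbhs_filter t)) => j; rewrite ord1.
      exact: (@limX_continuous _ _ _ _ _ _ _ _ _ cauchy_off i w t _ (Qn i 0)).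
    by move: H; apply: filterS => s H; apply: QU.
  + move=> t; rewrite /= in_itv/= => tT i.
    have := @limX_wrt _ _ _ _ _ _ _ _ _ _ cauchy_off hbeta mN PN t i 0; rewrite clipK//.
  + move=> t tT; exists (fun i j => limM beta S phi N i j t); split.
      by move=> i j; exact: limM_ito.
    exists N; split => // w /= nh; apply: contrapT => Nw; apply: nh => i.
    have sub s : s \in `[0, t]%classic -> 0 <= s <= T.
      by rewrite inE/= in_itv/= => /andP[-> st]; rewrite (le_trans st)//; case/andP: tT.
    have -> : \int[lebesgue_measure]_(s in `[0, t]) (A s *m X s w) i 0 =
              \int[lebesgue_measure]_(s in `[0, t]) (matA S s *m X s w) i 0.
      by apply: eq_Rintegral => s /sub /eA ->.
    have -> : \int[lebesgue_measure]_(s in `[0, t]) (B s *m u s w) i 0 =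
              \int[lebesgue_measure]_(s in `[0, t]) (matB S s *m u s w) i 0.
      by apply: eq_Rintegral => s /sub /eB ->.
    exact: (@drift_identity _ _ _ _ _ _ _ _ _ _ cauchy_off hbeta mN PN phi_ge w t i Nw tT).
- move=> q0; have [_] := @hitting_probability _ _ _ _ _ _ _ _ _ _ cauchy_off hbeta mN PN phi_ge q0.
  rewrite (_ : [set w | _] = [set w | (hitting_time T X y w <= T%:E)%E])//.
  by apply/seteqP; split => w /=; move/hitting_time_le.
- apply: aeW => w t /andP[t0 tT]; have tT' : 0 <= t <= T by rewrite !ltW.
  rewrite -eB//; have [h1 h2] := ub t w.
  exact: sign_inclusion (gain_gt0 S) h1 h2.
Qed.
End closed_loop.

Theorem theorem2p1 (R : realType) (dO : measure_display)
  (Omega : measurableType dO) (P : probability Omega R)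
  (n d : nat) (beta : 'I_d -> R -> Omega -> R)
  (hbeta : independent_brownian_motions P beta)
  (T : R) (hT : 0 < T)
  (A B : R -> 'M[R]_n)
  (hA : {within `[0, +oo[, continuous A})
  (hB : {within `[0, +oo[, continuous B})
  (gamma : R) (hgamma : 0 < gamma)
  (hBB : forall t, 0 <= t -> psd (B t *m (B t)^T - (gamma ^+ 2)%:M))
  (sigma : 'cV[R]_n -> 'M[R]_(n, d)) (hsigma : lipschitz_map sigma) :
  exists eta Cstar : R, [/\ 0 < eta, 0 < Cstar &
    forall x y : 'cV[R]_n, sigma y = 0 -> forall rho : R, 0 < rho ->
    exists u X : R -> Omega -> 'cV[R]_n,
      [/\ adapted (augmented_filtration P beta) `]0, T[ u,
          Linfty_control P T u,
          sde_solution P beta T A B sigma u x X,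
          ((1 - (rho * eta)^-1 *
                (enorm y + (1 - expR (- (Cstar * T)))^-1 * enorm (x - y)))%:E
           <= P [set w | (hitting_time T X y w <= T%:E)%E])%E &
          {ae P, forall w, forall t, 0 < t < T ->
            [set - rho *: theta | theta in sign_map ((B t)^T *m (X t w - y))]
              (u t w)}]].
Proof.
have [a0 Ha0] := clip_bounded hT hA; have [b0 Hb0] := clip_bounded hT hB.
have [mA [mA0 mAc HmA]] := clip_modulus hT hA; have [mB [mB0 mBc HmB]] := clip_modulus hT hB.
have [L0 HL0] := hsigma.
pose a := Num.max a0 0; pose b := Num.max b0 0; pose L := Num.max L0 0.
have ge0 (r : R) : 0 <= Num.max r 0 by rewrite le_max lexx orbT.
have Ha t : enorm (A (clip T t)) <= a by rewrite le_max Ha0.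
have Hb t : enorm (B (clip T t)) <= b by rewrite le_max Hb0.
have HL u v : enorm (sigma u - sigma v) <= L * enorm (u - v).
  by apply: le_trans (HL0 u v) _; rewrite ler_wpM2r ?enorm_ge0// le_max lexx.
have hmA m s t : `|s - t| <= step T m -> enorm (A (clip T s) - A (clip T t)) <= mA m + mB m.
  by move=> st; apply: le_trans (HmA m s t st) _; rewrite lerDl.
have hmB m s t : `|s - t| <= step T m -> enorm (B (clip T s) - B (clip T t)) <= mA m + mB m.
  by move=> st; apply: le_trans (HmB m s t st) _; rewrite lerDr.
have hm0 m : 0 <= mA m + mB m by rewrite addr_ge0.
have hmc : (fun m => mA m + mB m) @ \oo --> 0 by rewrite -(addr0 0); exact: cvgD.
have hBc t : psd (B (clip T t) *m (B (clip T t))^T - (gamma ^+ 2)%:M).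
  by apply: hBB; have /andP[] := clip_in t hT.
pose C := a + 4 * L ^+ 2; pose E := expR (C * T).
have E1 : 1 <= E by rewrite -expR0 ler_expR mulr_ge0 ?(ltW hT)// addr_ge0 ?ge0// mulr_ge0 ?sqr_ge0.
have E0 : 0 < E by rewrite expR_gt0.
(* [e1] ensures a |y| <= rho gamma / 2 whenever |y| < rho e1, with a + 1 to avoid dividing by 0;
   [e2] is chosen so that E / (T (rho gamma / 2)) equals 1 / (rho e2). *)
pose e1 := gamma / (2 * (a + 1)); pose e2 := T * gamma / (2 * E).
have a1 : 0 < a + 1 by rewrite ltr_wpDl ?ge0.
have e10 : 0 < e1 by rewrite divr_gt0// mulr_gt0.
have e20 : 0 < e2 by rewrite divr_gt0// mulr_gt0.
pose eta := Num.min e1 e2.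
have eta0 : 0 < eta by rewrite lt_min e10.
(* With this [Cstar] the factor in front of |x - y| is at least 1, which is all that the estimate
   asks of it. *)
exists eta, 1; split => // x y sy rho rho0.
pose S := @Setting R n d T (fun t => A (clip T t)) (fun t => B (clip T t)) sigma x y rho a b L
  (fun m => mA m + mB m) gamma hT rho0 (ge0 _) (ge0 _) (ge0 _) hgamma Ha Hb hm0 hmA hmB hmc hBc HL sy.
have [u [X [h1 h2 h3 h4 h5]]] := @closed_loop R dO Omega P n d beta hbeta S A B
  (fun t tT => congr1 A (clipK tT)) (fun t tT => congr1 B (clipK tT)).
exists u, X; split => //.
have q1 : 1 <= (1 - expR (- (1 * T)))^-1.
  rewrite mul1r invf_ge1; first by rewrite gerBl expR_ge0.
  by rewrite subr_gt0 expR_lt1 oppr_lt0.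
have D0 := enorm_ge0 (x - y).
have D1 : enorm (x - y) <= (1 - expR (- (1 * T)))^-1 * enorm (x - y) by rewrite ler_peMl.
set D := _^-1 * enorm (x - y) in D1 *.
have re0 : 0 < rho * eta by rewrite mulr_gt0.
have [yr|yr] := leP (rho * eta) (enorm y).
  apply: (@le_trans _ _ 0%E); last exact: measure_ge0.
  rewrite lee_fin subr_le0 mulrC ler_pdivlMr// mul1r; apply: le_trans yr _.
  by rewrite lerDl (le_trans D0).
have mS : rho * gamma / 2 <= margin S.
  rewrite /margin /=; have ye : enorm y <= rho * e1.
    by apply: le_trans (ltW yr) _; rewrite ler_pM2l// ge_min lexx.
  have : a * enorm y <= rho * gamma / 2.
    apply: (@le_trans _ _ ((a + 1) * (rho * e1))).
      by apply: ler_pM => //; [exact: ge0|exact: enorm_ge0|rewrite lerDl].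
    by rewrite /e1 le_eqVlt; apply/orP; left; apply/eqP; field; rewrite gt_eqF.
  lra.
have m0 : 0 < rho * gamma / 2 by rewrite divr_gt0// mulr_gt0.
have mS0 : 0 < margin S := lt_le_trans m0 mS.
apply: le_trans (h4 mS0); rewrite lee_fin lerD2l lerN2 /=.
apply: (@le_trans _ _ (E * enorm (x - y) / (T * (rho * gamma / 2)))).
  rewrite ler_wpM2l ?mulr_ge0 ?(ltW E0)// lef_pV2 ?posrE ?mulr_gt0// ler_pM2l//.
apply: (@le_trans _ _ ((rho * e2)^-1 * enorm (x - y))).
  by rewrite /e2 le_eqVlt; apply/orP; left; apply/eqP; field; rewrite !gt_eqF.
apply: ler_pM => //; first by rewrite invr_ge0 ltW// mulr_gt0.
  by rewrite (invfM rho e2) (invfM rho eta) ler_pM2l ?invr_gt0// lef_pV2 ?posrE// ge_min lexx orbT.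
by apply: le_trans D1 _; rewrite lerDr enorm_ge0.
Qed.
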